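(* Let $V$ be a $C_\infty$-algebra, and write $\Pi:=\prod_{k=1}^\infty(\Sigma V^* )^{\hat\otimes k}$ and $\Pi_Z:=\prod_{k=1}^\infty\left((\Sigma V^* )^{\hat\otimes k}\right)_{Z_k}$. (i) The cyclic Hochschild complex $CC^\bullet_{\mathrm{Hoch}}(V)$ splits as a direct product of the subcomplexes $\Sigma(e(i)[\Pi_Z])$: $$CC^\bullet_{\mathrm{Hoch}}(V)=\prod_{i=1}^\infty\left(\Sigma\left(e(i)[\Pi_Z]\right),b'\right).$$ (ii) Let $Q_i:=\Sigma(e(i)[\Pi])$ and $\widetilde Q_i:=\Sigma(\tilde e(i)[\Pi])$. The Tsygan bicomplex $CC^{\bullet\bullet}_{\mathrm{Tsygan}}(V)$ splits as a direct product of subcomplexes $$CC^{\bullet\bullet}_{\mathrm{Tsygan}}(V)=\prod_{i=0}^\infty\Gamma_i,$$ where $\Gamma_i$ is the subcomplex $$(\widetilde Q_i,b)\xrightarrow{1-z}(Q_i,b')\xrightarrow{N}(\widetilde Q_{i-1},b)\xrightarrow{1-z}(Q_{i-1},b')\xrightarrow{N}\cdots\xrightarrow{1-z}(Q_1,b')\xrightarrow{N}(\widetilde Q_0,b).$$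
   Context: Conventions. $\mathbb K$ is an evenly graded commutative ring containing $\mathbb Q$; all modules are graded $\mathbb K$-modules, cohomologically graded, and the Koszul sign rule is used. $(\Sigma V)^i=V^{i+1}$, $(\Sigma^{-1}V)^i=V^{i-1}$; $\Sigma V^*$ means $\mathrm{Hom}_{\mathbb K}(\Sigma V,\mathbb K)$. A profinite module is an inverse limit of free modules of finite rank with the inverse limit topology; $\hat\otimes$ is the completed tensor product. For a profinite module $W$, $\widehat TW=\prod_{i\ge 0}W^{\hat\otimes i}$, and $\widehat LW\subset\widehat TW$ is the Lie subalgebra (for the graded commutator) of all convergent (possibly infinite) linear combinations of Lie monomials. Vector field = continuous derivation. $C_\infty$-algebra. Let $V$ be a free graded module. A $C_\infty$-structure on $V$ is a vector field $m:\widehat L\Sigma V^*\to\widehat L\Sigma V^*$ of degree one with $m^2=0$. It extends uniquely to a vector field, again denoted $m$, on $\widehat T\Sigma V^*$ (of degree one, with $m^2=0$). Associative forms. For $X=\widehat TW$, $\Omega^1_{\mathrm{Ass}}(X)=X\hat\otimes(X/\mathbb K)$ with elements written $x\,dy$, a bimodule via $a\cdot x\,dy=ax\,dy$, $x\,dy\cdot a=x\,d(ya)-xy\,da$; $\Omega^\bullet_{\mathrm{Ass}}(X)=\widehat T_X(\Sigma^{-1}\Omega^1_{\mathrm{Ass}}(X))$ with the unique differential $d$ extending $x\mapsto dx$; $DR^\bullet_{\mathrm{Ass}}(X)=\Omega^\bullet_{\mathrm{Ass}}(X)/[\Omega^\bullet_{\mathrm{Ass}}(X),\Omega^\bullet_{\mathrm{Ass}}(X)]$,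 where the denominator consists of convergent combinations of graded commutators. $DR^i$ is the $i$-fold suspension of the part of form-degree $i$; $DR^0_{\mathrm{Ass}}(X)=X/[X,X]$. For a vector field $\xi$ on $X$, the Lie derivative $L_\xi$ is the derivation of $\Omega^\bullet_{\mathrm{Ass}}(X)$ with $L_\xi(x)=\xi(x)$, $L_\xi(dx)=(-1)^{|\xi|}d(\xi(x))$; it induces $L_\xi$ on $DR^\bullet_{\mathrm{Ass}}(X)$. There is an isomorphism $\Theta_{\mathrm{Ass}}:\prod_{k\ge1}W^{\hat\otimes k}=W\hat\otimes\widehat TW\to DR^1_{\mathrm{Ass}}(\widehat TW)$, $x\otimes y\mapsto dx\cdot y$. Cyclic operators. $Z_n$ is the cyclic group of order $n$, acting on $W^{\hat\otimes n}$ through its generator $z_n$, $z_n(x_1\otimes\dots\otimes x_n)=(-1)^{|x_1|(|x_2|+\dots+|x_n|)}x_2\otimes\dots\otimes x_n\otimes x_1$; subscript $Z_n$ denotes coinvariants. $N_n=1+z_n+\dots+z_n^{n-1}$. On $\prod_{n\ge1}W^{\hat\otimes n}$, $z$ acts as $z_n$ and $N$ as $N_n$ on the $n$-th factor. Complexes. With $W=\Sigma V^*$: $b'$ is the restriction of $m$ to $\Pi$, and $b:=\Theta_{\mathrm{Ass}}^{-1}L_m\Theta_{\mathrm{Ass}}$ on $\Pi$. The cyclic Hochschild complex $CC^\bullet_{\mathrm{Hoch}}(V)$ is the suspension of the module of elements of $DR^0_{\mathrm{Ass}}(\widehat T\Sigma V^* )$ vanishing at zero (zero constant term), with differential $L_m$;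 it is identified with $(\Sigma\Pi_Z,b')$, where $b'$ also denotes the map induced on coinvariants. The Tsygan bicomplex is $$(\Sigma\Pi,b)\xrightarrow{1-z}(\Sigma\Pi,b')\xrightarrow{N}(\Sigma\Pi,b)\xrightarrow{1-z}\cdots$$ with columns numbered $0,1,2,\dots$ from the left. Idempotents. $\widehat TW$ is a Hopf algebra with multiplication $\mu$ and the cocommutative (shuffle) coproduct $\Delta$, the continuous algebra homomorphism with $\Delta(w)=w\otimes1+1\otimes w$ for $w\in W$. Let $s=\mu\Delta$, with components $s_n:W^{\hat\otimes n}\to W^{\hat\otimes n}$. Put $\lambda_i=2^i$. Define $e(i):\widehat TW\to\widehat TW$, $i\ge0$, with components on $W^{\hat\otimes n}$ $$e_n(i)=\Big[\prod_{0\le r\le n,\,r\ne i}(\lambda_i-\lambda_r)\Big]^{-1}\prod_{0\le r\le n,\,r\neq i}(s_n-\lambda_r\mathrm{id})\ \ (0\le i\le n),\qquad e_n(i)=0\ \ (i>n).$$ Define $\tilde e(i):=1\hat\otimes e(i)$ on $W\hat\otimes\widehat TW=\prod_{k\ge1}W^{\hat\otimes k}$. For $i\ge1$ the operators $e(i)$ descend to $\Pi_Z$ and are denoted by the same symbol there. *)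

(* Defs.v *)
From mathcomp Require Import all_boot all_order all_algebra.
From mathcomp Require Import boolp classical_sets functions cardinality fsbigop.

Set Implicit Arguments.
Unset Strict Implicit.
Unset Printing Implicit Defensive.

Import GRing.Theory.
Local Open Scope ring_scope.
Local Open Scope classical_set_scope.

(* An internal grading K = \bigoplus_i gr i concentrated in even degrees.
   Together with the commutativity of K this makes K graded commutative. *)
Record even_grading (K : comNzRingType) := EvenGrading {
  gr :> int -> K -> Prop;
  gr0 : forall i, gr i 0;
  grB : forall i x y, gr i x -> gr i y -> gr i (x - y);
  gr1 : gr 0 1;
  grM : forall i j x y, gr i x -> gr j y -> gr (i + j) (x * y);
  gr_odd : forall i x, odd `|i|%N -> gr i x -> x = 0;
  gr_span : forall x, exists (s : seq int) (c : int -> K),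
    (forall i, gr i (c i)) /\ x = \sum_(i <- s) c i;
  gr_direct : forall (s : seq int) (c : int -> K), uniq s ->
    (forall i, gr i (c i)) -> \sum_(i <- s) c i = 0 ->
    forall i, i \in s -> c i = 0
}.

(* A free graded module, given by a homogeneous basis: V is the direct sum of
   the K e_a, with e_a in degree basis_deg a. *)
Record free_graded_module := FreeGradedModule {
  basis : choiceType;
  basis_deg : basis -> int
}.

(* Unconditional convergence of a family of functions T -> K for the topology
   of pointwise convergence, K being discrete. *)
Definition has_sum (K : comNzRingType) (T : Type) (I : choiceType)
    (F : I -> T -> K) (f : T -> K) : Prop :=
  forall t, finite_set [set i | F i t != 0] /\ f t = \sum_(i \in setT) F i t.

Definition scal (K : comNzRingType) (T : Type) (c : K) (f : T -> K) : T -> K :=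
  fun t => c * f t.
Local Infix "*+:" := scal (at level 40).

Section Series.

(* K contains Q: it is a nonzero commutative Q-algebra. *)
Variables (K : comAlgType rat) (G : even_grading K) (V : free_graded_module).

(* W = \Sigma V^* has the topological basis t_a (a : basis V) dual to the basis
   of \Sigma V; as e_a has degree |e_a| - 1 in \Sigma V, |t_a| = 1 - |e_a|.
   The words t_{a_1} ... t_{a_n} form the topological basis of the n-th
   completed tensor power of W, so that \hat T W is the algebra of
   noncommutative formal power series in the t_a. *)
Definition word := seq (basis V).
Definition letter_deg (a : basis V) : int := 1 - basis_deg a.
Definition word_deg (w : word) : int := \sum_(a <- w) letter_deg a.

(* The series f stands for the sum of the f w * w. All series are allowed; the
   graded module \hat T W consists of its homogeneous parts [homog d]. As K is
   even, the Koszul signs only involve the degrees of the words. The inverse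
   limit topology is that of pointwise convergence. *)
Local Notation X := (word -> K).

Definition homog (d : int) (f : X) : Prop := forall w, G (d - word_deg w) (f w).

Definition ksign (i j : int) : K := (-1) ^+ absz (i * j).

Definition mono (w : word) : X := fun u => (u == w)%:R.

Definition mul (x y : X) : X := fun w =>
  \sum_(i < (size w).+1) x (take i w) * y (drop i w).

(* The graded commutator of x and y, of degrees d and e. *)
Definition bracket (d e : int) (x y : X) : X :=
  mul x y - ksign d e *+: mul y x.

(* The component of f in the n-th completed tensor power. *)
Definition tensor_part (n : nat) (f : X) : X := fun w =>
  if size w == n then f w else 0.

Definition continuous_on (L : X -> Prop) (xi : X -> X) : Prop :=
  forall w, exists s : seq word,
    forall f, L f -> (forall u, u \in s -> f u = 0) -> xi f w = 0.

Definition linear_on (L : X -> Prop) (xi : X -> X) : Prop :=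
  forall (c : K) f g, L f -> L g -> xi (c *+: f + g) = c *+: xi f + xi g.

Definition degree_on (L : X -> Prop) (k : int) (xi : X -> X) : Prop :=
  forall d f, L f -> homog d f -> homog (d + k) (xi f).

Inductive lie_monomial : int -> X -> Prop :=
| lie_letter a : lie_monomial (letter_deg a) (mono [:: a])
| lie_bracket d e x y : lie_monomial d x -> lie_monomial e y ->
    lie_monomial (d + e) (bracket d e x y).

(* \hat L W *)
Definition lie_series (f : X) : Prop :=
  exists (I : choiceType) (c : I -> K) (d : I -> int) (x : I -> X),
    (forall i, lie_monomial (d i) (x i)) /\ has_sum (fun i => c i *+: x i) f.

(* Only the values of m on \hat L W matter. *)
Record lie_vector_field (k : int) (m : X -> X) : Prop := LieVectorField {
  lvf_stable : forall f, lie_series f -> lie_series (m f);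
  lvf_linear : linear_on lie_series m;
  lvf_continuous : continuous_on lie_series m;
  lvf_degree : degree_on lie_series k m;
  lvf_derivation : forall d e f g, lie_series f -> lie_series g ->
    homog d f -> homog e g ->
    m (bracket d e f g) =
      bracket (d + k) e (m f) g + ksign k d *+: bracket d (e + k) f (m g)
}.

Record vector_field (k : int) (m : X -> X) : Prop := VectorField {
  vf_linear : linear_on (fun=> True) m;
  vf_continuous : continuous_on (fun=> True) m;
  vf_degree : degree_on (fun=> True) k m;
  vf_derivation : forall d f g, homog d f ->
    m (mul f g) = mul (m f) g + ksign k d *+: mul f (m g)
}.

Record Cinfty_structure (m : X -> X) : Prop := CinftyStructure {
  Cinfty_vf : lie_vector_field 1 m;
  Cinfty_sq : forall f, lie_series f -> m (m f) = 0
}.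

(* One-forms: F stands for the sum of the F (u, v) * (u dv) in
   X \hat\otimes (X / K), where X / K is identified with the series without
   constant term, whence the condition F (u, [::]) = 0 in [homog_form]. *)
Local Notation Omega1 := (word * word -> K).

Definition homog_form (d : int) (F : Omega1) : Prop :=
  (forall u, F (u, [::]) = 0) /\
  forall u v, G (d - word_deg u - word_deg v) (F (u, v)).

Definition dform (y : X) : Omega1 := fun p =>
  if (p.1 == [::]) && (p.2 != [::]) then y p.2 else 0.

(* a . x dy = ax dy *)
Definition lact (a : X) (F : Omega1) : Omega1 := fun p =>
  \sum_(i < (size p.1).+1) a (take i p.1) * F (drop i p.1, p.2).

(* x dy . a = x d(ya) - xy da *)
Definition ract (F : Omega1) (a : X) : Omega1 := fun p =>
  if p.2 == [::] then 0 else
  \sum_(j < (size p.2).+1) F (p.1, take j p.2) * a (drop j p.2)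
  - \sum_(i < (size p.1).+1) F (take i p.1, drop i p.1) * a p.2.

(* [X, X] *)
Definition comm0 (f : X) : Prop :=
  exists (I : choiceType) (d e : I -> int) (x y : I -> X),
    [/\ forall i, homog (d i) (x i), forall i, homog (e i) (y i)
      & has_sum (fun i => bracket (d i) (e i) (x i) (y i)) f].

(* The form-degree one part of [Omega, Omega]. Here and below, the form
   \sigma F of \Sigma^{-1} Omega1 is represented by F; the graded commutator of
   a and \sigma F is, up to a global sign, \sigma of the commutator of a and F. *)
Definition comm1 (H : Omega1) : Prop :=
  exists (I : choiceType) (d e : I -> int) (a : I -> X) (F : I -> Omega1),
    [/\ forall i, homog (d i) (a i), forall i, homog_form (e i) (F i)
      & has_sum (fun i => lact (a i) (F i)
                          - ksign (d i) (e i) *+: ract (F i) (a i)) H].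

(* The Lie derivative on one-forms. As a derivation of Omega it satisfies
   L(dx) = (-1)^k d(xi x) and L(x . dy) = xi x . dy + (-1)^(k|x|) x . L(dy);
   since x . \sigma(1 dy) = (-1)^|x| \sigma(x dy), it maps \sigma(x dy) to
   (-1)^k \sigma(xi x dy + (-1)^(k|x|) x d(xi y)). *)
Definition lie_deriv (k : int) (xi : X -> X) (F : Omega1) : Omega1 := fun p =>
  if p.2 == [::] then 0 else
  ksign k 1 * (xi (fun u => F (u, p.2)) p.1
               + ksign k (word_deg p.1) * xi (fun v => F (p.1, v)) p.2).

(* t_a \otimes u |-> d t_a . u *)
Definition theta_word (w : word) : Omega1 :=
  if w is a :: u then ract (dform (mono [:: a])) (mono u) else 0.

Definition theta (f : X) : Omega1 := fun p =>
  \sum_(w \in [set: word]) f w * theta_word w p.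

Definition theta_inv (F : Omega1) : X :=
  xget 0 [set f : X | f [::] = 0 /\ comm1 (theta f - F)].

Definition hoch_b (m : X -> X) (f : X) : X :=
  theta_inv (lie_deriv 1 m (theta f)).

(* z_n(x_1 ... x_n) is a signed x_2 ... x_n x_1; the coefficient of z f at w
   thus comes from the word obtained by moving the last letter of w in front. *)
Definition cyc (f : X) : X := fun w =>
  if rotr 1 w is a :: u
  then ksign (letter_deg a) (word_deg u) * f (a :: u) else f [::].

Definition cyc_sub (f : X) : X := f - cyc f.

Definition cyc_norm (f : X) : X := fun w =>
  \sum_(k < size w) iter k cyc f w.

(* F stands for the sum of the F (u, v) * (u \otimes v). *)
Local Notation XX := (word * word -> K).

Definition tensor_mul (F H : XX) : XX := fun p =>
  \sum_(i < (size p.1).+1) \sum_(j < (size p.2).+1)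
    ksign (word_deg (take j p.2)) (word_deg (drop i p.1))
    * F (take i p.1, take j p.2) * H (drop i p.1, drop j p.2).

Definition coprod_letter (a : basis V) : XX := fun p =>
  (p == ([:: a], [::]))%:R + (p == ([::], [:: a]))%:R.

Definition coprod_word (w : word) : XX :=
  foldr (fun a F => tensor_mul (coprod_letter a) F)
        (fun p => (p == ([::], [::]))%:R) w.

Definition coprod (f : X) : XX := fun p =>
  \sum_(w \in [set: word]) f w * coprod_word w p.

Definition mult (F : XX) : X := fun w =>
  \sum_(i < (size w).+1) F (take i w, drop i w).

Definition s_op (f : X) : X := mult (coprod f).

Definition lambda (i : nat) : rat := 2%:R ^+ i.

Definition e_comp (n i : nat) (f : X) : X :=
  if (i <= n)%N then
    (\prod_(r < n.+1 | r != i :> nat) (lambda i - lambda r))^-1 *: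
    (\big[@comp X X X/idfun]_(r < n.+1 | r != i :> nat)
        (fun g : X => s_op g - lambda r *: g)) f
  else 0.

Definition e_op (i : nat) (f : X) : X := fun w =>
  e_comp (size w) i (tensor_part (size w) f) w.

(* 1 \hat\otimes e(i) on W \hat\otimes \hat T W *)
Definition et_op (i : nat) (f : X) : X := fun w =>
  if w is a :: u then e_op i (fun v => f (a :: v)) u else 0.

(* A graded module [mem] / [null] presented by series, with a differential
   defined on representatives. *)
Record dg_module := DgModule {
  mem : int -> X -> Prop;
  null : int -> X -> Prop;
  diff : X -> X
}.

(* y is the sum of the classes of the x i in the degree d part of C: in each
   tensor degree the partial sums are eventually equal to y. *)
Definition sum_to (C : dg_module) (d : int) (x : nat -> X) (y : X) : Prop :=
  forall n, exists N, forall j, (N <= j)%N ->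
    null C d (tensor_part n (y - \sum_(i < j) x i)).

Definition subcomplex (Q C : dg_module) : Prop :=
  forall d f, mem Q d f ->
    [/\ mem C d f, null Q d f <-> null C d f, mem Q (d + 1) (diff Q f)
      & null C (d + 1) (diff Q f - diff C f)].

(* C is the (internal) direct product of its subcomplexes Q i: the sum map from
   the product of the Q i to C is an isomorphism of complexes. *)
Definition direct_product (C : dg_module) (Q : nat -> dg_module) : Prop :=
  (forall i, subcomplex (Q i) C) /\
  forall d,
  [/\ forall x, (forall i, mem (Q i) d (x i)) ->
        exists2 y, mem C d y & sum_to C d x y,
      forall y, mem C d y ->
        exists2 x, (forall i, mem (Q i) d (x i)) & sum_to C d x y,
      forall x x' y y',
        (forall i, mem (Q i) d (x i)) -> (forall i, mem (Q i) d (x' i)) ->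
        mem C d y -> mem C d y' -> sum_to C d x y -> sum_to C d x' y' ->
        (null C d (y - y') <-> forall i, null (Q i) d (x i - x' i))
    & forall x y, (forall i, mem (Q i) d (x i)) -> mem C d y ->
        sum_to C d x y -> sum_to C (d + 1) (fun i => diff (Q i) (x i)) (diff C y)].

(* Column p is [col p], with the horizontal map [hor p] to column p.+1. *)
Record bicomplex := Bicomplex {
  col : nat -> dg_module;
  hor : nat -> X -> X
}.

Definition bi_direct_product (B : bicomplex) (Q : nat -> bicomplex) : Prop :=
  [/\ forall p, direct_product (col B p) (fun i => col (Q i) p),
      forall i p d f, mem (col (Q i) p) d f ->
        mem (col (Q i) p.+1) d (hor (Q i) p f) /\
        null (col B p.+1) d (hor (Q i) p f - hor B p f)
    & forall p d x y, (forall i, mem (col (Q i) p) d (x i)) ->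
        mem (col B p) d y -> sum_to (col B p) d x y ->
        sum_to (col B p.+1) d (fun i => hor (Q i) p (x i)) (hor B p y)].

(* The degree d part of \Sigma \Pi, i.e. the degree d + 1 part of \Pi. *)
Definition sPi (d : int) (f : X) : Prop := homog (d + 1) f /\ f [::] = 0.

(* Classes modulo [X, X] of the series without constant term. *)
Definition CC_Hoch (m : X -> X) : dg_module :=
  DgModule sPi (fun d f => sPi d f /\ comm0 f) m.

(* The coinvariants of Z_n are the cokernel of 1 - z_n, as z_n generates Z_n. *)
Definition sPiZ_null (d : int) (f : X) : Prop := exists2 g, sPi d g & f = cyc_sub g.

(* \Sigma (e(i)[\Pi_Z]) with the differential b' *)
Definition Hoch_factor (m : X -> X) (i : nat) : dg_module :=
  DgModule (fun d f => sPi d f /\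
                       exists2 g, sPi d g & sPiZ_null d (f - e_op i g))
           sPiZ_null m.

Definition unquotiented (M : int -> X -> Prop) (D : X -> X) : dg_module :=
  DgModule M (fun=> eq^~ 0) D.

Definition tsygan_diff (m : X -> X) (p : nat) : X -> X :=
  if odd p then m else hoch_b m.

Definition tsygan_hor (p : nat) : X -> X :=
  if odd p then cyc_norm else cyc_sub.

Definition CC_Tsygan (m : X -> X) : bicomplex :=
  Bicomplex (fun p => unquotiented sPi (tsygan_diff m p)) tsygan_hor.

Definition Q_ (i : nat) (d : int) (f : X) : Prop := exists2 g, sPi d g & f = e_op i g.

Definition Qt_ (i : nat) (d : int) (f : X) : Prop := exists2 g, sPi d g & f = et_op i g.

(* Columns 2k and 2k+1 are \tilde Q_{i-k} for k <= i and Q_{i-k} for k < i;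
   the other columns vanish. *)
Definition Gamma_col (i p : nat) (d : int) (f : X) : Prop :=
  if odd p then (if (p./2 < i)%N then Q_ (i - p./2) d f else f = 0)
  else (if (p./2 <= i)%N then Qt_ (i - p./2) d f else f = 0).

Definition Gamma_ (m : X -> X) (i : nat) : bicomplex :=
  Bicomplex (fun p => unquotiented (Gamma_col i p) (tsygan_diff m p)) tsygan_hor.

End Series.

(* Main.v *)
(* The components of e(i) and 1 \otimes e(i) are the projections onto the
   eigenspaces for 2^i of s and of 1 \otimes s. Indeed s - 2^k maps a product of k
   Lie elements to a combination of products of k - 1 Lie elements, and a word of
   length n is a product of n of them, so that s is diagonalizable on W^{\otimes n}
   with eigenvalues 2^1, ..., 2^n if n > 0. The theorem thus amounts to commutation
   rules with s:
   - m s = s m, because m is also a coderivation: m(t) is a Lie series, hence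
     primitive, for every letter t;
   - b (1 \otimes s) = (1 \otimes s) b, because b(t \otimes u) is, up to sign, the
     class of dm(t) . u + (+-) dt . m(u), while dl . s(u) = (1 \otimes s)(dl . u) for
     every Lie series l, by induction on Lie monomials from [l, s(u)] = s([l, u]);
   - s (1 - z) = (1 - z) (1 \otimes s), because (1 - z)(t \otimes u) = [t, u];
   - N s = 2 (1 \otimes s) N, which shifts the eigenvalues by one; this is the
     cocommutativity of the coproduct.
   The coinvariants are handled through the equality of ker N and im (1 - z), valid
   over the rational numbers.

   All operators are linear and continuous, and identities between them are
   checked on the topological basis of the words. *)
Require Import Defs.
From mathcomp Require Import all_boot all_order all_algebra.
From mathcomp Require Import boolp classical_sets functions cardinality fsbigop.
From mathcomp Require Import ring.
Import Defs.

Set Implicit Arguments.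
Unset Strict Implicit.
Unset Printing Implicit Defensive.

Import GRing.Theory.
Local Open Scope ring_scope.
Local Open Scope classical_set_scope.

(* Degrees are only available on homogeneous series, while the extension from words to series needs
   operators defined on all of them. As K is even, a Koszul sign sees only the parity of words.
   Products and commutators are therefore redefined with signs on the individual words, and compared
   with the graded ones on series whose words share one parity. In b the obstacle is that the
   inverse of Theta is specified only up to convergent sums of commutators. It is replaced by the
   explicit map taking u dv to the cyclic words of dv . u; that this is an inverse rests on writing
   a form minus its normal form as an explicit convergent sum of homogeneous commutators. The
   differentials do not preserve the tensor degree, so they do not act on the factors of the
   infinite products separately. They never lower it, however, which makes every coefficient of an
   image depend on finitely many tensor degrees. Both splittings come from one statement on
   orthogonal idempotents modulo the kernel of an operator N: the cyclic norm for the coinvariants,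
   the identity for the columns of the bicomplex. *)
Local Infix "*+:" := scal (at level 40).

(** * Linear continuous maps between spaces of series *)

Section LinearContinuous.

Variable K : comAlgType rat.

Definition delta (A : choiceType) (a : A) : A -> K := fun b => (b == a)%:R.

(** For products of copies of the discrete ring [K], a linear map is continuous when each
    coefficient of the image depends on finitely many coefficients of the argument. *)
Definition lincont (A B : choiceType) (T : (A -> K) -> B -> K) :=
  (forall c f g, T (c *+: f + g) = c *+: T f + T g) /\
  forall b, exists s : seq A,
    forall f, (forall a, a \in s -> f a = 0) -> T f b = 0.

Implicit Types A B C : choiceType.

Lemma funD A (f g : A -> K) a : (f + g) a = f a + g a. Proof. by []. Qed.
Lemma funN A (f : A -> K) a : (- f) a = - f a. Proof. by []. Qed.
Lemma fun0 A a : (0 : A -> K) a = 0. Proof. by []. Qed.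
Lemma funscal A c (f : A -> K) a : (c *+: f) a = c * f a. Proof. by []. Qed.
Lemma funsum A I (r : seq I) (P : pred I) (F : I -> A -> K) a :
  (\sum_(i <- r | P i) F i) a = \sum_(i <- r | P i) F i a.
Proof. by elim/big_rec2: _ => // i y1 y2 _ <-. Qed.
Definition funE := (funD, funN, fun0, funscal, funsum).

Lemma scal_rat A (q : rat) (f : A -> K) : q *: f = q%:A *+: f.
Proof. by apply/funext => a; rewrite /scal mulr_algl. Qed.

Lemma lcP A B (T : (A -> K) -> B -> K) : lincont T ->
  forall c f g, T (c *+: f + g) = c *+: T f + T g.
Proof. by case. Qed.

Lemma scal1 A (f : A -> K) : 1 *+: f = f.
Proof. by apply/funext => a; rewrite /scal mul1r. Qed.

Lemma lcD A B (T : (A -> K) -> B -> K) (L : lincont T) f g :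
  T (f + g) = T f + T g.
Proof. by have := lcP L 1 f g; rewrite !scal1. Qed.

Lemma lc0 A B (T : (A -> K) -> B -> K) (L : lincont T) : T 0 = 0.
Proof. by apply: (@addrI _ (T 0)); rewrite -lcD // !addr0. Qed.

Lemma lcZ A B (T : (A -> K) -> B -> K) (L : lincont T) c f :
  T (c *+: f) = c *+: T f.
Proof. by rewrite -[c *+: f]addr0 (lcP L) lc0 // addr0. Qed.

Lemma scalN1 A (f : A -> K) : (-1) *+: f = - f.
Proof. by apply/funext => a; rewrite /scal mulN1r. Qed.

Lemma lcN A B (T : (A -> K) -> B -> K) (L : lincont T) f : T (- f) = - T f.
Proof. by rewrite -!scalN1 lcZ. Qed.

Lemma lcB A B (T : (A -> K) -> B -> K) (L : lincont T) f g :
  T (f - g) = T f - T g.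
Proof. by rewrite lcD // lcN. Qed.

Lemma lcS A B (T : (A -> K) -> B -> K) (L : lincont T) I (r : seq I)
    (P : pred I) (F : I -> A -> K) :
  T (\sum_(i <- r | P i) F i) = \sum_(i <- r | P i) T (F i).
Proof. by apply: (big_morph T (lcD L) (lc0 L)). Qed.

Lemma lcE A B (T : (A -> K) -> B -> K) (L : lincont T) b :
  exists s : seq A, uniq s /\
    forall f, T f b = \sum_(a <- s) f a * T (delta a) b.
Proof.
have [s Hs] := L.2 b; exists (undup s); split; first exact: undup_uniq.
move=> f.
have := Hs (f - \sum_(a <- undup s) f a *+: delta a).
rewrite (lcB L) (lcS L) !funE => H.
apply/eqP; rewrite -subr_eq0 -[X in _ == X]H.
  apply/eqP; congr (_ - _); apply: eq_bigr => a _; by rewrite (lcZ L).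
move=> a; rewrite -mem_undup => ain; rewrite !funE.
rewrite (bigD1_seq a) ?undup_uniq //= big1 => [|c /negPf ca].
  by rewrite funscal /delta eqxx mulr1 addr0 subrr.
by rewrite funscal /delta eq_sym ca mulr0.
Qed.

(** Restricting to the support lets a property of [f], such as the parity of its words or a missing
    constant term, enter an argument on basis elements. *)
Lemma lc_ext_supp A B (T U : (A -> K) -> B -> K) f :
  lincont T -> lincont U ->
  (forall a, f a != 0 -> T (delta a) = U (delta a)) -> T f = U f.
Proof.
move=> LT LU H; apply/funext => b.
have LTU : lincont (fun f => T f - U f).
  split=> [c g h|c].
    rewrite (lcP LT) (lcP LU); apply/funext => x; rewrite !funE; ring.
  have [s Hs] := LT.2 c; have [t Ht] := LU.2 c; exists (s ++ t) => g Hg.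
  by rewrite !funE Hs ?Ht ?subrr // => a ain; apply: Hg;
    rewrite mem_cat ain ?orbT.
have [s [_ Hs]] := lcE LTU b.
apply/eqP; rewrite -subr_eq0; have := Hs f; rewrite !funE => ->.
rewrite big1 // => a _; case: (eqVneq (f a) 0) => [->|/H->]; first by rewrite mul0r.
by rewrite !funE subrr mulr0.
Qed.

Lemma lc_ext A B (T U : (A -> K) -> B -> K) :
  lincont T -> lincont U -> (forall a, T (delta a) = U (delta a)) ->
  forall f, T f = U f.
Proof. by move=> LT LU H f; apply: lc_ext_supp. Qed.

Lemma lc_supp A B (T : (A -> K) -> B -> K) (L : lincont T) f b :
  (forall a, f a != 0 -> T (delta a) b = 0) -> T f b = 0.
Proof.
move=> H; have [s [_ ->]] := lcE L b; rewrite big1 // => a _.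
by case: (eqVneq (f a) 0) => [->|/H->]; rewrite ?mul0r ?mulr0.
Qed.

Lemma lc_id A : lincont (fun f : A -> K => f).
Proof. by split=> [//|b]; exists [:: b] => f; apply; rewrite inE. Qed.

Lemma lc_zero A B : lincont (fun _ : A -> K => (0 : B -> K)).
Proof.
by split=> [c f g|b]; [apply/funext => b; rewrite !funE mulr0 addr0|exists [::]].
Qed.

Lemma lc_add A B (T U : (A -> K) -> B -> K) :
  lincont T -> lincont U -> lincont (fun f => T f + U f).
Proof.
move=> LT LU; split=> [c g h|c].
  rewrite (lcP LT) (lcP LU); apply/funext => x; rewrite !funE; ring.
have [s Hs] := LT.2 c; have [t Ht] := LU.2 c; exists (s ++ t) => g Hg.
by rewrite !funE Hs ?Ht ?addr0 // => a ain; apply: Hg; rewrite mem_cat ain ?orbT.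
Qed.

Lemma lc_scal A B (T : (A -> K) -> B -> K) c :
  lincont T -> lincont (fun f => c *+: T f).
Proof.
move=> LT; split=> [d g h|b].
  rewrite (lcP LT); apply/funext => x; rewrite !funE; ring.
by have [s Hs] := LT.2 b; exists s => f /Hs; rewrite funscal => ->; rewrite mulr0.
Qed.

Lemma lc_opp A B (T : (A -> K) -> B -> K) : lincont T -> lincont (fun f => - T f).
Proof.
move=> LT; have := lc_scal (-1) LT; congr lincont.
by apply/funext => f; rewrite scalN1.
Qed.

Lemma lc_sub A B (T U : (A -> K) -> B -> K) :
  lincont T -> lincont U -> lincont (fun f => T f - U f).
Proof. by move=> LT LU; apply: lc_add => //; apply: lc_opp. Qed.

Lemma lc_sum A B I (r : seq I) (P : pred I) (T : I -> (A -> K) -> B -> K) :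
  (forall i, lincont (T i)) -> lincont (fun f => \sum_(i <- r | P i) T i f).
Proof.
move=> LT; elim: r => [|i r IH].
  have := lc_zero A B; congr lincont; by apply/funext => f; rewrite big_nil.
have := lc_add (LT i) IH; case E : (P i) => H.
  by move: H; congr lincont; apply/funext => f; rewrite big_cons E.
by move: IH; congr lincont; apply/funext => f; rewrite big_cons E.
Qed.

Lemma lc_comp A B C (T : (B -> K) -> C -> K) (U : (A -> K) -> B -> K) :
  lincont T -> lincont U -> lincont (fun f => T (U f)).
Proof.
move=> LT LU; split=> [c g h|c]; first by rewrite (lcP LU) (lcP LT).
have [s Hs] := LT.2 c.
have [t Ht] : exists t : seq A, forall f, (forall a, a \in t -> f a = 0) ->
    forall b, b \in s -> U f b = 0.
  elim: s {Hs} => [|b s [t Ht]]; first by exists [::].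
  have [t' Ht'] := LU.2 b; exists (t' ++ t) => f Hf b'.
  rewrite inE => /predU1P[->|]; last first.
    by apply: Ht => a ain; apply: Hf; rewrite mem_cat ain orbT.
  by apply: Ht' => a ain; apply: Hf; rewrite mem_cat ain.
by exists t => f /Ht Hf; apply: Hs.
Qed.

(** Covers operators whose formula depends on the coefficient being computed, for instance through
    the length of the word. *)
Lemma lc_pt A B (T : (A -> K) -> B -> K) :
  (forall b, exists2 U : (A -> K) -> B -> K, lincont U & forall f, T f b = U f b) ->
  lincont T.
Proof.
move=> H; split=> [c f g|b].
  by apply/funext => b; have [U LU E] := H b; rewrite !funE !E (lcP LU) !funE.
by have [U LU E] := H b; have [s Hs] := LU.2 b; exists s => f; rewrite E; exact: Hs.
Qed.

Lemma lc_pt2 A B C (U : B -> (A -> K) -> C -> K) (g : B -> C) :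
  (forall b, lincont (U b)) -> lincont (fun f b => U b f (g b)).
Proof.
move=> L; split=> [c f h|b].
  by apply/funext => b; rewrite (lcP (L b)) !funE.
exact: (L b).2.
Qed.

Lemma lc_eval A B (c : B -> K) (g : B -> A) :
  lincont (fun (f : A -> K) b => c b * f (g b)).
Proof.
split=> [d f h|b]; first by apply/funext => b; rewrite !funE; ring.
by exists [:: g b] => f Hf; rewrite Hf ?mulr0 // inE.
Qed.

Lemma lc_sumfun A B (I : B -> Type) (r : forall b, seq (I b))
    (P : forall b, pred (I b)) (c : forall b, I b -> K) (g : forall b, I b -> A) :
  lincont (fun (f : A -> K) b => \sum_(i <- r b | P b i) c b i * f (g b i)).
Proof.
split=> [d f h|b].
  apply/funext => b; rewrite !funE mulr_sumr -big_split /=.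
  by apply: eq_bigr => i _; rewrite !funE; ring.
exists [seq g b i | i <- r b] => f Hf; elim: (r b) Hf => [|i s IH] Hf.
  by rewrite big_nil.
rewrite big_cons IH => [|a ain]; last by apply: Hf; rewrite inE ain orbT.
by rewrite Hf ?inE ?eqxx // mulr0 addr0 if_same.
Qed.

(** Under [colfin], the linear continuous map with matrix [M], taking the basis element [a] to
    [M a]. *)
Definition ext A B (M : A -> B -> K) (f : A -> K) : B -> K :=
  fun b => \sum_(a \in [set: A]) f a * M a b.

Definition colfin A B (M : A -> B -> K) :=
  forall b, exists s : seq A, forall a, M a b != 0 -> a \in s.

Lemma fsum_seq A (F : A -> K) (s : seq A) : uniq s ->
  (forall a, F a != 0 -> a \in s) -> \sum_(a \in [set: A]) F a = \sum_(a <- s) F a.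
Proof.
move=> us Hs; rewrite (fsbig_seq _ _ us); apply/esym/fsbig_widen => // a /= [_].
by move=> /negP as'; apply/eqP; apply: contraNT as' => /Hs.
Qed.

Lemma ext_seq A B (M : A -> B -> K) b (s : seq A) f : uniq s ->
  (forall a, M a b != 0 -> a \in s) -> ext M f b = \sum_(a <- s) f a * M a b.
Proof.
move=> us Hs; apply: fsum_seq => // a H; apply: Hs; apply: contraNneq H => ->.
by rewrite mulr0.
Qed.

Lemma lc_extM A B (M : A -> B -> K) : colfin M -> lincont (ext M).
Proof.
move=> cf; apply: lc_pt => b; have [s Hs] := cf b.
exists (fun f _ => \sum_(a <- undup s) M a b * f a).
  exact: (lc_sumfun (fun=> undup s) (fun _ _ => true) (fun _ a => M a b) (fun _ a => a)).
move=> f; rewrite (@ext_seq _ _ _ _ (undup s)) ?undup_uniq // => [|a /Hs].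
  by apply: eq_bigr => a _; rewrite mulrC.
by rewrite mem_undup.
Qed.

Lemma ext_delta A B (M : A -> B -> K) a : colfin M -> ext M (delta a) = M a.
Proof.
move=> cf; apply/funext => b.
rewrite /ext (fsum_seq (s := [:: a])) // => [|c].
  by rewrite big_seq1 /delta eqxx mul1r.
by rewrite inE /delta; case: (c =P a) => //= _; rewrite mul0r eqxx.
Qed.

(** A coefficient of [T f] sees finitely many coefficients of [f], and these receive contributions
    from finitely many indices, so a finite partial sum can replace [f]. *)
Lemma lc_has_sum A B (T : (A -> K) -> B -> K) (I : choiceType) (F : I -> A -> K) f :
  lincont T -> has_sum F f -> (forall i, T (F i) = 0) -> T f = 0.
Proof.
move=> L Hf H0; apply/funext => b; have [s Hs] := L.2 b.
have [J [uJ HJ]] : exists J : seq I, uniq J /\ forall a i, a \in s -> F i a != 0 -> i \in J.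
  elim: s {Hs} => [|a s [J [uJ HJ]]]; first by exists [::].
  have [/finite_seqP[Ja EJa] _] := Hf a.
  exists (undup (Ja ++ J)); split; first exact: undup_uniq.
  move=> a' i; rewrite mem_undup mem_cat inE => /predU1P[->|/HJ H /H ->].
    by move=> Fia; have : [set i | F i a != 0] i by []; rewrite EJa /= => ->.
  by rewrite orbT.
have : T (f - \sum_(i <- J) F i) b = 0.
  apply: Hs => a ain; rewrite !funE.
  have [_ ->] := Hf a; rewrite (fsum_seq uJ) ?subrr // => i; exact: HJ.
by rewrite (lcB L) (lcS L) !funE big1 ?subr0 // => i _; rewrite H0.
Qed.

Lemma lcQ A B (T : (A -> K) -> B -> K) (L : lincont T) (q : rat) f :
  T (q *: f) = q *: T f.
Proof. by rewrite !scal_rat lcZ. Qed.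

Lemma lc_scalQ A B (T : (A -> K) -> B -> K) (q : rat) :
  lincont T -> lincont (fun f => q *: T f).
Proof.
move=> L; have := lc_scal (q%:A) L; congr lincont.
by apply/funext => f; rewrite scal_rat.
Qed.

End LinearContinuous.

(** * Parities of degrees and Koszul signs *)

Section Words.

Variables (K : comAlgType rat) (V : free_graded_module).

Local Notation ksign := (ksign K).
Local Notation deg := (@word_deg V).
Local Notation ldeg := (@letter_deg V).

Definition par (i : int) : bool := odd `|i|%N.

Lemma parD i j : par (i + j) = par i (+) par j.
Proof.
rewrite /par; case: i => i; case: j => j; rewrite ?NegzE.
- by rewrite -PoszD !absz_nat oddD.
- rewrite abszN !absz_nat; case: (leqP j.+1 i) => H.
    by rewrite subzn // absz_nat oddB.
  by rewrite -opprB abszN subzn 1?ltnW // absz_nat oddB 1?ltnW // addbC.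
- rewrite abszN !absz_nat addrC; case: (leqP i.+1 j) => H.
    by rewrite subzn // absz_nat oddB // addbC.
  by rewrite -opprB abszN subzn 1?ltnW // absz_nat oddB 1?ltnW.
- by rewrite -opprD !abszN -PoszD !absz_nat oddD.
Qed.

Lemma parN i : par (- i) = par i. Proof. by rewrite /par abszN. Qed.
Lemma par0 : par 0 = false. Proof. by []. Qed.
Lemma par1 : par 1 = true. Proof. by []. Qed.

Lemma ksignE i j : ksign i j = (-1) ^+ (par i && par j).
Proof. by rewrite /Defs.ksign -signr_odd abszM oddM. Qed.

Lemma deg_nil : deg [::] = 0.
Proof. by rewrite /word_deg big_nil. Qed.

Lemma deg_cons a w : deg (a :: w) = ldeg a + deg w.
Proof. by rewrite /word_deg big_cons. Qed.

Lemma deg_cat u v : deg (u ++ v) = deg u + deg v.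
Proof. by rewrite /word_deg big_cat. Qed.

Lemma deg_rcons u a : deg (rcons u a) = deg u + ldeg a.
Proof. by rewrite -cats1 deg_cat deg_cons deg_nil addr0. Qed.

Definition signE :=
  (ksignE, deg_nil, deg_cons, deg_cat, deg_rcons, parD, parN, par0, par1).

End Words.

(* Decides linear identities between series whose coefficients are Koszul
   signs by running through the parities of the degrees. *)
Ltac sgn :=
  rewrite ?signE;
  repeat match goal with |- context [par ?x] => case: (par x) end;
  rewrite /= ?expr0 ?expr1; ring.

Ltac lin := apply/funext => ?; rewrite ?funE; sgn.

(** * Products and commutators with signs on words *)

Section Series.

Variables (K : comAlgType rat) (V : free_graded_module).

Local Notation word := (word V).
Local Notation X := (word -> K).
Local Notation XX := (word * word -> K).
Local Notation mono := (mono K (V := V)).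
Local Notation ksign := (ksign K).
Local Notation deg := (@word_deg V).

Definition tens (x y : X) : XX := fun p => x p.1 * y p.2.

Definition swap (F : XX) : XX := fun p => ksign (deg p.1) (deg p.2) * F (p.2, p.1).

Definition tmul (x y : X) : X := mult (swap (tens x y)).

(** The commutator with signs read off the individual words: unlike [bracket] it takes no degrees,
    and it is bilinear and continuous on all series. *)
Definition brk (x y : X) : X := mul x y - tmul x y.

Lemma mult_tens (x y : X) : mult (tens x y) = mul x y. Proof. by []. Qed.

Section LinearContinuous.
Variable A : choiceType.
Implicit Types (T : (A -> K) -> X) (S : (A -> K) -> XX).

Lemma lc_tens1 T y : lincont T -> lincont (fun f => tens (T f) y).
Proof.
move=> L; apply: (lc_comp (T := fun x => tens x y)) => //.
have := lc_eval (fun p : word * word => y p.2) (fun p : word * word => p.1).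
by congr lincont; apply/funext => x; apply/funext => p; rewrite /tens mulrC.
Qed.

Lemma lc_tens2 x T : lincont T -> lincont (fun f => tens x (T f)).
Proof.
move=> L; apply: (lc_comp (T := fun y => tens x y)) => //.
exact: (lc_eval (fun p : word * word => x p.1) (fun p : word * word => p.2)).
Qed.

Lemma lc_swap S : lincont S -> lincont (fun f => swap (S f)).
Proof.
move=> L; apply: (lc_comp (T := swap)) => //.
exact: (lc_eval (fun p : word * word => ksign (deg p.1) (deg p.2))
         (fun p : word * word => (p.2, p.1))).
Qed.

Lemma lc_mult S : lincont S -> lincont (fun f => mult (S f)).
Proof.
move=> L; apply: (lc_comp (T := @mult K V)) => //.
have := lc_sumfun (fun w : word => index_enum 'I_(size w).+1) (fun _ _ => true)
  (fun _ _ => 1) (fun w i => (take i w, drop i w)) (K := K).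
congr lincont; apply/funext => F; apply/funext => w.
by apply: eq_bigr => i _; rewrite mul1r.
Qed.

Lemma lc_mul1 T y : lincont T -> lincont (fun f => mul (T f) y).
Proof. by move=> L; apply: (lc_mult (S := fun f => tens (T f) y)); apply: lc_tens1. Qed.

Lemma lc_mul2 x T : lincont T -> lincont (fun f => mul x (T f)).
Proof. by move=> L; apply: (lc_mult (S := fun f => tens x (T f))); apply: lc_tens2. Qed.

Lemma lc_tmul1 T y : lincont T -> lincont (fun f => tmul (T f) y).
Proof.
move=> L; apply: (lc_mult (S := fun f => swap (tens (T f) y))).
by apply: (lc_swap (S := fun f => tens (T f) y)); apply: lc_tens1.
Qed.

Lemma lc_tmul2 x T : lincont T -> lincont (fun f => tmul x (T f)).
Proof.
move=> L; apply: (lc_mult (S := fun f => swap (tens x (T f)))).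
by apply: (lc_swap (S := fun f => tens x (T f))); apply: lc_tens2.
Qed.

Lemma lc_brk1 T y : lincont T -> lincont (fun f => brk (T f) y).
Proof. by move=> L; apply: lc_sub; [apply: lc_mul1|apply: lc_tmul1]. Qed.

Lemma lc_brk2 x T : lincont T -> lincont (fun f => brk x (T f)).
Proof. by move=> L; apply: lc_sub; [apply: lc_mul2|apply: lc_tmul2]. Qed.

End LinearContinuous.

Lemma lc_extX (B : choiceType) (T U : X -> B -> K) : lincont T -> lincont U ->
  (forall w, T (mono w) = U (mono w)) -> forall f, T f = U f.
Proof. exact: lc_ext. Qed.

Lemma lc_ext_suppX (B : choiceType) (T U : X -> B -> K) f :
  lincont T -> lincont U ->
  (forall w, f w != 0 -> T (mono w) = U (mono w)) -> T f = U f.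
Proof. exact: lc_ext_supp. Qed.

Lemma delta_tens u v : delta K (u, v) = tens (mono u) (mono v).
Proof.
apply/funext => -[p q]; rewrite /delta /tens /Defs.mono /= xpair_eqE.
by case: (p == u); case: (q == v); rewrite ?mulr1 ?mulr0.
Qed.

Lemma lc_extXX (B : choiceType) (T U : XX -> B -> K) : lincont T -> lincont U ->
  (forall u v, T (tens (mono u) (mono v)) = U (tens (mono u) (mono v))) ->
  forall f, T f = U f.
Proof. by move=> LT LU H; apply: lc_ext => // -[u v]; rewrite delta_tens. Qed.

Lemma mult_mono u v : mult (tens (mono u) (mono v)) = mono (u ++ v).
Proof.
apply/funext => w; rewrite /mult /tens /Defs.mono /=.
case: (eqVneq w (u ++ v)) => [->|neq].
  have lt : (size u < (size (u ++ v)).+1)%N by rewrite size_cat ltnS leq_addr.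
  rewrite (bigD1 (Ordinal lt)) //= take_size_cat // drop_size_cat // !eqxx mul1r.
  rewrite big1 ?addr0 // => i ne; case: eqP => [E|]; rewrite ?mul0r //.
  have := congr1 size E; rewrite size_takel => [Ei|]; last by rewrite -ltnS.
  by case/eqP: ne; apply: val_inj.
rewrite big1 // => i _; case: eqP => [E1|]; rewrite ?mul0r //.
case: eqP => [E2|]; rewrite ?mulr0 //.
by rewrite -E1 -E2 cat_take_drop eqxx in neq.
Qed.

Lemma swap_mono u v :
  swap (tens (mono u) (mono v)) = ksign (deg u) (deg v) *+: tens (mono v) (mono u).
Proof.
apply/funext => -[p q]; rewrite /swap /scal /tens /Defs.mono /=.
case: (eqVneq p v) => [->|_]; last by rewrite !(mul0r, mulr0).
case: (eqVneq q u) => [->|_]; last by rewrite !(mul0r, mulr0).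
sgn.
Qed.

Lemma mul_mono u v : mul (mono u) (mono v) = mono (u ++ v).
Proof. by rewrite -mult_tens mult_mono. Qed.

Lemma lc_multE : lincont (@mult K V). Proof. exact: (lc_mult (lc_id _ _)). Qed.

Lemma tmul_mono u v :
  tmul (mono u) (mono v) = ksign (deg u) (deg v) *+: mono (v ++ u).
Proof. by rewrite /tmul swap_mono (lcZ lc_multE) mult_mono. Qed.

Lemma lc_mulr y : lincont (fun x : X => mul x y). Proof. exact: (lc_mul1 _ (lc_id _ _)). Qed.
Lemma lc_mull x : lincont (fun y : X => mul x y). Proof. exact: (lc_mul2 _ (lc_id _ _)). Qed.
Lemma lc_brkr y : lincont (fun x : X => brk x y). Proof. exact: (lc_brk1 _ (lc_id _ _)). Qed.
Lemma lc_brkl x : lincont (fun y : X => brk x y). Proof. exact: (lc_brk2 _ (lc_id _ _)). Qed.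
Lemma lc_tensr y : lincont (fun x : X => tens x y). Proof. exact: (lc_tens1 _ (lc_id _ _)). Qed.
Lemma lc_tensl x : lincont (fun y : X => tens x y). Proof. exact: (lc_tens2 _ (lc_id _ _)). Qed.

Definition mulE := ((fun x y z => lcD (lc_mulr z) x y), (fun x y z => lcD (lc_mull z) x y),
  (fun c x z => lcZ (lc_mulr z) c x), (fun c x z => lcZ (lc_mull z) c x),
  (fun x z => lcN (lc_mulr z) x), (fun x z => lcN (lc_mull z) x),
  (fun x => lc0 (lc_mulr x)), (fun x => lc0 (lc_mull x))).

Definition brkE := ((fun x y z => lcD (lc_brkr z) x y), (fun x y z => lcD (lc_brkl z) x y),
  (fun c x z => lcZ (lc_brkr z) c x), (fun c x z => lcZ (lc_brkl z) c x),
  (fun x z => lcN (lc_brkr z) x), (fun x z => lcN (lc_brkl z) x),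
  (fun x => lc0 (lc_brkr x)), (fun x => lc0 (lc_brkl x))).

Definition tensE := ((fun x y z => lcD (lc_tensr z) x y), (fun x y z => lcD (lc_tensl z) x y),
  (fun c x z => lcZ (lc_tensr z) c x), (fun c x z => lcZ (lc_tensl z) c x),
  (fun x z => lcN (lc_tensr z) x), (fun x z => lcN (lc_tensl z) x),
  (fun x => lc0 (lc_tensr x)), (fun x => lc0 (lc_tensl x))).

End Series.

(** [lc] proves continuity by following the shape of the operator; [lc_extra] is redefined once the
    coproduct and [s_op] are known to be continuous. *)
Ltac lc_extra := fail.

Ltac lc :=
  cbv beta;
  lazymatch goal with
  | |- lincont (fun f => _) => idtac
  | |- lincont ?T => change (lincont (fun f => T f)); cbv beta
  end;
  lazymatch goal with
  | |- lincont (fun f => f) => apply lc_id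
  | |- lincont (fun f => GRing.add (@?T f) (GRing.opp (@?U f))) =>
      apply (@lc_sub _ _ _ T U); lc
  | |- lincont (fun f => GRing.add (@?T f) (@?U f)) => apply (@lc_add _ _ _ T U); lc
  | |- lincont (fun f => GRing.opp (@?T f)) => apply (@lc_opp _ _ _ T); lc
  | |- lincont (fun f => scal ?c (@?T f)) => apply (@lc_scal _ _ _ T c); lc
  | |- lincont (fun f => GRing.scale ?c (@?T f)) => apply (@lc_scalQ _ _ _ T c); lc
  | |- lincont (fun f => mul _ _) => first [
      lazymatch goal with |- lincont (fun f => mul ?x (@?T f)) => apply (@lc_mul2 _ _ _ x T) end
    | lazymatch goal with |- lincont (fun f => mul (@?T f) ?x) => apply (@lc_mul1 _ _ _ T x) end]; lc
  | |- lincont (fun f => tmul _ _) => first [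
      lazymatch goal with |- lincont (fun f => tmul ?x (@?T f)) => apply (@lc_tmul2 _ _ _ x T) end
    | lazymatch goal with |- lincont (fun f => tmul (@?T f) ?x) => apply (@lc_tmul1 _ _ _ T x) end]; lc
  | |- lincont (fun f => brk _ _) => first [
      lazymatch goal with |- lincont (fun f => brk ?x (@?T f)) => apply (@lc_brk2 _ _ _ x T) end
    | lazymatch goal with |- lincont (fun f => brk (@?T f) ?x) => apply (@lc_brk1 _ _ _ T x) end]; lc
  | |- lincont (fun f => tens _ _) => first [
      lazymatch goal with |- lincont (fun f => tens ?x (@?T f)) => apply (@lc_tens2 _ _ _ x T) end
    | lazymatch goal with |- lincont (fun f => tens (@?T f) ?x) => apply (@lc_tens1 _ _ _ T x) end]; lc
  | |- lincont (fun f => mult (@?T f)) => apply (@lc_mult _ _ _ T); lc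
  | |- lincont (fun f => swap (@?T f)) => apply (@lc_swap _ _ _ T); lc
  | |- lincont (fun _ => 0) => apply lc_zero
  | H : lincont ?m |- lincont (fun f => ?m f) => exact H
  | H : lincont ?m |- lincont (fun f => ?m (@?T f)) => apply (@lc_comp _ _ _ _ m T H); lc
  | |- _ => lc_extra
  end.

Section Algebra.
Variables (K : comAlgType rat) (V : free_graded_module).
Local Notation X := (word V -> K).
Local Notation mono := (mono K (V := V)).

Lemma mul_seriesA (x y z : X) : mul x (mul y z) = mul (mul x y) z.
Proof.
move: x; apply: lc_extX; [lc|lc|] => u.
move: y; apply: lc_extX; [lc|lc|] => v.
move: z; apply: lc_extX; [lc|lc|] => w.
by rewrite !mul_mono catA.
Qed.

Lemma mul_series1l (x : X) : mul (mono [::]) x = x.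
Proof. by move: x; apply: lc_extX; [lc|lc|] => u; rewrite mul_mono. Qed.

Lemma mul_series1r (x : X) : mul x (mono [::]) = x.
Proof. by move: x; apply: lc_extX; [lc|lc|] => u; rewrite mul_mono cats0. Qed.

End Algebra.

(** * The coproduct as a continuous operator *)

Section Coproduct.
Variables (K : comAlgType rat) (V : free_graded_module).

Local Notation word := (word V).
Local Notation X := (word -> K).
Local Notation XX := (word * word -> K).
Local Notation mono := (mono K (V := V)).
Local Notation ksign := (ksign K).
Local Notation deg := (@word_deg V).

Definition act1 (T : X -> X) (F : XX) : XX := fun p => T (fun u => F (u, p.2)) p.1.

(** [T] may depend on the first tensor factor because the sign of moving an operator past that
    factor does. *)
Definition act2 (T : word -> X -> X) (F : XX) : XX :=
  fun p => T p.1 (fun v => F (p.1, v)) p.2.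

Lemma lc_act1E T : lincont T -> lincont (act1 T).
Proof.
move=> L; split=> [c F H|[p q]].
  apply/funext => -[p q]; rewrite /act1 /= !funE.
  by rewrite -[LHS]/(T (c *+: (fun u => F (u, q)) + (fun u => H (u, q))) p) (lcP L).
have [s Hs] := L.2 p; exists [seq (u, q) | u <- s] => F HF.
by apply: Hs => u us; apply: HF; rewrite map_f.
Qed.

Lemma lc_act2E T : (forall u, lincont (T u)) -> lincont (act2 T).
Proof.
move=> L; split=> [c F H|[p q]].
  apply/funext => -[p q]; rewrite /act2 /= !funE.
  by rewrite -[LHS]/(T p (c *+: (fun u => F (p, u)) + (fun u => H (p, u))) q) (lcP (L p)).
have [s Hs] := (L p).2 q; exists [seq (p, u) | u <- s] => F HF.
by apply: Hs => u us; apply: HF; rewrite map_f.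
Qed.

Lemma act1_tens T x y : lincont T -> act1 T (tens x y) = tens (T x) y.
Proof.
move=> L; apply/funext => -[p q]; rewrite /act1 /=.
have -> : (fun u => tens x y (u, q)) = y q *+: x by apply/funext => u; rewrite /scal mulrC.
by rewrite (lcZ L) /scal mulrC.
Qed.

Lemma act2_tens T u y : (forall u, lincont (T u)) ->
  act2 T (tens (mono u) y) = tens (mono u) (T u y).
Proof.
move=> L; apply/funext => -[p q]; rewrite /act2 /=.
rewrite -[fun v => _]/(mono u p *+: y) (lcZ (L p)) /scal /tens /= /Defs.mono.
by case: eqP => [->//|_]; rewrite !mul0r.
Qed.

(** Supplies the Koszul sign in (1 \otimes x)(u \otimes v) = +- u \otimes xv. *)
Definition twist (u : word) (x : X) : X := fun v => ksign (deg v) (deg u) * x v.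

Lemma lc_twistE u : lincont (twist u).
Proof. exact: (lc_eval (fun v : word => ksign (deg v) (deg u)) id). Qed.

Lemma twist_mono u v : twist u (mono v) = ksign (deg v) (deg u) *+: mono v.
Proof.
apply/funext => w; rewrite /twist /scal /Defs.mono.
by case: eqP => [->//|_]; rewrite !mulr0.
Qed.

(* Multiplication by x \otimes 1 + 1 \otimes x. *)
Definition prim_mul (x : X) (F : XX) : XX :=
  act1 (mul x) F + act2 (fun u => mul (twist u x)) F.

Lemma lc_prim_mulE x : lincont (prim_mul x).
Proof.
apply: lc_add; first exact: (lc_act1E (lc_mull x)).
by apply: lc_act2E => u; exact: lc_mull.
Qed.

Lemma prim_mul_tens x u v : prim_mul x (tens (mono u) v) =
  tens (mul x (mono u)) v + tens (mono u) (mul (twist u x) v).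
Proof.
rewrite /prim_mul act1_tens; last exact: lc_mull.
by rewrite act2_tens // => w; exact: lc_mull.
Qed.

Lemma mul_letter a (f : X) w :
  mul (mono [:: a]) f w = if w is b :: w' then (b == a)%:R * f w' else 0.
Proof.
rewrite /mul /Defs.mono; case: w => [|b w].
  by rewrite big_ord1 /= mul0r.
rewrite big_ord_recl /= mul0r add0r big_ord_recl /= take0 drop0 eqseq_cons andbT.
rewrite big1 ?addr0 // => i _; rewrite /bump /= ?add1n /=; case: w i => [[]//|c w i].
by rewrite /= eqseq_cons andbF mul0r.
Qed.

Lemma tensor_mul_l (x : X) F : tensor_mul (tens x (mono [::])) F = act1 (mul x) F.
Proof.
apply/funext => -[p q]; rewrite /tensor_mul /act1 /mul /=.
apply: eq_bigr => i _; rewrite big_ord_recl /= take0 drop0 /tens /=.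
rewrite big1 => [|j _]; rewrite /Defs.mono ?take0.
  by rewrite eqxx !signE /= expr0; ring.
case: q j => [[]//|b q j]; rewrite /bump /= ?add1n /= ?(mulr0, mul0r) //.
Qed.

Lemma tensor_mul_r (x : X) F :
  tensor_mul (tens (mono [::]) x) F = act2 (fun u => mul (twist u x)) F.
Proof.
apply/funext => -[p q]; rewrite /tensor_mul /act2 /mul /=.
rewrite big_ord_recl [X in _ + X]big1 ?addr0 => [|i _]; last first.
  rewrite big1 // => j _; rewrite /tens /= /Defs.mono.
  case: p i => [[]//|b p i]; rewrite /bump /= ?add1n /= ?(mul0r, mulr0) //.
apply: eq_bigr => j _; rewrite /= take0 drop0 /tens /twist /= /Defs.mono eqxx mul1r; ring.
Qed.

Lemma coprod_word_cons a (w : word) :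
  coprod_word K (a :: w) = prim_mul (mono [:: a]) (coprod_word K w).
Proof.
rewrite /prim_mul -tensor_mul_l -tensor_mul_r /=.
have -> : coprod_letter K a = tens (mono [:: a]) (mono [::]) + tens (mono [::]) (mono [:: a]).
  apply/funext => -[p q]; rewrite /coprod_letter /tens !funE /Defs.mono /= !xpair_eqE.
  by rewrite -!natrM !mulnb.
apply/funext => -[p q]; rewrite funE /tensor_mul -big_split /=; apply: eq_bigr => i _.
by rewrite -big_split /=; apply: eq_bigr => j _; rewrite funE; ring.
Qed.

(** Only the finitely many rearrangements of [p.1 ++ p.2] contribute to the coefficient at [p],
    whence continuity. *)
Lemma coprod_word_perm (w : word) p : coprod_word K w p != 0 -> perm_eq w (p.1 ++ p.2).
Proof.
elim: w p => [[p q]|a w IH [p q]].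
  rewrite /= xpair_eqE; case: (p =P [::]) => [->|_]; last by rewrite eqxx.
  by case: (q =P [::]) => [->|_]; last by rewrite eqxx.
rewrite coprod_word_cons /prim_mul funD; case: (eqVneq (act1 (mul (mono [:: a]))
    (coprod_word K w) (p, q)) 0) => [->|].
  rewrite add0r /act2 /= twist_mono (lcZ (lc_mulr _)) funscal mul_letter.
  case: q => [|b q]; first by rewrite mulr0 eqxx.
  case: (b =P a) => [->|_]; last by rewrite mul0r mulr0 eqxx.
  rewrite mul1r => H; have {}H : coprod_word K w (p, q) != 0.
    by apply: contraNneq H => ->; rewrite mulr0.
  rewrite /= -(cat1s a q) perm_sym perm_catCA cat1s perm_cons perm_sym; exact: (IH _ H).
rewrite /act1 /= mul_letter => H _; case: p H => [|b p]; first by rewrite eqxx.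
case: (b =P a) => [->|_]; last by rewrite mul0r eqxx.
by rewrite mul1r /= perm_cons => /IH.
Qed.

Lemma colfin_coprod : colfin (@coprod_word K V).
Proof.
move=> p; exists (permutations (p.1 ++ p.2)) => w /coprod_word_perm.
by rewrite mem_permutations.
Qed.

Lemma lc_coprodE : lincont (@coprod K V).
Proof. exact: (lc_extM colfin_coprod). Qed.

Lemma coprod_mono w : coprod (mono w) = coprod_word K w.
Proof. exact: (ext_delta w colfin_coprod). Qed.

Lemma lc_sE : lincont (@s_op K V).
Proof. exact: (lc_comp (@lc_multE K V) lc_coprodE). Qed.

End Coproduct.

Ltac lc_extra ::=
  lazymatch goal with
  | |- lincont (fun f => prim_mul ?x (@?T f)) => apply (@lc_comp _ _ _ _ _ T (lc_prim_mulE x)); lc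
  | |- lincont (fun f => twist ?x (@?T f)) => apply (@lc_comp _ _ _ _ _ T (lc_twistE _ x)); lc
  | |- lincont (fun f => coprod (@?T f)) => apply (@lc_comp _ _ _ _ _ T (@lc_coprodE _ _)); lc
  | |- lincont (fun f => s_op (@?T f)) => apply (@lc_comp _ _ _ _ _ T (@lc_sE _ _)); lc
  end.

(** * Sums over unshuffles of a word *)

Section Unshuffles.
Variables (K : comAlgType rat) (V : free_graded_module).

Local Notation word := (word V).
Local Notation ksign := (ksign K).
Local Notation deg := (@word_deg V).
Local Notation ldeg := (@letter_deg V).

Variable B : choiceType.
Implicit Types phi psi : word -> word -> B -> K.

(* The value of a function bilinear in the two halves of \Delta w. *)
Fixpoint dsum (w : word) (phi : word -> word -> B -> K) : B -> K :=
  if w is a :: w' then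
    dsum w' (fun x y => phi (a :: x) y + ksign (ldeg a) (deg x) *+: phi x (a :: y))
  else phi [::] [::].

Lemma eq_dsum w phi psi :
  (forall x y, deg w = deg x + deg y -> phi x y = psi x y) -> dsum w phi = dsum w psi.
Proof.
elim: w phi psi => [|a w IH] phi psi H /=.
  by apply: H; rewrite deg_nil.
by apply: IH => x y E; rewrite !H // !deg_cons E; ring.
Qed.

Lemma dsumD w phi psi :
  dsum w (fun x y => phi x y + psi x y) = dsum w phi + dsum w psi.
Proof.
elim: w phi psi => [//|a w IH] phi psi /=; rewrite -IH; apply: eq_dsum => x y _.
by apply/funext => b; rewrite !funE; ring.
Qed.

Lemma dsumZ w c phi : dsum w (fun x y => c *+: phi x y) = c *+: dsum w phi.
Proof.
elim: w phi => [//|a w IH] phi /=; rewrite -IH; apply: eq_dsum => x y _.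
by apply/funext => b; rewrite !funE; ring.
Qed.

Lemma dsum0 w : dsum w (fun _ _ => 0) = 0.
Proof.
elim: w => [//|a w IH] /=; rewrite -[RHS]IH; apply: eq_dsum => x y _.
by apply/funext => b; rewrite !funE; ring.
Qed.

Lemma dsum_rcons w a phi : dsum (rcons w a) phi =
  dsum w (fun x y => ksign (ldeg a) (deg y) *+: phi (rcons x a) y + phi x (rcons y a)).
Proof.
elim: w phi => [|b w IH] phi /=; first by lin.
by rewrite IH; apply: eq_dsum => x y _; lin.
Qed.

(** Cocommutativity of the coproduct. *)
Lemma dsumC w phi :
  dsum w phi = dsum w (fun x y => ksign (deg x) (deg y) *+: phi y x).
Proof.
elim: w phi => [|b w IH] phi /=; first by lin.
by rewrite IH; apply: eq_dsum => x y _; lin.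
Qed.

(** Multiplicativity of the coproduct. *)
Lemma dsum_cat v z phi : dsum (v ++ z) phi =
  dsum v (fun v1 v2 => dsum z (fun z1 z2 =>
    ksign (deg v2) (deg z1) *+: phi (v1 ++ z1) (v2 ++ z2))).
Proof.
elim: v phi => [|a v IH] phi /=.
  by apply: eq_dsum => x y _; lin.
rewrite IH; apply: eq_dsum => x y _; rewrite -dsumZ -dsumD; apply: eq_dsum => x' y' _; lin.
Qed.

End Unshuffles.

(** * The operator s and cyclic words with a marked letter *)

Section Spectrum.
Variables (K : comAlgType rat) (V : free_graded_module).

Local Notation word := (word V).
Local Notation X := (word -> K).
Local Notation mono := (mono K (V := V)).
Local Notation ksign := (ksign K).
Local Notation deg := (@word_deg V).
Local Notation ldeg := (@letter_deg V).

Lemma lc_dsum (B C : choiceType) (T : (B -> K) -> C -> K) w phi : lincont T ->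
  T (dsum w phi) = dsum (V := V) w (fun x y => T (phi x y)).
Proof.
move=> L; elim: w phi => [//|a w IH] phi /=; rewrite IH; apply: eq_dsum => x y _.
by rewrite (lcD L) (lcZ L).
Qed.

Lemma coprod_wordE w : coprod_word K w = dsum w (fun x y => tens (mono x) (mono y)).
Proof.
elim: w => [|a w IH].
  by apply/funext => -[p q]; rewrite /= /tens /Defs.mono xpair_eqE /= -natrM mulnb.
rewrite coprod_word_cons IH (lc_dsum _ _ (@lc_prim_mulE _ _ _)) /=; apply: eq_dsum => x y _.
by rewrite prim_mul_tens twist_mono !mulE !mul_mono !tensE; lin.
Qed.

Lemma s_mono w : s_op (mono w) = dsum w (fun x y => mono (x ++ y)).
Proof.
rewrite /s_op coprod_mono coprod_wordE (lc_dsum _ _ (@lc_multE _ _)).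
by apply: eq_dsum => x y _; rewrite mult_mono.
Qed.

Lemma brk_mono u v : brk (mono u) (mono v) =
  mono (u ++ v) - ksign (deg u) (deg v) *+: mono (v ++ u).
Proof. by rewrite /brk mul_mono tmul_mono. Qed.

(** In the unshuffles of aw and wa the new letter begins or ends one of the halves x, y. The terms x
    a y occur for both words and cancel; what is left is [a, xy]. *)
Lemma s_brk_letter a f : s_op (brk (mono [:: a]) f) = brk (mono [:: a]) (s_op f).
Proof.
move: f; apply: lc_extX; [lc|lc|] => w; rewrite brk_mono (lcB (@lc_sE _ _)) (lcZ (@lc_sE _ _)).
rewrite cats1 !s_mono dsum_rcons -dsumZ -scalN1 -dsumZ /= -dsumD.
rewrite (lc_dsum _ _ (@lc_brkl _ _ _)); apply: eq_dsum => x y E; rewrite brk_mono cats1 E.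
by rewrite /= rcons_cat cat_rcons; lin.
Qed.

(* 1 \otimes T on W \hat\otimes \hat T W, the series without constant term. *)
Definition tail (T : X -> X) (f : X) : X := fun w =>
  if w is a :: u then T (fun v => f (a :: v)) u else 0.

Lemma lc_tail T : lincont T -> lincont (tail T).
Proof.
move=> L; split=> [c f g|[|a u]].
- apply/funext => -[|a u]; rewrite /tail /= !funE; first by rewrite mulr0 addr0.
  by rewrite -[LHS]/(T (c *+: (fun v => f (a :: v)) + (fun v => g (a :: v))) u) (lcP L).
- by exists [::].
have [s Hs] := L.2 u; exists [seq a :: v | v <- s] => f Hf.
by apply: Hs => v vs; apply: Hf; rewrite map_f.
Qed.

Lemma tail_mono T a u w : lincont T ->
  tail T (mono (a :: u)) w = if w is b :: v then (b == a)%:R * T (mono u) v else 0.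
Proof.
move=> L; case: w => [//|b v]; rewrite /tail.
have -> : (fun v => mono (a :: u) (b :: v)) = (b == a)%:R *+: mono u.
  by apply/funext => x; rewrite /scal /Defs.mono eqseq_cons -natrM mulnb.
by rewrite (lcZ L).
Qed.

Lemma tail_nil T : lincont T -> tail T (mono [::]) = 0.
Proof.
move=> L; apply/funext => -[//|a u]; rewrite /tail.
by rewrite -[fun v => _]/(0 : X) (lc0 L).
Qed.

Definition s_tail := tail (@s_op K V).

Lemma lc_s_tailE : lincont s_tail.
Proof. exact: (lc_tail (@lc_sE _ _)). Qed.

Lemma s_tail_cons a f : s_tail (mul (mono [:: a]) f) = mul (mono [:: a]) (s_op f).
Proof.
apply/funext => -[|b u]; rewrite /s_tail /tail !mul_letter //.
have -> : (fun v => mul (mono [:: a]) f (b :: v)) = (b == a)%:R *+: f.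
  by apply/funext => v; rewrite mul_letter.
by rewrite (lcZ (@lc_sE _ _)).
Qed.

Lemma s_tail_mono a w : s_tail (mono (a :: w)) = mul (mono [:: a]) (s_op (mono w)).
Proof. by rewrite -cat1s -mul_mono s_tail_cons. Qed.

Lemma s_tail_nil : s_tail (mono [::]) = 0.
Proof. exact: (tail_nil (@lc_sE _ _)). Qed.

(* The sum of the +- v2 u v1 over the decompositions v = v1 v2 with v2 <> [::],
   which is the class of dv . u under \Theta_Ass. *)
Fixpoint cder (v u : word) : X :=
  if v is a :: v' then
    mono (v ++ u) + ksign (ldeg a) (deg v' + deg u) *+: cder v' (rcons u a)
  else 0.

(** The Leibniz rule for d(v1 v2) . u, the term v1 dv2 . u being rotated to dv2 . (u v1). *)
Lemma cder_cat v1 v2 u : cder (v1 ++ v2) u =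
  cder v1 (v2 ++ u) + ksign (deg v1) (deg v2 + deg u) *+: cder v2 (u ++ v1).
Proof.
elim: v1 u => [|a v1 IH] u /=; first by rewrite cats0; lin.
rewrite IH rcons_cat cat_rcons -catA; lin.
Qed.

(* For z = [::] the left-hand side is half of N s v: by cocommutativity the
   letter marked by N may be taken in the first tensor factor of \Delta v. The
   word z makes the induction on v work. *)
Lemma cder_s v z :
  dsum v (fun v1 v2 => dsum z (fun z1 z2 =>
    ksign (deg z2) (deg v2 + deg z1) *+: cder v1 (z2 ++ v2 ++ z1))) = s_tail (cder v z).
Proof.
elim: v z => [|a v IH] z /=.
  rewrite (lc0 lc_s_tailE) -[RHS](dsum0 K _ z); apply: eq_dsum => x y _; lin.
rewrite (lcD lc_s_tailE) (lcZ lc_s_tailE) -IH s_tail_mono s_mono dsum_cat.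
rewrite (lc_dsum _ _ (@lc_mull _ _ _)) -dsumZ -dsumD; apply: eq_dsum => v1 v2 Ev.
(* The remaining terms match as they stand, but those of a s(vz) contain the two parts of z in the
   opposite order; cocommutativity on z exchanges them. *)
rewrite (lc_dsum _ _ (@lc_mull _ _ _)) dsum_rcons [in RHS]dsumC -!dsumZ -!dsumD.
apply: eq_dsum => z1 z2 Ez; rewrite !mulE mul_mono /= Ev Ez.
rewrite !rcons_cat -!catA !cat_rcons /=.
lin.
Qed.

End Spectrum.

(** * The cyclic operators z and N *)

Section Cyclic.
Variables (K : comAlgType rat) (V : free_graded_module).

Local Notation word := (word V).
Local Notation X := (word -> K).
Local Notation mono := (mono K (V := V)).
Local Notation ksign := (ksign K).
Local Notation deg := (@word_deg V).
Local Notation ldeg := (@letter_deg V).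

Lemma cycE (f : X) w : cyc f w =
  (if rotr 1 w is a :: u then ksign (ldeg a) (deg u) else 1) * f (rotr 1 w).
Proof. by rewrite /cyc; case: (rotr 1 w) => [|a u] //; rewrite mul1r. Qed.

Lemma lc_cycE : lincont (@cyc K V).
Proof.
have := lc_eval (fun w : word =>
  if rotr 1 w is a :: u then ksign (ldeg a) (deg u) else 1) (fun w => rotr 1 w).
by congr lincont; apply/funext => f; apply/funext => w; rewrite cycE.
Qed.

Lemma cyc_mono a u : cyc (mono (a :: u)) = ksign (ldeg a) (deg u) *+: mono (rcons u a).
Proof.
apply/funext => w; rewrite cycE /scal /Defs.mono.
case: (eqVneq w (rcons u a)) => [->|ne]; first by rewrite rotr1_rcons eqxx.
case: eqP => [E|]; rewrite ?mulr0 //.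
by case/eqP: ne; rewrite -(rotrK 1 w) E rot1_cons.
Qed.

Lemma cyc_nil : cyc (mono [::]) = mono [::].
Proof.
apply/funext => w; rewrite cycE /Defs.mono; case: w => [|b w]; first by rewrite mul1r.
case: eqP => [E|]; rewrite ?mulr0 //.
by have := congr1 size E; rewrite size_rotr.
Qed.

Lemma lc_cyc_subE : lincont (@cyc_sub K V).
Proof. by apply: lc_sub; [apply: lc_id|apply: lc_cycE]. Qed.

Lemma cyc_sub_mono a u : cyc_sub (mono (a :: u)) = brk (mono [:: a]) (mono u).
Proof. by rewrite /cyc_sub cyc_mono brk_mono cats1 deg_cons deg_nil addr0. Qed.

Lemma cyc_sub_nil : cyc_sub (mono [::]) = 0.
Proof. by rewrite /cyc_sub cyc_nil subrr. Qed.

Lemma lc_iter_cyc k : lincont (iter k (@cyc K V)).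
Proof.
elim: k => [|k IH]; first exact: lc_id.
exact: (lc_comp lc_cycE IH).
Qed.

Lemma lc_cyc_normE : lincont (@cyc_norm K V).
Proof.
apply: lc_pt => w; exists (fun f => \sum_(k < size w) iter k (@cyc K V) f).
  by apply: lc_sum => k; apply: lc_iter_cyc.
by move=> f; rewrite funsum.
Qed.

Lemma scal_sumr (A : choiceType) c I (r : seq I) (F : I -> A -> K) :
  c *+: (\sum_(i <- r) F i) = \sum_(i <- r) c *+: F i.
Proof. exact: (lcS (lc_scal c (lc_id K A))). Qed.

(** Each rotation moves the next letter of [v] to the end of [u], just as the recursion of [cder]
    does. *)
Lemma iter_cyc_cder v u :
  \sum_(k < size v) iter k (@cyc K V) (mono (v ++ u)) = cder K v u.
Proof.
elim: v u => [|a v IH] u; first by rewrite big_ord0.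
rewrite big_ord_recl /=; congr (_ + _); rewrite -IH.
rewrite scal_sumr; apply: eq_bigr => k _.
by rewrite add0n -iterS iterSr cyc_mono (lcZ (lc_iter_cyc _)) -deg_cat rcons_cat.
Qed.

Definition size_graded (T : X -> X) :=
  forall u w, size w != size u -> T (mono u) w = 0.

Lemma sg_id : size_graded id.
Proof.
move=> u w; rewrite /Defs.mono; case: (w =P u) => [->|//]; by rewrite eqxx.
Qed.

Lemma sg_comp T U : lincont T -> lincont U -> size_graded T -> size_graded U ->
  size_graded (fun f => T (U f)).
Proof.
move=> LT LU HT HU u w ne; apply: (lc_supp LT) => v.
case: (eqVneq (size v) (size u)) => [E _|/HU ->]; last by rewrite eqxx.
by apply: HT; rewrite E.
Qed.

Lemma sg_cyc : size_graded (@cyc K V).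
Proof.
move=> [|a u] w ne; first by rewrite cyc_nil sg_id.
by rewrite cyc_mono funscal sg_id ?mulr0 // size_rcons.
Qed.

Lemma sg_iter_cyc k : size_graded (iter k (@cyc K V)).
Proof.
elim: k => [|k IH]; first exact: sg_id.
exact: (sg_comp lc_cycE (lc_iter_cyc k) sg_cyc IH).
Qed.

Lemma sg_cyc_sub : size_graded (@cyc_sub K V).
Proof. by move=> u w ne; rewrite /cyc_sub !funE sg_id // sg_cyc // subrr. Qed.

Lemma sg_cyc_norm : size_graded (@cyc_norm K V).
Proof.
by move=> u w ne; rewrite /cyc_norm big1 // => k _; rewrite sg_iter_cyc.
Qed.

Lemma cyc_norm_mono w : cyc_norm (mono w) = cder K w [::].
Proof.
rewrite -iter_cyc_cder cats0; apply/funext => v; rewrite /cyc_norm funsum.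
case: (eqVneq (size v) (size w)) => [->//|ne].
by rewrite !big1 // => k _; rewrite sg_iter_cyc.
Qed.

Lemma lc_tensor_partE n : lincont (@tensor_part K V n).
Proof.
have := lc_eval (fun w : word => (size w == n)%:R) id (K := K).
congr lincont; apply/funext => f; apply/funext => w; rewrite /tensor_part.
by case: eqP => _; rewrite ?mul1r ?mul0r.
Qed.

Lemma tensor_part_mono n w :
  tensor_part n (mono w) = if size w == n then mono w else 0.
Proof.
apply/funext => u; rewrite /tensor_part; case: eqP => [<-|ne]; case: eqP => [E|ne'] //.
  by rewrite sg_id //; apply/eqP => /esym.
by rewrite sg_id // E; apply/eqP.
Qed.

Lemma sg_tensor_part T n f : lincont T -> size_graded T ->
  T (tensor_part n f) = tensor_part n (T f).
Proof.
move=> L H; move: f; apply: lc_extX.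
- exact: (lc_comp L (lc_tensor_partE n)).
- exact: (lc_comp (lc_tensor_partE n) L).
move=> u; rewrite tensor_part_mono; apply/funext => w; rewrite /tensor_part.
case: (eqVneq (size u) n) => [<-|ne].
  by case: eqP => // /eqP ne; rewrite H.
by case: eqP => E; rewrite (lc0 L) // H // E eq_sym.
Qed.

Lemma sg_nil T f : lincont T -> size_graded T -> f [::] = 0 -> T f [::] = 0.
Proof.
move=> L H f0; apply: (lc_supp L) => w; case: w => [|a w]; first by rewrite f0 eqxx.
by move=> _; exact: H.
Qed.

(** The two Leibniz terms of N(uv) are, up to the Koszul sign, those of N(vu) in the other order. *)
Lemma cyc_norm_brk (x y : X) : cyc_norm (brk x y) = 0.
Proof.
move: x; apply: lc_extX.
- exact: (lc_comp lc_cyc_normE (lc_brkr y)).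
- exact: lc_zero.
move=> u; move: y; apply: lc_extX.
- exact: (lc_comp lc_cyc_normE (lc_brkl _)).
- exact: lc_zero.
move=> v; rewrite brk_mono (lcB lc_cyc_normE) (lcZ lc_cyc_normE) !cyc_norm_mono !cder_cat /=.
by rewrite !cats0; lin.
Qed.

Lemma cyc_norm_sub f : cyc_norm (@cyc_sub K V f) = 0.
Proof.
move: f; apply: lc_extX; [exact: (lc_comp lc_cyc_normE lc_cyc_subE)|exact: lc_zero|].
case=> [|a u]; first by rewrite cyc_sub_nil (lc0 lc_cyc_normE).
by rewrite cyc_sub_mono cyc_norm_brk.
Qed.

Lemma s_cyc_sub (f : X) : s_op (cyc_sub f) = cyc_sub (s_tail f).
Proof.
move: f; apply: lc_extX.
- exact: (lc_comp (@lc_sE _ _) lc_cyc_subE).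
- exact: (lc_comp lc_cyc_subE (@lc_s_tailE _ _)).
case=> [|a u]; first by rewrite cyc_sub_nil s_tail_nil (lc0 (@lc_sE _ _)) (lc0 lc_cyc_subE).
rewrite cyc_sub_mono s_brk_letter s_tail_mono s_mono (lc_dsum _ _ (@lc_brkl _ _ _)).
rewrite (lc_dsum _ _ (@lc_mull _ _ _)) (lc_dsum _ _ lc_cyc_subE).
by apply: eq_dsum => x y _; rewrite mul_mono cyc_sub_mono.
Qed.

Lemma cyc_norm_s (f : X) : cyc_norm (s_op f) = 2%:R *+: s_tail (cyc_norm f).
Proof.
move: f; apply: lc_extX.
- exact: (lc_comp lc_cyc_normE (@lc_sE _ _)).
- exact: (lc_scal _ (lc_comp (@lc_s_tailE _ _) lc_cyc_normE)).
move=> w; rewrite cyc_norm_mono -cder_s s_mono (lc_dsum _ _ lc_cyc_normE).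
have E : dsum w (fun x y => cder K x y) = dsum w (fun x y => ksign (deg x) (deg y) *+: cder K y x).
  exact: dsumC.
transitivity (dsum w (fun x y => cder K x y) +
   dsum w (fun x y => ksign (deg x) (deg y) *+: cder K y x)).
  rewrite -dsumD; apply: eq_dsum => x y _; rewrite cyc_norm_mono cder_cat cats0.
  by rewrite deg_nil addr0.
rewrite -E /=; have -> : dsum w (fun x y => ksign (deg [::]) (deg y + deg [::]) *+:
    cder K x (y ++ [::])) = dsum w (fun x y => cder K x y).
  by apply: eq_dsum => x y _; rewrite cats0; lin.
lin.
Qed.

(* If [f] is killed by N_n then
   n f = \sum_(k < n) (1 - z^k) f = (1 - z) \sum_(k < n) \sum_(j < k) z^j f. *)
Definition cyc_prim (f : X) : X := fun w =>
  (size w)%:R^-1 *: \sum_(k < size w) \sum_(j < k) iter j (@cyc K V) f w.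

Lemma sum_telescope (g : nat -> K) k : \sum_(j < k) (g j - g j.+1) = g 0%N - g k.
Proof.
elim: k => [|k IH]; first by rewrite big_ord0 subrr.
by rewrite big_ord_recr /= IH; ring.
Qed.

Lemma cyc_sub_prim (f : X) : f [::] = 0 -> cyc_norm f = 0 -> f = cyc_sub (cyc_prim f).
Proof.
move=> f0 Nf; apply/funext => w; rewrite /cyc_sub !funE.
(* The bounds and the factor depend on [w] only through its length, which rotation preserves. *)
have -> : cyc (cyc_prim f) w =
    (size w)%:R^-1 *: \sum_(k < size w) \sum_(j < k) iter j.+1 (@cyc K V) f w.
  rewrite cycE /cyc_prim size_rotr -scalerAr mulr_sumr; congr (_ *: _).
  apply: eq_bigr => k _; rewrite mulr_sumr; apply: eq_bigr => j _.
  by rewrite iterS cycE.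
rewrite /cyc_prim -scalerBr -sumrB.
rewrite (eq_bigr (fun k : 'I_(size w) => f w - iter k (@cyc K V) f w)) => [|k _]; last first.
  by rewrite -sumrB (sum_telescope (fun j => iter j (@cyc K V) f w)).
rewrite sumrB sumr_const card_ord.
have := congr1 (fun g : X => g w) Nf; rewrite /cyc_norm => ->; rewrite subr0.
(* At the empty word the norm is an empty sum and says nothing; the vanishing constant term takes
   over. *)
case: w => [|a w] //=; first by rewrite f0 mulr0n scaler0.
by rewrite -scaler_nat scalerA mulVf ?scale1r // Num.Theory.pnatr_eq0.
Qed.

End Cyclic.

(** * Lie monomials, primitivity and products of Lie elements *)

Section Lie.
Variables (K : comAlgType rat) (V : free_graded_module).

Local Notation word := (word V).
Local Notation X := (word -> K).
Local Notation XX := (word * word -> K).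
Local Notation mono := (mono K (V := V)).
Local Notation ksign := (ksign K).
Local Notation deg := (@word_deg V).

(** The part of homogeneity that Koszul signs can detect. *)
Definition pdeg (d : int) (x : X) := forall w, x w != 0 -> par (deg w) = par d.

Lemma pdeg_mono w : pdeg (deg w) (mono w).
Proof. by move=> u; rewrite /Defs.mono; case: (u =P w) => [->|_] //; rewrite eqxx. Qed.

Lemma ksign_par i j i' j' : par i = par i' -> par j = par j' -> ksign i j = ksign i' j'.
Proof. by rewrite !ksignE => -> ->. Qed.

Lemma lc_bracket1 d e y : lincont (fun x : X => bracket d e x y).
Proof. rewrite /bracket; lc. Qed.

Lemma lc_bracket2 d e x : lincont (fun y : X => bracket d e x y).
Proof. rewrite /bracket; lc. Qed.

Lemma bracket_mono d e u v : par (deg u) = par d -> par (deg v) = par e ->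
  bracket d e (mono u) (mono v) = brk (mono u) (mono v).
Proof.
by move=> pu pv; rewrite /bracket brk_mono !mul_mono (ksign_par pu pv).
Qed.

Lemma bracketE d e x y : pdeg d x -> pdeg e y -> bracket d e x y = brk x y.
Proof.
move=> px py; apply: (lc_ext_suppX (T := fun x => bracket d e x y)
  (U := fun x => brk x y)); [exact: lc_bracket1|exact: lc_brkr|] => u /px pu.
apply: (lc_ext_suppX (T := fun y => bracket d e (mono u) y)
  (U := fun y => brk (mono u) y)); [exact: lc_bracket2|exact: lc_brkl|] => v /py pv.
exact: bracket_mono.
Qed.

Lemma lie_pdeg d x : lie_monomial d x -> pdeg d x /\ x [::] = 0.
Proof.
elim=> {d x} [a|d e x y _ [px x0] _ [py y0]].
  split=> [w|//]; rewrite /Defs.mono; case: (w =P [:: a]) => [->|_]; last by rewrite eqxx.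
  by rewrite deg_cons deg_nil addr0.
split=> [w|]; last first.
  by rewrite /bracket !funE /mul !big_ord1 /= x0 y0; ring.
apply: contraNeq => ne; rewrite bracketE //; apply/eqP.
apply: (lc_supp (lc_brkr y)) => u /px pu; apply: (lc_supp (lc_brkl _)) => v /py pv.
rewrite [brk _ _]brk_mono !funE.
have [E|nE] := eqVneq w (u ++ v); first by move: ne; rewrite E !signE pu pv eqxx.
have [E'|nE'] := eqVneq w (v ++ u).
  by move: ne; rewrite E' !signE pu pv addbC eqxx.
by rewrite /Defs.mono (negPf nE) (negPf nE') mulr0 subrr.
Qed.

(** The graded Jacobi identity, which carries statements on commutators from letters to Lie
    monomials. *)
Lemma lie_brk_bracket d e (x y f : X) : pdeg d x -> pdeg e y ->
  brk (bracket d e x y) f = brk x (brk y f) - ksign d e *+: brk y (brk x f).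
Proof.
move=> px py; apply: (lc_ext_suppX (T := fun x => brk (bracket d e x y) f)
  (U := fun x => brk x (brk y f) - ksign d e *+: brk y (brk x f))) => [||u /px pu].
- by apply: (lc_comp (lc_brkr f)); exact: lc_bracket1.
- lc.
apply: (lc_ext_suppX (T := fun y => brk (bracket d e (mono u) y) f)
  (U := fun y => brk (mono u) (brk y f) - ksign d e *+: brk y (brk (mono u) f)))
  => [||v /py pv].
- by apply: (lc_comp (lc_brkr f)); exact: lc_bracket2.
- lc.
move: f; apply: lc_extX; [lc|lc|] => w.
rewrite bracket_mono // !brk_mono !brkE !brk_mono -!catA -(ksign_par pu pv).
lin.
Qed.

Lemma s_brk_lie d (x : X) f : lie_monomial d x -> s_op (brk x f) = brk x (s_op f).
Proof.
move=> H; elim: H f => {d x} [a|d e x y /lie_pdeg[px _] IHx /lie_pdeg[py _] IHy] f.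
  exact: s_brk_letter.
by rewrite !lie_brk_bracket // (lcB (@lc_sE _ _)) (lcZ (@lc_sE _ _)) !(IHx, IHy).
Qed.

Lemma lc_prim_mul1 F : lincont (fun x : X => prim_mul x F).
Proof.
apply: lc_add.
  exact: (lc_pt2 (U := fun p x => mul x (fun u => F (u, p.2))) (fun p => p.1)
    (fun p => lc_mulr _)).
apply: (lc_pt2 (U := fun p x => mul (twist p.1 x) (fun u => F (p.1, u))) (fun p => p.2)).
by move=> p; lc.
Qed.

Lemma lc_act1_brk F : lincont (fun x : X => act1 (brk x) F).
Proof.
exact: (lc_pt2 (U := fun p x => brk x (fun u => F (u, p.2))) (fun p => p.1)
  (fun p => lc_brkr _)).
Qed.

(** Commutators of primitive elements are primitive, phrased through left multiplications so that no
    algebra structure on the tensor square is needed. *)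
Lemma prim_mul_bracket d e (x y : X) F : pdeg d x -> pdeg e y ->
  prim_mul (bracket d e x y) F =
  prim_mul x (prim_mul y F) - ksign d e *+: prim_mul y (prim_mul x F).
Proof.
move=> px py; apply: (lc_ext_suppX (T := fun x => prim_mul (bracket d e x y) F)
  (U := fun x => prim_mul x (prim_mul y F) - ksign d e *+: prim_mul y (prim_mul x F)))
  => [||u /px pu].
- by apply: (lc_comp (lc_prim_mul1 F)); exact: lc_bracket1.
- apply: lc_sub; first exact: lc_prim_mul1.
  by apply: lc_scal; apply: (lc_comp (lc_prim_mulE y)); exact: lc_prim_mul1.
apply: (lc_ext_suppX (T := fun y => prim_mul (bracket d e (mono u) y) F)
  (U := fun y => prim_mul (mono u) (prim_mul y F) -
                 ksign d e *+: prim_mul y (prim_mul (mono u) F))) => [||v /py pv].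
- by apply: (lc_comp (lc_prim_mul1 F)); exact: lc_bracket2.
- apply: lc_sub; last by apply: lc_scal; exact: lc_prim_mul1.
  by apply: (lc_comp (lc_prim_mulE _)); exact: lc_prim_mul1.
move: F; apply: lc_extXX; [lc|lc|] => p q.
rewrite bracket_mono // brk_mono !prim_mul_tens !twist_mono !mulE !mul_mono.
rewrite (lcB (lc_twistE _ p)) (lcZ (lc_twistE _ p)) !twist_mono !mulE !mul_mono !tensE.
rewrite !(lcD (lc_prim_mulE _)) !(lcZ (lc_prim_mulE _)) !prim_mul_tens !twist_mono.
rewrite !mulE !mul_mono !tensE -!catA -(ksign_par pu pv).
lin.
Qed.

Lemma coprod_lie d (x f : X) : lie_monomial d x ->
  coprod (mul x f) = prim_mul x (coprod f).
Proof.
move=> H; elim: H f => {d x} [a|d e x y /lie_pdeg[px _] IHx /lie_pdeg[py _] IHy] f.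
  move: f; apply: lc_extX; [lc|lc|] => w.
  by rewrite mul_mono !coprod_mono coprod_word_cons.
rewrite prim_mul_bracket // /bracket !mulE -!mul_seriesA (lcB (@lc_coprodE _ _)).
by rewrite (lcZ (@lc_coprodE _ _)) !(IHx, IHy).
Qed.

(** The sign of moving an object of degree [d] past [x], for [x] not necessarily homogeneous. *)
Definition sgnop (d : int) (x : X) : X := fun w => ksign d (deg w) * x w.

Lemma lc_sgnopE d : lincont (sgnop d).
Proof. exact: (lc_eval (fun w : word => ksign d (deg w)) id). Qed.

Lemma sgnop_mono d w : sgnop d (mono w) = ksign d (deg w) *+: mono w.
Proof.
apply/funext => u; rewrite /sgnop /scal /Defs.mono.
by case: eqP => [->//|_]; rewrite !mulr0.
Qed.

Lemma sgnop_mul d (x y : X) : sgnop d (mul x y) = mul (sgnop d x) (sgnop d y).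
Proof.
move: x; apply: lc_extX => [||u].
- exact: (lc_comp (lc_sgnopE d) (lc_mulr _)).
- exact: (lc_comp (lc_mulr _) (lc_sgnopE d)).
move: y; apply: lc_extX => [||v].
- exact: (lc_comp (lc_sgnopE d) (lc_mull _)).
- exact: (lc_comp (lc_mull _) (lc_sgnopE d)).
by rewrite mul_mono !sgnop_mono !mulE mul_mono; lin.
Qed.

Lemma sgnop_pdeg d e x : pdeg e x -> sgnop d x = ksign d e *+: x.
Proof.
move=> px; apply/funext => w; rewrite /sgnop /scal.
case: (eqVneq (x w) 0) => [->|/px pw]; first by rewrite !mulr0.
by rewrite (ksign_par (i' := d) (j' := e)).
Qed.

Lemma prim_mul_pdeg d x (u v : X) : pdeg d x ->
  prim_mul x (tens u v) = tens (mul x u) v + tens (sgnop d u) (mul x v).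
Proof.
move=> px; move: u; apply: lc_extX => [||u].
- lc.
- apply: lc_add; [lc|exact: (lc_comp (lc_tensr _) (lc_sgnopE d))].
rewrite prim_mul_tens sgnop_mono; congr (_ + _).
have -> : twist u x = ksign d (deg u) *+: x.
  apply/funext => w; rewrite /twist /scal.
  case: (eqVneq (x w) 0) => [->|/px pw]; first by rewrite !mulr0.
  by rewrite (ksign_par (i' := d) (j' := deg u)).
by rewrite !mulE !tensE.
Qed.

(** Spans of products of exactly [k] Lie monomials. They overlap, since a bracket of letters is also
    a combination of products of two letters; only the triangular action of [s_op] with respect to
    [k] matters. *)
Inductive lie_prod : nat -> X -> Prop :=
| lie_prod_one : lie_prod 0 (mono [::])
| lie_prod_mul d x k y : lie_monomial d x -> lie_prod k y -> lie_prod k.+1 (mul x y)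
| lie_prod_lin c k x y : lie_prod k x -> lie_prod k y -> lie_prod k (c *+: x + y)
| lie_prod_zero k : lie_prod k 0.

Inductive lie_prod2 : nat -> XX -> Prop :=
| lie_prod2_tens i j x y : lie_prod i x -> lie_prod j y -> lie_prod2 (i + j) (tens x y)
| lie_prod2_lin c k F H : lie_prod2 k F -> lie_prod2 k H -> lie_prod2 k (c *+: F + H)
| lie_prod2_zero k : lie_prod2 k 0.

Lemma lie_prodZ c k x : lie_prod k x -> lie_prod k (c *+: x).
Proof. by move=> H; rewrite -[_ *+: _]addr0; apply: lie_prod_lin => //; constructor. Qed.

Lemma lie_prodD k x y : lie_prod k x -> lie_prod k y -> lie_prod k (x + y).
Proof. by rewrite -{2}[x]scal1; apply: lie_prod_lin. Qed.

Lemma lie_prod2D k x y : lie_prod2 k x -> lie_prod2 k y -> lie_prod2 k (x + y).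
Proof. by rewrite -{2}[x]scal1; apply: lie_prod2_lin. Qed.

Lemma lie_prodM i j x y : lie_prod i x -> lie_prod j y -> lie_prod (i + j) (mul x y).
Proof.
move=> Hx Hy; elim: Hx => {i x} [|d x k z Hd _ IH|c k x z _ IHx _ IHz|k].
- by rewrite mul_series1l.
- by rewrite -mul_seriesA addSn; apply: (lie_prod_mul Hd).
- by rewrite !mulE; apply: lie_prod_lin.
- by rewrite mulE; constructor.
Qed.

(** Bracketing with [l] is a derivation: it replaces one Lie factor at a time by a Lie monomial and
    keeps their number. *)
Lemma lie_prod_brk d l k x : lie_monomial d l -> lie_prod k x -> lie_prod k (brk l x).
Proof.
move=> Hl; elim=> {k x} [|e x k y Hx Hy IH|c k x y _ IHx _ IHy|k].
- suff -> : brk l (mono [::]) = 0 by constructor.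
  move: {Hl} l; apply: lc_extX; [lc|lc|] => u.
  by rewrite brk_mono cats0; lin.
- have [pl _] := lie_pdeg Hl; have [px _] := lie_pdeg Hx.
  have -> : brk l (mul x y) = mul (bracket d e l x) y + ksign d e *+: mul x (brk l y).
    rewrite bracketE //.
    apply: (lc_ext_suppX (T := fun l => brk l (mul x y))
      (U := fun l => mul (brk l x) y + ksign d e *+: mul x (brk l y))); [lc|lc|] => u /pl pu.
    apply: (lc_ext_suppX (T := fun x => brk (mono u) (mul x y))
      (U := fun x => mul (brk (mono u) x) y + ksign d e *+: mul x (brk (mono u) y)));
      [lc|lc|] => v /px pv.
    rewrite -(ksign_par pu pv); move: {Hy IH} y; apply: lc_extX; [lc|lc|] => w.
    by rewrite mul_mono !brk_mono !mulE !mul_mono -!catA; lin.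
  apply: lie_prodD; first exact: (lie_prod_mul (lie_bracket Hl Hx)).
  by apply: lie_prodZ; apply: (lie_prod_mul Hx).
- by rewrite !brkE; apply: lie_prod_lin.
- by rewrite brkE; constructor.
Qed.

Lemma lie_prod_sgnop d k x : lie_prod k x -> lie_prod k (sgnop d x).
Proof.
elim=> {k x} [|e x k y Hx _ IH|c k x y _ IHx _ IHy|k].
- by rewrite sgnop_mono; apply: lie_prodZ; constructor.
- have [px _] := lie_pdeg Hx; rewrite sgnop_mul (sgnop_pdeg _ px) mulE.
  by apply: lie_prodZ; apply: lie_prod_mul Hx _.
- by rewrite (lcP (lc_sgnopE d)); apply: lie_prod_lin.
- by rewrite (lc0 (lc_sgnopE d)); constructor.
Qed.

Lemma lie_prod2_prim_mul d l k F : lie_monomial d l -> lie_prod2 k F ->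
  lie_prod2 k.+1 (prim_mul l F).
Proof.
move=> Hl; elim=> {k F} [i j x y Hx Hy|c k F H _ IHF _ IHH|k].
- rewrite (prim_mul_pdeg _ _ (lie_pdeg Hl).1); apply: lie_prod2D.
    by rewrite -addSn; apply: lie_prod2_tens => //; apply: lie_prod_mul Hl _.
  rewrite -addnS; apply: lie_prod2_tens; first exact: lie_prod_sgnop.
  exact: lie_prod_mul Hl _.
- by rewrite (lcP (lc_prim_mulE l)); apply: lie_prod2_lin.
- by rewrite (lc0 (lc_prim_mulE l)); constructor.
Qed.

(** Each primitive factor goes into one of the two halves, so the total number of factors is
    kept. *)
Lemma coprod_lie_prod k x : lie_prod k x -> lie_prod2 k (coprod x).
Proof.
elim=> {k x} [|d x k y Hx _ IH|c k x y _ IHx _ IHy|k].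
- have -> : coprod (mono [::]) = tens (mono [::]) (mono [::]).
    by rewrite coprod_mono coprod_wordE.
  exact: (lie_prod2_tens lie_prod_one lie_prod_one).
- by rewrite (coprod_lie _ Hx); apply: lie_prod2_prim_mul Hx _.
- by rewrite (lcP (@lc_coprodE _ _)); apply: lie_prod2_lin.
- by rewrite (lc0 (@lc_coprodE _ _)); constructor.
Qed.

Lemma lie_prod2_brk d l k F : lie_monomial d l -> lie_prod2 k F ->
  lie_prod k (mult (act1 (brk l) F)).
Proof.
move=> Hl; have La := lc_act1E (lc_brkl l).
elim=> {k F} [i j x y Hx Hy|c k F H _ IHF _ IHH|k].
- rewrite (act1_tens _ _ (lc_brkl l)) mult_tens; apply: lie_prodM => //.
  exact: lie_prod_brk Hl _.
- by rewrite (lcP La) (lcP (@lc_multE _ _)); apply: lie_prod_lin.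
- by rewrite (lc0 La) (lc0 (@lc_multE _ _)); constructor.
Qed.

(** For F = u \otimes v this is luv +- ulv = 2 luv - [l, u]v. Each Lie factor thus contributes a
    factor 2 to the eigenvalue. *)
Lemma mult_prim_mul (l : X) F :
  mult (prim_mul l F) = 2%:R *+: mul l (mult F) - mult (act1 (brk l) F).
Proof.
move: l; apply: lc_extX => [||l].
- exact: (lc_comp (@lc_multE _ _) (lc_prim_mul1 F)).
- apply: lc_sub; first by lc.
  exact: (lc_comp (@lc_multE _ _) (lc_act1_brk F)).
move: F; apply: lc_extXX => [||u v].
- lc.
- apply: lc_sub; first by lc.
  exact: (lc_comp (@lc_multE _ _) (lc_act1E (lc_brkl _))).
rewrite prim_mul_tens (act1_tens _ _ (lc_brkl _)) (lcD (@lc_multE _ _)) !mult_tens.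
by rewrite twist_mono brk_mono !mulE !mul_mono -!catA; lin.
Qed.

(* s (l x) is 2 l s(x) up to a sum of the terms [l, x1] x2, where \Delta x is
   the sum of the x1 \otimes x2; these involve only as many Lie factors as x. *)
Lemma s_lie_prod k x : lie_prod k x ->
  if k is k'.+1 then lie_prod k' (s_op x - (2%:R ^+ k) *+: x)
  else s_op x - (2%:R ^+ k) *+: x = 0.
Proof.
have Ls := @lc_sE K V.
elim=> {k x} [|d x k y Hx Hy IH|c k x y _ IHx _ IHy|k].
- by rewrite s_mono /= expr0 scal1 subrr.
- have -> : s_op (mul x y) - (2%:R ^+ k.+1) *+: mul x y =
      2%:R *+: mul x (s_op y - (2%:R ^+ k) *+: y) + (-1) *+: mult (act1 (brk x) (coprod y)).
    by rewrite /s_op (coprod_lie _ Hx) mult_prim_mul !mulE exprS; lin.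
  apply: lie_prodD; last first.
    by apply: lie_prodZ; apply: lie_prod2_brk Hx _; apply: coprod_lie_prod.
  apply: lie_prodZ; case: k IH {Hy} => [->|k IH]; first by rewrite mulE; constructor.
  exact: lie_prod_mul Hx _.
- have -> : s_op (c *+: x + y) - (2%:R ^+ k) *+: (c *+: x + y) =
      c *+: (s_op x - (2%:R ^+ k) *+: x) + (s_op y - (2%:R ^+ k) *+: y).
    by rewrite (lcP Ls); lin.
  case: k IHx IHy => [-> ->|k]; last exact: lie_prod_lin.
  by rewrite addr0; apply/funext => w; rewrite !funE mulr0.
- rewrite (lc0 Ls); have -> : (0 - (2%:R ^+ k) *+: 0 : X) = 0 by lin.
  by case: k => // k; constructor.
Qed.

Lemma lie_prod_mono w : lie_prod (size w) (mono w).
Proof.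
elim: w => [|a w IH]; first by constructor.
by rewrite -cat1s -mul_mono; apply: (lie_prod_mul (lie_letter K a)).
Qed.

Lemma lie_prod_const x : lie_prod 0 x -> tensor_part 0 x = x.
Proof.
move E : 0%N => k H; elim: H E => {k x} [_|//|c k x y _ IHx _ IHy E|k _].
- by rewrite tensor_part_mono eqxx.
- by move: (IHx E) (IHy E); rewrite (lcP (@lc_tensor_partE _ _ _)) => -> ->.
- by rewrite (lc0 (@lc_tensor_partE _ _ _)).
Qed.

End Lie.

(** * Diagonalization of s and the idempotents e(i) *)

Section Eigenspaces.
Variables (K : comAlgType rat) (V : free_graded_module).

Local Notation word := (word V).
Local Notation X := (word -> K).
Local Notation mono := (mono K (V := V)).

Lemma lambda_scal (A : choiceType) i (f : A -> K) : lambda i *: f = 2%:R ^+ i *+: f.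
Proof. by rewrite scal_rat /lambda -in_algE rmorphXn rmorph_nat. Qed.

Lemma lambda_inj i j : lambda i = lambda j -> i = j.
Proof.
rewrite /lambda => /eqP; rewrite -!natrX Num.Theory.eqr_nat eqn_exp2l // => /eqP.
by [].
Qed.

Lemma lambda_sub i j : i != j -> lambda i - lambda j != 0.
Proof. by apply: contraNneq => /eqP; rewrite subr_eq0 => /eqP/lambda_inj ->. Qed.

(** By induction s x - 2^k x is a sum of eigenvectors with smaller eigenvalues, which can be
    corrected away from [x]. The last clause records that the eigenvalue 1 only comes from
    constants. *)
Lemma lie_prod_eig k (x : X) : lie_prod k x ->
  exists g : nat -> X, [/\ x = \sum_(i < k.+1) g i,
    forall i, s_op (g i) = lambda i *: g i & tensor_part 0 (g 0%N) = g 0%N].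
Proof.
have Ls := @lc_sE K V; elim: k x => [|k IH] x Hx.
  exists (fun i => if i is 0%N then x else 0); split.
  - by rewrite big_ord1.
  - case=> [|i]; last by rewrite (lc0 Ls) scaler0.
    by apply/eqP; rewrite -subr_eq0 lambda_scal; apply/eqP; apply: (s_lie_prod Hx).
  - exact: lie_prod_const.
have [h [Eh Hh h0]] := IH _ (s_lie_prod Hx).
(* [s_op] - lambda k.+1 acts on [h j] by lambda j - lambda k.+1, so this coefficient makes it
   annihilate [y]. *)
pose c i := (lambda i - lambda k.+1)^-1.
pose y := x - \sum_(j < k.+1) c j *: h j.
exists (fun i => if (i <= k)%N then c i *: h i else if i == k.+1 then y else 0).
split=> [|i|]; last by rewrite /= (lcQ (@lc_tensor_partE _ _ _)) h0.
  rewrite big_ord_recr /= ltnn eqxx addrC /y.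
  rewrite [X in _ + X](eq_bigr (fun j : 'I_k.+1 => c j *: h j)) ?subrK // => j _.
  by rewrite -ltnS ltn_ord.
case: leqP => [le|gt]; first by rewrite (lcQ Ls) Hh !scalerA mulrC.
case: eqP => [->|_]; last by rewrite (lc0 Ls) scaler0.
have -> : s_op y = s_op x - \sum_(j < k.+1) c j *: (lambda j *: h j).
  rewrite /y (lcB Ls) (lcS Ls); congr (_ - _); apply: eq_bigr => j _.
  by rewrite (lcQ Ls) Hh.
have -> : s_op x = \sum_(i < k.+1) h i + lambda k.+1 *: x.
  by rewrite -Eh lambda_scal subrK.
rewrite /y scalerBr scaler_sumr addrAC addrC; congr (_ + _).
rewrite -sumrB -sumrN; apply: eq_bigr => j _.
have ne : (j : nat) != k.+1 by rewrite neq_ltn ltn_ord.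
rewrite -{1}[h j]scale1r -(mulVf (lambda_sub ne)) -/(c j) !scalerA -scalerBl -scaleNr.
by congr (_ *: _); ring.
Qed.

Lemma sg_s : size_graded (@s_op K V).
Proof.
move=> u w ne; rewrite /s_op coprod_mono /mult big1 // => i _.
apply/eqP; apply: contraNT ne => /coprod_word_perm /perm_size ->.
by rewrite /= cat_take_drop.
Qed.

Lemma lc_e_comp n i : lincont (@e_comp K V n i).
Proof.
rewrite /e_comp; case: leqP => _; last exact: lc_zero.
apply: (lc_scalQ (T := \big[_/_]_(r < n.+1 | _) _)).
apply: (big_ind (fun T : X -> X => lincont T)) => [|T U LT LU|r _]; first exact: lc_id.
  exact: lc_comp LT LU.
by lc.
Qed.

(** [e_comp] is the Lagrange interpolation polynomial in [s_op] with value 1 at lambda i and 0 at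
    the other nodes. *)
Lemma e_comp_eig n i j (f : X) : (i <= n)%N -> (j <= n)%N -> s_op f = lambda j *: f ->
  e_comp n i f = if i == j then f else 0.
Proof.
move=> le lj Hf; rewrite /e_comp le.
have -> : (\big[@comp X X X/idfun]_(r < n.+1 | r != i :> nat)
    (fun g : X => s_op g - lambda r *: g)) f =
    (\prod_(r < n.+1 | r != i :> nat) (lambda j - lambda r)) *: f.
  apply: (big_rec2 (fun (T : X -> X) c => T f = c *: f)); first by rewrite scale1r.
  by move=> r c T _ /= ->; rewrite (lcQ (@lc_sE _ _)) Hf !scalerA -scalerBl; congr (_ *: _); ring.
case: eqP => [<-|/eqP ne].
  rewrite scalerA mulVf ?scale1r //; apply/prodf_neq0 => r ne.
  by apply: lambda_sub; rewrite eq_sym.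
have ltj : (j < n.+1)%N by rewrite ltnS.
rewrite [X in X *: f](bigD1 (Ordinal ltj)) /=; last by rewrite eq_sym.
by rewrite subrr mul0r scale0r scaler0.
Qed.

Lemma lc_eE i : lincont (@e_op K V i).
Proof.
apply: (lc_pt2 (U := fun w f => e_comp (size w) i (tensor_part (size w) f)) id) => w.
exact: (lc_comp (lc_e_comp _ _) (@lc_tensor_partE _ _ _)).
Qed.

Lemma sg_e i : size_graded (@e_op K V i).
Proof.
move=> u w ne; rewrite /e_op tensor_part_mono eq_sym (negPf ne).
by rewrite (lc0 (lc_e_comp _ _)).
Qed.

Lemma e_big i (f : X) w : (size w < i)%N -> e_op i f w = 0.
Proof. by move=> lt; rewrite /e_op /e_comp leqNgt lt. Qed.

Lemma tensor_part_id n (f : X) : tensor_part n (tensor_part n f) = tensor_part n f.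
Proof. by apply/funext => w; rewrite /tensor_part; case: eqP. Qed.

Lemma e_eig i j n (f : X) : (j <= n)%N -> tensor_part n f = f ->
  s_op f = lambda j *: f -> e_op i f = if i == j then f else 0.
Proof.
move=> lj Ef Hf; apply/funext => w; rewrite /e_op.
case: (eqVneq (size w) n) => [->|ne].
  rewrite Ef; case: (leqP i n) => [le|lt]; first by rewrite (e_comp_eig le lj).
  by rewrite /e_comp leqNgt lt /=; case: eqP => // E; move: lt; rewrite E ltnNge lj.
have -> : tensor_part (size w) f = 0.
  rewrite -Ef; apply/funext => u; rewrite /tensor_part; case: eqP => // ->.
  by rewrite (negPf ne).
rewrite (lc0 (lc_e_comp _ _)); case: ifP => // _.
by rewrite -Ef /tensor_part (negPf ne).
Qed.

(** As [s_op] preserves lengths, the parts of length [size w] of the eigenvectors are again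
    eigenvectors; the constant one disappears when [w] is nonempty. *)
Lemma mono_eig w : exists g : nat -> X, [/\ mono w = \sum_(i < (size w).+1) g i,
  forall i, s_op (g i) = lambda i *: g i,
  forall i j, (j <= size w)%N -> e_op i (g j) = if i == j then g j else 0
  & (0 < size w)%N -> g 0%N = 0].
Proof.
have Lt := @lc_tensor_partE K V (size w).
have [g [Eg Hg g0]] := lie_prod_eig (lie_prod_mono K w).
have Hg' i : s_op (tensor_part (size w) (g i)) = lambda i *: tensor_part (size w) (g i).
  by rewrite (sg_tensor_part _ _ (@lc_sE _ _) sg_s) Hg (lcQ Lt).
exists (fun i => tensor_part (size w) (g i)); split=> [|//|i j le|lt].
- by rewrite -(lcS Lt) -Eg tensor_part_mono eqxx.
- exact: (e_eig i le (tensor_part_id _ _) (Hg' j)).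
- rewrite -g0; apply/funext => u; rewrite /tensor_part; case: eqP => // ->.
  by rewrite gtn_eqF.
Qed.

Lemma e_mono_eig w : exists g : nat -> X,
  [/\ mono w = \sum_(i < (size w).+1) g i, forall i, s_op (g i) = lambda i *: g i,
  forall i, (i <= size w)%N -> e_op i (mono w) = g i,
  forall i j, (j <= size w)%N -> e_op i (g j) = if i == j then g j else 0
  & (0 < size w)%N -> g 0%N = 0].
Proof.
have [g [Eg Hg Hg' g0]] := mono_eig w; exists g; split=> // i le.
rewrite Eg (lcS (lc_eE i)).
rewrite (bigD1 (Ordinal (n := (size w).+1) (m := i) le)) //= Hg' // eqxx.
rewrite big1 ?addr0 // => j ne; rewrite Hg'; last by rewrite -ltnS ltn_ord.
by case: eqP => // E; case/eqP: ne; apply: val_inj.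
Qed.

Lemma e_mono_big i w : (size w < i)%N -> e_op i (mono w) = 0.
Proof.
move=> lt; apply/funext => u; case: (eqVneq (size u) (size w)) => [E|ne]; last exact: sg_e.
by rewrite e_big // E.
Qed.

Lemma s_e i (f : X) : s_op (e_op i f) = lambda i *: e_op i f.
Proof.
move: f; apply: lc_extX => [||w].
- exact: (lc_comp (@lc_sE _ _) (lc_eE i)).
- exact: (lc_scalQ _ (lc_eE i)).
case: (leqP i (size w)) => [le|lt].
  by have [g [_ Hg -> //]] := e_mono_eig w.
by rewrite e_mono_big // (lc0 (@lc_sE _ _)) scaler0.
Qed.

Lemma e_s i (f : X) : e_op i (s_op f) = lambda i *: e_op i f.
Proof.
move: f; apply: lc_extX => [||w].
- exact: (lc_comp (lc_eE i) (@lc_sE _ _)).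
- exact: (lc_scalQ _ (lc_eE i)).
have [g [Eg Hg Hi Hg' _]] := e_mono_eig w.
rewrite Eg (lcS (@lc_sE _ _)) !(lcS (lc_eE i)) scaler_sumr; apply: eq_bigr => j _.
rewrite Hg (lcQ (lc_eE i)) Hg'; last by rewrite -ltnS ltn_ord.
by case: eqP => [->//|_]; rewrite !scaler0.
Qed.

Lemma e_sum (f : X) w : \sum_(i < (size w).+1) e_op i f w = f w.
Proof.
pose T (f : X) : X := fun w => \sum_(i < (size w).+1) e_op i f w.
have LT : lincont T.
  have := lc_pt2 (U := fun w f => \sum_(i < (size w).+1) e_op i f) id
    (fun w => lc_sum _ _ (fun i => lc_eE (nat_of_ord i))).
  by congr lincont; apply/funext => h; apply/funext => u; rewrite funsum.
rewrite -[LHS]/(T f w); congr (_ w); move: f; apply: lc_extX => // [|u].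
  exact: lc_id.
apply/funext => v; rewrite /T; case: (eqVneq (size v) (size u)) => [E|ne].
  have [g [Eg _ Hi _ _]] := e_mono_eig u; rewrite [in RHS]Eg funsum E.
  by apply: eq_bigr => i _; rewrite Hi // -ltnS.
by rewrite sg_id // big1 // => i _; apply: sg_e.
Qed.

(** The eigenvalue 1 occurs on constants only, which is why the cyclic splitting starts at i = 1. *)
Lemma e_zero (f : X) : f [::] = 0 -> e_op 0 f = 0.
Proof.
move=> f0; apply: (lc_ext_suppX (T := e_op 0) (U := fun=> 0)) => [||[|a w]].
- exact: lc_eE.
- exact: lc_zero.
- by rewrite f0 eqxx.
- move=> _; have [g [_ _ Hi _ g0]] := e_mono_eig (a :: w).
  by rewrite Hi // g0.
Qed.

End Eigenspaces.

(** * Operators that intertwine two spectral families *)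

Section SpectralFamilies.
Variables (K : comAlgType rat) (V : free_graded_module).

Local Notation word := (word V).
Local Notation X := (word -> K).
Local Notation mono := (mono K (V := V)).

(* [E i] is the projection onto the eigenspace of [S] for 2^i, on the series
   without constant term. *)
Record spectral (S : X -> X) (E : nat -> X -> X) : Prop := Spectral {
  sp_lc : forall i, lincont (E i);
  sp_sg : forall i, size_graded (E i);
  sp_eig : forall i f, S (E i f) = lambda i *: E i f;
  sp_comm : forall i f, E i (S f) = lambda i *: E i f;
  sp_big : forall i f w, (size w < i)%N -> E i f w = 0;
  sp_sum : forall f w, f [::] = 0 -> \sum_(i < (size w).+1) E i f w = f w
}.

Lemma spectral_e : spectral (@s_op K V) (@e_op K V).
Proof.
split=> [i|i|i f|i f|i f w|f w _].
- exact: lc_eE.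
- exact: sg_e.
- exact: s_e.
- exact: e_s.
- exact: e_big.
- exact: e_sum.
Qed.

Lemma spectral_et : spectral (@s_tail K V) (@et_op K V).
Proof.
have etE i : @et_op K V i = tail (@e_op K V i) by [].
split=> [i|i|i f|i f|i f w|f w f0].
- by rewrite etE; apply: lc_tail; apply: lc_eE.
- move=> [|a u] w ne; rewrite etE; first by rewrite (tail_nil (@lc_eE _ _ _)).
  rewrite (tail_mono _ _ _ (@lc_eE _ _ _)); case: w ne => [//|b v] ne.
  by rewrite sg_e ?mulr0.
- apply/funext => -[|a u]; first by rewrite -[RHS]/(_ *: (0 : K)) scaler0.
  by rewrite -[LHS]/(s_op (e_op i (fun v => f (a :: v))) u) s_e.
- apply/funext => -[|a u]; first by rewrite -[RHS]/(_ *: (0 : K)) scaler0.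
  by rewrite -[LHS]/(e_op i (s_op (fun v => f (a :: v))) u) e_s.
- by case: w => [//|a u] /= /ltnW lt; rewrite e_big.
- case: w => [|a u] /=; first by rewrite big_ord1 f0.
  (* The tail of a word of length n has length n - 1, so the projection of index n vanishes
     there. *)
  rewrite big_ord_recr /= e_big // addr0; exact: e_sum.
Qed.

Lemma sp_nil S E i f : spectral S E -> f [::] = 0 -> E i f [::] = 0.
Proof. by move=> H; apply: sg_nil; [exact: sp_lc H i|exact: sp_sg H i]. Qed.

(** Applying [E k] to S f = lambda j f shows that lambda k - lambda j annihilates [E k f]; hence
    only [E j f] survives in the sum, which is [f]. *)
Lemma sp_fix S E i j f : spectral S E -> f [::] = 0 -> S f = lambda j *: f ->
  E i f = if i == j then f else 0.
Proof.
move=> H f0 Hf.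
have E0 k : k != j -> E k f = 0.
  move=> ne; apply/eqP.
  have : (lambda k - lambda j) *: E k f == 0.
    by rewrite scalerBl -(sp_comm H) Hf (lcQ (sp_lc H k)) subrr.
  move/eqP/(congr1 (fun g => (lambda k - lambda j)^-1 *: g)).
  by rewrite scaler0 scalerA mulVf ?lambda_sub // scale1r => ->.
case: (eqVneq i j) => [->|/E0 //]; apply/funext => w; rewrite -[RHS](sp_sum H _ f0).
case: (leqP j (size w)) => [le|lt].
  rewrite (bigD1 (Ordinal (n := (size w).+1) (m := j) le)) //= big1 ?addr0 // => k ne.
  by rewrite E0.
by rewrite (sp_big H) // big1 // => k _; rewrite E0 // neq_ltn (leq_trans (ltn_ord k)).
Qed.

Lemma sp_proj S E i j f : spectral S E -> f [::] = 0 ->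
  E i (E j f) = if i == j then E j f else 0.
Proof. by move=> H f0; apply: (sp_fix i H); [exact: sp_nil H f0|exact: sp_eig H j f]. Qed.

(** [T] lowers the exponent of each eigenvalue by [k], so it carries the eigenvector decomposition
    of a word to that of its image. The shift is 1 for the norm and 0 in the other uses; the
    condition on [j < k] rules out exponents that would become negative. *)
Lemma intertwine S E S' E' k T i f : spectral S E -> spectral S' E' ->
  lincont T -> (forall h, h [::] = 0 -> T h [::] = 0) ->
  (forall j h, S' (T (E (j + k)%N h)) = lambda j *: T (E (j + k)%N h)) ->
  (forall j h, (j < k)%N -> h [::] = 0 -> E j h = 0) ->
  f [::] = 0 -> T (E (i + k)%N f) = E' i (T f).
Proof.
move=> H H' LT nT HT H0 f0.
apply: (lc_ext_suppX (T := fun f => T (E (i + k)%N f)) (U := fun f => E' i (T f))).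
- exact: (lc_comp LT (sp_lc H _)).
- exact: (lc_comp (sp_lc H' _) LT).
move=> w fw; have w0 : mono w [::] = 0.
  by apply: sg_id; apply: contraNneq fw => /esym/size0nil ->; rewrite f0.
have Ew : mono w = \sum_(j < (size w).+1) E j (mono w).
  apply/funext => u; rewrite funsum; case: (eqVneq (size u) (size w)) => [Eu|ne].
    by rewrite -Eu (sp_sum H).
  by rewrite sg_id // big1 // => j _; apply: (sp_sg H).
have T0 j : T (E j (mono w)) [::] = 0.
  by apply: nT; apply: (sp_nil _ H).
have EE j : E' i (T (E j (mono w))) = if i + k == j then T (E j (mono w)) else 0.
  case: (ltnP j k) => [lt|le]; first by rewrite H0 // (lc0 LT) (lc0 (sp_lc H' i)) if_same.
  rewrite -(subnK le) eqn_add2r; apply: (sp_fix _ H'); first exact: T0.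
  exact: HT.
rewrite [in RHS]Ew (lcS LT) (lcS (sp_lc H' i)).
under eq_bigr do rewrite EE.
case: (leqP (i + k) (size w)) => [le|lt].
  rewrite (bigD1 (Ordinal (n := (size w).+1) (m := i + k) le)) //= eqxx big1 ?addr0 // => j ne.
  by case: eqP => // Ej; case/eqP: ne; apply: val_inj.
rewrite big1 => [|j _]; last by rewrite gtn_eqF // (leq_trans (ltn_ord j)).
have -> : E (i + k)%N (mono w) = 0; last by rewrite (lc0 LT).
apply/funext => u; case: (eqVneq (size u) (size w)) => [Eu|ne]; last exact: (sp_sg H).
by rewrite (sp_big H) // Eu.
Qed.

Lemma cyc_sub_et i (f : X) : f [::] = 0 -> cyc_sub (et_op i f) = e_op i (cyc_sub f).
Proof.
move=> f0; rewrite -{1}[i]addn0; apply: (intertwine _ spectral_et spectral_e) => //.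
- exact: lc_cyc_subE.
- by move=> h; apply: sg_nil; [exact: lc_cyc_subE|exact: sg_cyc_sub].
- by move=> j h; rewrite addn0 s_cyc_sub (sp_eig spectral_et) (lcQ (@lc_cyc_subE _ _)).
Qed.

Lemma cyc_norm_e i (f : X) : f [::] = 0 -> cyc_norm (e_op i.+1 f) = et_op i (cyc_norm f).
Proof.
move=> f0; rewrite -addn1; apply: (intertwine _ spectral_e spectral_et) => //.
- exact: lc_cyc_normE.
- by move=> h; apply: sg_nil; [exact: lc_cyc_normE|exact: sg_cyc_norm].
- move=> j h; have := cyc_norm_s (e_op (j + 1) h); rewrite s_e (lcQ (@lc_cyc_normE _ _)).
  (* Halving N s = 2 (1 \otimes s) N turns the eigenvalue 2^(j+1) into 2^j. *)
  move/(congr1 (fun g : X => (2%:R^-1 : rat) *: g)).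
  have -> (g : X) : 2%:R *+: g = (2%:R : rat) *: g.
    by rewrite scal_rat -in_algE rmorph_nat.
  rewrite !scalerA mulVf // scale1r => <-; congr (_ *: _).
  by rewrite addn1 /lambda exprS mulrA mulVf ?mul1r.
- by case=> // h _; apply: e_zero.
Qed.

End SpectralFamilies.

(** * Commutation of the vector field with s *)

Section Derivation.
Variables (K : comAlgType rat) (V : free_graded_module).

Local Notation word := (word V).
Local Notation X := (word -> K).
Local Notation XX := (word * word -> K).
Local Notation mono := (mono K (V := V)).
Local Notation ksign := (ksign K).
Local Notation deg := (@word_deg V).
Local Notation ldeg := (@letter_deg V).

Lemma lie_series_eq (B : choiceType) (T U : X -> B -> K) f :
  lincont T -> lincont U -> (forall d x, lie_monomial d x -> T x = U x) ->
  lie_series f -> T f = U f.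
Proof.
move=> LT LU H [I [c [d [x [Hx Hf]]]]]; apply/eqP; rewrite -subr_eq0; apply/eqP.
apply: (lc_has_sum (lc_sub LT LU) Hf) => i.
by rewrite (lcZ LT) (lcZ LU) (H _ _ (Hx i)) subrr.
Qed.

Lemma coprod_lie_series (x f : X) : lie_series x ->
  coprod (mul x f) = prim_mul x (coprod f).
Proof.
apply: (lie_series_eq (T := fun x => coprod (mul x f)) (U := fun x => prim_mul x (coprod f))).
- by lc.
- exact: lc_prim_mul1.
- by move=> d y /coprod_lie ->.
Qed.

Lemma lie_series_nil (x : X) : lie_series x -> x [::] = 0.
Proof.
move=> H; suff : (fun _ : word => x [::]) = (fun=> 0) by move/(congr1 (fun g => g [::])).
apply: (lie_series_eq (T := fun x _ => x [::]) (U := fun _ => 0)) H => [||d y /lie_pdeg[_ y0]].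
- have := lc_eval (fun _ : word => 1) (fun _ : word => [::] : word) (K := K).
  by congr lincont; apply/funext => f; apply/funext => w; rewrite mul1r.
- exact: lc_zero.
- by apply/funext => w; rewrite y0.
Qed.

(** The vector field without homogeneity hypotheses: with the signs placed on words by [sgnop], the
    Leibniz rule holds for all series. *)
Record odd_lie_derivation (m : X -> X) : Prop := OddLieDerivation {
  old_lc : lincont m;
  old_mul : forall f g, m (mul f g) = mul (m f) g + mul (sgnop 1 f) (m g);
  old_odd : forall u, pdeg (deg u + 1) (m (mono u));
  old_lie : forall a, lie_series (m (mono [:: a]))
}.

Variables (m : X -> X) (Hm : odd_lie_derivation m).

Let Lm : lincont m := old_lc Hm.

Lemma old_one : m (mono [::]) = 0.
Proof.
have := old_mul Hm (mono [::]) (mono [::]); rewrite sgnop_mono !mulE.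
rewrite mul_series1l mul_series1r mul_series1l => E.
apply: (@addIr _ (m (mono [::]))); rewrite add0r [RHS]E.
by lin.
Qed.

Lemma old_cons a w : m (mono (a :: w)) =
  mul (m (mono [:: a])) (mono w) + ksign 1 (ldeg a) *+: mul (mono [:: a]) (m (mono w)).
Proof.
by rewrite -cat1s -mul_mono (old_mul Hm) sgnop_mono !mulE deg_cons deg_nil addr0.
Qed.

(* m \otimes 1 + 1 \otimes m *)
Definition der2 : XX -> XX :=
  fun F => act1 m F + act2 (fun u f => ksign 1 (deg u) *+: m f) F.

Let Lm2 u : lincont (fun f => ksign 1 (deg u) *+: m f).
Proof. by lc. Qed.

Lemma lc_der2E : lincont der2.
Proof. by apply: lc_add; [apply: lc_act1E|apply: lc_act2E]. Qed.

Lemma der2_tens u y : der2 (tens (mono u) y) =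
  tens (m (mono u)) y + ksign 1 (deg u) *+: tens (mono u) (m y).
Proof.
by rewrite /der2 (act1_tens _ _ Lm) (act2_tens _ _ Lm2) tensE.
Qed.

(** The graded commutator of m \otimes 1 + 1 \otimes m with a \otimes 1 + 1 \otimes a has the same
    shape, with a replaced by m(a); the mixed terms cancel. *)
Lemma der2_prim_mul a F : der2 (prim_mul (mono [:: a]) F) =
  prim_mul (m (mono [:: a])) F + ksign 1 (ldeg a) *+: prim_mul (mono [:: a]) (der2 F).
Proof.
have Ld := lc_der2E.
move: F; apply: lc_extXX => [||u v]; [by lc|by lc|].
have tw : twist u (m (mono [:: a])) = ksign (ldeg a + 1) (deg u) *+: m (mono [:: a]).
  apply/funext => w; rewrite /twist /scal.
  case: (eqVneq (m (mono [:: a]) w) 0) => [->|/(old_odd Hm) pw]; first by rewrite !mulr0.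
  congr (_ * _); apply: ksign_par => //.
  by rewrite pw deg_cons deg_nil addr0.
rewrite !prim_mul_tens der2_tens tw twist_mono (lcD (@lc_prim_mulE _ _ _)).
rewrite (lcZ (@lc_prim_mulE _ _ _)) (prim_mul_pdeg _ _ (@pdeg_mono _ _ [:: a])).
rewrite !prim_mul_tens twist_mono (sgnop_pdeg _ (old_odd Hm (u := u))) !mulE.
rewrite !mul_mono (lcD Ld) !tensE (lcZ Ld) !der2_tens /= (old_cons a u) (old_cons a v) !tensE.
lin.
Qed.

Lemma coprod_der f : coprod (m f) = der2 (coprod f).
Proof.
have Lc := @lc_coprodE K V; have Ld := lc_der2E.
move: f; apply: lc_extX => [||w]; [by lc|by lc|].
elim: w => [|a w IH].
  rewrite old_one (lc0 Lc) coprod_mono coprod_wordE /= der2_tens old_one !tensE; lin.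
rewrite old_cons (lcD Lc) (lcZ Lc) (coprod_lie_series _ (old_lie Hm a)).
rewrite (coprod_lie _ (lie_letter K a)) IH -der2_prim_mul -(coprod_lie _ (lie_letter K a)).
by rewrite mul_mono.
Qed.

Lemma mult_der2 F : mult (der2 F) = m (mult F).
Proof.
have Ld := lc_der2E; have Lu := @lc_multE K V.
move: F; apply: lc_extXX => [||u v]; [by lc|by lc|].
rewrite der2_tens (lcD Lu) (lcZ Lu) !mult_tens (old_mul Hm) sgnop_mono.
by rewrite !mulE.
Qed.

Lemma s_der f : s_op (m f) = m (s_op f).
Proof. by rewrite /s_op coprod_der mult_der2. Qed.

Lemma mul_low (x y : X) k l w : (forall u, (size u < k)%N -> x u = 0) ->
  (forall u, (size u < l)%N -> y u = 0) -> (size w < k + l)%N -> mul x y w = 0.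
Proof.
move=> Hx Hy lt; rewrite /mul big1 // => i _.
case: (ltnP (size (take i w)) k) => [/Hx ->|le]; first by rewrite mul0r.
rewrite Hy ?mulr0 // -(ltn_add2l (size (take i w))) -size_cat cat_take_drop.
by apply: leq_trans lt _; rewrite leq_add2r.
Qed.

(** A letter is replaced by a Lie series, which has no constant term, so words do not become
    shorter. *)
Lemma der_low_mono u w : (size w < size u)%N -> m (mono u) w = 0.
Proof.
elim: u w => [//|a u IH] w lt; rewrite old_cons funD funscal.
rewrite (@mul_low _ _ 1 (size u)) // => [|v|v ltv]; last first.
- by rewrite sg_id // neq_ltn ltv.
- by rewrite ltnS leqn0 => /nilP ->; apply: lie_series_nil; exact: old_lie.
rewrite (@mul_low _ _ 1 (size u)) ?mulr0 ?addr0 // => v.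
by rewrite ltnS leqn0 => /nilP ->; rewrite sg_id.
Qed.

Lemma der_low n f w : (forall u, (size u <= n)%N -> f u = 0) -> (size w <= n)%N -> m f w = 0.
Proof.
move=> Hf le; apply: (lc_supp Lm) => u fu; apply: der_low_mono.
by apply: leq_ltn_trans le _; rewrite ltnNge; apply: contraNN fu => /Hf ->.
Qed.

Lemma der_nil f : f [::] = 0 -> m f [::] = 0.
Proof. by move=> f0; apply: (@der_low 0) => // u; rewrite leqn0 => /nilP ->. Qed.

Lemma der_brk_letter a u : m (brk (mono [:: a]) (mono u)) =
  brk (m (mono [:: a])) (mono u) + ksign 1 (ldeg a) *+: brk (mono [:: a]) (m (mono u)).
Proof.
rewrite -(bracketE (old_odd Hm (u := [:: a])) (@pdeg_mono _ _ u)).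
rewrite -(bracketE (@pdeg_mono _ _ [:: a]) (old_odd Hm (u := u))).
rewrite brk_mono /bracket (lcB Lm) (lcZ Lm) -!mul_mono !(old_mul Hm) !sgnop_mono !mulE.
lin.
Qed.

(** The kernel of N consists of sums of commutators, and a derivation maps these to sums of
    commutators. Thus [m] descends to the coinvariants. *)
Lemma cyc_norm_der f : f [::] = 0 -> cyc_norm f = 0 -> cyc_norm (m f) = 0.
Proof.
move=> f0 Nf; rewrite (cyc_sub_prim f0 Nf); move: (cyc_prim f) => {Nf f0}f.
have Ln := @lc_cyc_normE K V; have Ls := @lc_cyc_subE K V.
move: f; apply: lc_extX => [||[|a u]]; [by lc|exact: lc_zero| |].
  by rewrite cyc_sub_nil (lc0 Lm) (lc0 Ln).
rewrite cyc_sub_mono der_brk_letter (lcD Ln) (lcZ Ln) !cyc_norm_brk.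
lin.
Qed.

Lemma e_der i f : f [::] = 0 -> m (e_op i f) = e_op i (m f).
Proof.
move=> f0; rewrite -{1}[i]addn0.
apply: (intertwine _ (spectral_e K V) (spectral_e K V)) => //; first exact: der_nil.
by move=> j h; rewrite addn0 s_der s_e (lcQ Lm).
Qed.

End Derivation.

(** * One-forms and an explicit inverse of Theta *)

Section Forms.
Variables (K : comAlgType rat) (V : free_graded_module).

Local Notation word := (word V).
Local Notation X := (word -> K).
Local Notation XX := (word * word -> K).
Local Notation mono := (mono K (V := V)).
Local Notation ksign := (ksign K).
Local Notation deg := (@word_deg V).

(** Imposes d1 = 0, so that formulas can be written on X \otimes X before passing to X \otimes
    X/K. *)
Definition reduce (F : XX) : XX := fun p => if p.2 == [::] then 0 else F p.

Lemma lc_reduceE : lincont reduce.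
Proof.
have := lc_eval (fun p : word * word => (p.2 != [::])%:R) id (K := K).
congr lincont; apply/funext => f; apply/funext => p; rewrite /reduce.
by case: eqP => _; rewrite ?mul1r ?mul0r.
Qed.

Lemma reduce_tens x v : reduce (tens x (mono v)) = if v == [::] then 0 else tens x (mono v).
Proof.
apply/funext => -[p q]; rewrite /reduce /tens /Defs.mono /=.
case: (q =P [::]) => [->|/eqP nq]; case: (v =P [::]) => [E|/eqP nv] //.
  by rewrite eq_sym (negPf nv) mulr0.
by rewrite E (negPf nq) mulr0.
Qed.

Lemma pairs_fin (w : word) :
  exists s : seq (word * word), forall p, perm_eq (p.1 ++ p.2) w -> p \in s.
Proof.
exists (flatten [seq [seq (take i t, drop i t) | i <- iota 0 (size w).+1] |
  t <- permutations w]) => -[u v] H; have {}H : perm_eq (u ++ v) w by [].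
apply/flatten_mapP; exists (u ++ v); first by rewrite mem_permutations.
have -> : (u, v) = (fun i => (take i (u ++ v), drop i (u ++ v))) (size u).
  by rewrite take_size_cat // drop_size_cat.
apply: (map_f (fun i => (take i (u ++ v), drop i (u ++ v)))); rewrite mem_iota add0n.
by rewrite ltnS -(perm_size H) size_cat leq_addr.
Qed.

Lemma cder_perm (v u w : word) : cder K v u w != 0 -> perm_eq (v ++ u) w.
Proof.
elim: v u => [|a v IH] u /=; first by rewrite eqxx.
rewrite funD funscal /Defs.mono; case: (w =P a :: v ++ u) => [-> _|_].
  exact: perm_refl.
rewrite add0r => H; have /IH H' : cder K v (rcons u a) w != 0.
  by apply: contraNneq H => ->; rewrite mulr0.
by apply: perm_trans H'; rewrite -rcons_cat perm_sym perm_rcons.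
Qed.

Lemma cder_nil (v u : word) : cder K v u [::] = 0.
Proof. by elim: v u => [//|a v IH] u /=; rewrite funD funscal IH mulr0 addr0. Qed.

(* The function taking v \otimes u to dv . u *)
Definition dmul : XX -> X := ext (fun p => cder K p.1 p.2).

Lemma colfin_cder : colfin (fun p => cder K p.1 p.2 : X).
Proof.
by move=> w; have [s Hs] := pairs_fin w; exists s => p /cder_perm; exact: Hs.
Qed.

Lemma lc_dmulE : lincont dmul. Proof. exact: (lc_extM colfin_cder). Qed.

Lemma dmul_mono v u : dmul (tens (mono v) (mono u)) = cder K v u.
Proof. by rewrite -delta_tens; exact: (ext_delta _ colfin_cder). Qed.

Lemma lc_dmul1 y : lincont (fun x => dmul (tens x y)).
Proof. exact: (lc_comp lc_dmulE (lc_tensr y)). Qed.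

Lemma lc_dmul2 x : lincont (fun y => dmul (tens x y)).
Proof. exact: (lc_comp lc_dmulE (lc_tensl x)). Qed.

Lemma dmul_letter a y : dmul (tens (mono [:: a]) y) = mul (mono [:: a]) y.
Proof.
move: y; apply: lc_extX => [||u]; [exact: lc_dmul2|by lc|].
by rewrite dmul_mono mul_mono /=; lin.
Qed.

(** In cyclic words d(xy) . z is dx . (yz) +- dy . (zx); the four terms coming from [x, y] regroup
    into commutators with z. *)
Lemma dmul_bracket d e (x y z : X) : pdeg d x -> pdeg e y ->
  dmul (tens (bracket d e x y) z) =
  dmul (tens x (brk y z)) - ksign d e *+: dmul (tens y (brk x z)).
Proof.
have Ld := lc_dmulE.
move=> px py; apply: (lc_ext_suppX (T := fun x => dmul (tens (bracket d e x y) z))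
  (U := fun x => dmul (tens x (brk y z)) - ksign d e *+: dmul (tens y (brk x z))))
  => [||u /px pu].
- exact: (lc_comp (lc_dmul1 z) (lc_bracket1 d e y)).
- by lc.
apply: (lc_ext_suppX (T := fun y => dmul (tens (bracket d e (mono u) y) z))
  (U := fun y => dmul (tens (mono u) (brk y z)) - ksign d e *+: dmul (tens y (brk (mono u) z))))
  => [||v /py pv].
- exact: (lc_comp (lc_dmul1 z) (lc_bracket2 d e _)).
- by lc.
rewrite bracket_mono // -(ksign_par K pu pv) brk_mono tensE (lcD Ld).
move: z; apply: lc_extX => [||w]; [by lc|by lc|].
rewrite !brk_mono !tensE !(lcD Ld) !(lcN Ld) !(lcZ Ld) !dmul_mono !cder_cat.
lin.
Qed.

Lemma dmul_s_lie d (x y : X) : lie_monomial d x ->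
  dmul (tens x (s_op y)) = s_tail (dmul (tens x y)).
Proof.
have Lt := @lc_s_tailE K V.
move=> H; elim: H y => {d x} [a|d e x z Hx IHx Hz IHz] y.
  by rewrite !dmul_letter s_tail_cons.
have [px _] := lie_pdeg Hx; have [pz _] := lie_pdeg Hz.
rewrite !dmul_bracket // (lcB Lt) (lcZ Lt) -(s_brk_lie _ Hz) -(s_brk_lie _ Hx).
by rewrite IHx IHz.
Qed.

Lemma dmul_s (x y : X) : lie_series x ->
  dmul (tens x (s_op y)) = s_tail (dmul (tens x y)).
Proof.
have Ld := lc_dmulE; have Lt := @lc_s_tailE K V.
apply: (lie_series_eq (T := fun x => dmul (tens x (s_op y)))
  (U := fun x => s_tail (dmul (tens x y)))) => [||d z /dmul_s_lie -> //]; lc.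
Qed.

(* The inverse of \Theta_Ass on the level of forms. *)
Definition kappa (F : XX) : X := dmul (swap F).

Lemma lc_kappaE : lincont kappa.
Proof. exact: (lc_comp lc_dmulE (lc_swap (lc_id _ _))). Qed.

Lemma kappa_mono u v :
  kappa (tens (mono u) (mono v)) = ksign (deg u) (deg v) *+: cder K v u.
Proof. by rewrite /kappa swap_mono (lcZ lc_dmulE) dmul_mono. Qed.

Lemma kappa_reduce F : kappa (reduce F) = kappa F.
Proof.
have Lk := lc_kappaE; have Lm := lc_reduceE.
move: F; apply: lc_extXX => [||u v]; [by lc|by lc|].
rewrite reduce_tens; case: eqP => [->|//].
by rewrite kappa_mono (lc0 Lk) /=; lin.
Qed.

Lemma kappa_tens_nil x : kappa (tens x (mono [::])) = 0.
Proof. by rewrite -kappa_reduce reduce_tens eqxx (lc0 lc_kappaE). Qed.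

(** The Leibniz rule d(xy) = dx . y + x dy, read in cyclic words. *)
Lemma kappa_dmul (x y : X) :
  kappa (tens (mono [::]) (mul x y)) - kappa (tens x y) = dmul (tens x y).
Proof.
have Lk := lc_kappaE; have Ld := lc_dmulE.
move: x; apply: lc_extX => [||u]; [by lc|by lc|].
move: y; apply: lc_extX => [||v]; [by lc|by lc|].
by rewrite mul_mono !kappa_mono dmul_mono cder_cat cats0 /=; lin.
Qed.

Lemma reduce_id (x y : X) : y [::] = 0 -> reduce (tens x y) = tens x y.
Proof.
move=> y0; apply/funext => -[p q]; rewrite /reduce /tens /=.
by case: eqP => [->|//]; rewrite y0 mulr0.
Qed.

Lemma dform_reduce (y : X) : dform y = reduce (tens (mono [::]) y).
Proof.
apply/funext => -[p q]; rewrite /dform /reduce /tens /Defs.mono /=.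
by case: (p == [::]); case: (q == [::]); rewrite /= ?mul0r ?mul1r.
Qed.

Lemma ractE F (x : X) :
  ract F x = reduce (act2 (fun _ y => mul y x) F - tens (mult F) x).
Proof.
apply/funext => -[p q]; rewrite /ract /reduce /=; case: eqP => // _.
rewrite funD funN /act2 /tens /mul /mult /=; congr (_ - _).
by rewrite mulr_suml; apply: eq_bigr.
Qed.

Lemma ract_tens (x y : X) v : ract (tens x y) (mono v) =
  reduce (tens x (mul y (mono v)) - tens (mul x y) (mono v)).
Proof.
rewrite ractE mult_tens; congr (reduce (_ - _)); apply/funext => -[p q].
by rewrite /act2 /= -[fun v => _]/(x p *+: y) mulE.
Qed.

Lemma theta_word_cons a (u : word) : theta_word K (a :: u) =
  reduce (tens (mono [::]) (mono (a :: u)) - tens (mono [:: a]) (mono u)).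
Proof. by rewrite /= dform_reduce reduce_id // ract_tens !mul_mono. Qed.

Lemma theta_word_cat (w : word) p : theta_word K w p != 0 -> w = p.1 ++ p.2.
Proof.
case: w => [|a u]; first by rewrite eqxx.
rewrite theta_word_cons /reduce; case: p => p q /=; case: (q =P [::]) => [_|_]; first by rewrite eqxx.
rewrite funD funN /tens /Defs.mono /=; case: (p =P [::]) => [->|_].
  case: (q =P a :: u) => [-> //|_]; rewrite mulr0 sub0r.
  by rewrite /= mul0r oppr0 eqxx.
rewrite mul0r sub0r; case: (p =P [:: a]) => [->|_]; last by rewrite mul0r oppr0 eqxx.
by case: (q =P u) => [->//|_]; rewrite mulr0 oppr0 eqxx.
Qed.

Lemma colfin_theta : colfin (@theta_word K V).
Proof. by move=> p; exists [:: p.1 ++ p.2] => w /theta_word_cat ->; rewrite inE. Qed.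

Lemma lc_thetaE : lincont (@theta K V). Proof. exact: (lc_extM colfin_theta). Qed.

Lemma theta_mono w : theta (mono w) = theta_word K w.
Proof. exact: (ext_delta w colfin_theta). Qed.

Lemma kappa_theta f : f [::] = 0 -> kappa (theta f) = f.
Proof.
have Lk := lc_kappaE; have Lt := lc_thetaE.
move=> f0; apply: (lc_ext_suppX (T := fun f => kappa (theta f)) (U := id)) => [||[|a u]].
- by lc.
- exact: lc_id.
- by rewrite f0 eqxx.
move=> _; rewrite theta_mono theta_word_cons kappa_reduce (lcB Lk) !kappa_mono /=.
by rewrite cats0; lin.
Qed.

Lemma lact_tens (x u v : X) : lact x (tens u v) = tens (mul x u) v.
Proof. exact: (act1_tens u v (lc_mull x)). Qed.

Lemma lc_lact2 x : lincont (lact x : XX -> XX).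
Proof. exact: (lc_act1E (lc_mull x)). Qed.

Lemma lc_lact1 F : lincont (fun x : X => lact x F).
Proof.
exact: (lc_pt2 (U := fun p x => mul x (fun u => F (u, p.2))) (fun p => p.1)
  (fun p => lc_mulr _)).
Qed.

Lemma lc_ract1 x : lincont (fun F : XX => ract F x).
Proof.
have := lc_comp lc_reduceE (lc_sub (lc_act2E (fun _ => lc_mulr x))
  (lc_tens1 x (lc_mult (lc_id _ _)))).
by congr lincont; apply/funext => F; rewrite ractE.
Qed.

Lemma lc_ract2 F : lincont (fun x : X => ract F x).
Proof.
have L : lincont (fun x : X => act2 (fun _ y => mul y x) F).
  exact: (lc_pt2 (U := fun p x => mul (fun u => F (p.1, u)) x) (fun p => p.2)
    (fun p => lc_mull _)).
have := lc_comp lc_reduceE (lc_sub L (lc_tensl (mult F))).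
by congr lincont; apply/funext => x; rewrite ractE.
Qed.

Lemma ract_theta_word a (v u : word) :
  ract (theta_word K (a :: v)) (mono u) = theta_word K (a :: v ++ u).
Proof.
rewrite !theta_word_cons (lcB lc_reduceE) !reduce_tens /=; case: eqP => [->|_].
  by rewrite subr0 ract_tens !mul_mono.
rewrite (lcB (lc_ract1 _)) !ract_tens !mul_mono -(lcB lc_reduceE); congr reduce.
by rewrite /=; lin.
Qed.

(** In (u dv) . x = u d(vx) - uv dx the last term cancels the share of dx in u d(vx). What is left
    is dv . (xu), which is also the value on xu dv. *)
Lemma kappa_comm d e (x : X) (F : XX) : pdeg d x ->
  (forall p, F p != 0 -> par (deg p.1 + deg p.2) = par e) ->
  kappa (lact x F - ksign d e *+: ract F x) = 0.
Proof.
have Lk := lc_kappaE; have L1 := lc_lact1; have L2 := lc_lact2.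
have R1 := lc_ract1; have R2 := lc_ract2.
move=> px pF; apply: (lc_ext_suppX (T := fun x => kappa (lact x F - ksign d e *+: ract F x))
  (U := fun=> 0)) => [||u /px pu].
- apply: (lc_comp Lk); apply: lc_sub; first exact: L1.
  by apply: lc_scal; exact: R2.
- exact: lc_zero.
apply: (lc_ext_supp (T := fun F => kappa (lact (mono u) F - ksign d e *+: ract F (mono u)))
  (U := fun=> 0)) => [||[p q] /pF pq].
- apply: (lc_comp Lk); apply: lc_sub; first exact: L2.
  by apply: lc_scal; exact: R1.
- exact: lc_zero.
rewrite delta_tens lact_tens ract_tens !mul_mono (lcB Lk) (lcZ Lk) kappa_reduce (lcB Lk).
rewrite !kappa_mono cder_cat -(ksign_par K pu pq) /=.
lin.
Qed.

(** By the Leibniz rule u dv is the sum of the uv' dt_a . v'' over the decompositions v = v' t_a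
    v''; the pairs (uv', t_a v'') are listed here. *)
Fixpoint shift_word (u v : word) : XX :=
  if v is a :: v' then tens (mono u) (mono v) + shift_word (rcons u a) v' else 0.

Lemma shift_word_cat u v p : shift_word u v p != 0 -> u ++ v = p.1 ++ p.2.
Proof.
elim: v u => [|a v IH] u /=; first by rewrite eqxx.
case: p => p q in IH *; rewrite funD /tens /Defs.mono /=.
case: (p =P u) => [Ep|_]; last by rewrite mul0r add0r => /IH; rewrite cat_rcons.
case: (q =P a :: v) => [-> _|_]; first by rewrite Ep.
by rewrite mulr0 add0r => /IH; rewrite cat_rcons.
Qed.

Lemma shift_word_nil u v p : shift_word u v (p, [::]) = 0.
Proof. by elim: v u => [//|a v IH] u /=; rewrite funD IH /tens /= mulr0 addr0. Qed.

Lemma colfin_shift : colfin (fun p => shift_word p.1 p.2).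
Proof.
move=> p; have [s Hs] := pairs_fin (p.1 ++ p.2); exists s => q /shift_word_cat E.
by apply: Hs; rewrite E.
Qed.

(* The coefficient of (u, v), v <> [::], in [shift F] is the sum of the
   coefficients F (u1, u2 v) over the decompositions u = u1 u2. *)
Definition shift : XX -> XX := ext (fun p => shift_word p.1 p.2).

Lemma lc_shiftE : lincont shift. Proof. exact: (lc_extM colfin_shift). Qed.

Lemma shift_mono u v : shift (tens (mono u) (mono v)) = shift_word u v.
Proof. by rewrite -delta_tens; exact: (ext_delta _ colfin_shift). Qed.

Lemma shift_nil F p : shift F (p, [::]) = 0.
Proof.
by apply: (lc_supp lc_shiftE) => -[u v] _; rewrite delta_tens shift_mono shift_word_nil.
Qed.

(** The commutator of the word [p.1] with the form of [p.2], the right action being already carried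
    out. It is a commutator only when [p.2] is nonempty, and [shift] has no other coefficients, by
    [shift_nil]. *)
Definition comm_theta (p : word * word) : XX :=
  lact (mono p.1) (theta_word K p.2) - ksign (deg p.1) (deg p.2) *+: theta_word K (p.2 ++ p.1).

Lemma lact_reduce x F : lact x (reduce F) = reduce (lact x F).
Proof.
apply/funext => -[p q]; rewrite /lact /reduce /=; case: eqP => // _.
by rewrite big1 // => i _; rewrite mulr0.
Qed.

Lemma lact_theta_word (x : word) a u : lact (mono x) (theta_word K (a :: u)) =
  reduce (tens (mono x) (mono (a :: u)) - tens (mono (rcons x a)) (mono u)).
Proof.
rewrite theta_word_cons lact_reduce (lcB (lc_lact2 _)) !lact_tens !mul_mono.
by rewrite cats0 cats1.
Qed.

Lemma comm_theta_perm p q : comm_theta p q != 0 -> perm_eq (p.1 ++ p.2) (q.1 ++ q.2).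
Proof.
case: p => x y; rewrite /comm_theta funD funN funscal /=.
case: (eqVneq (theta_word K (y ++ x) q) 0) => [->|/theta_word_cat <- _]; last first.
  by rewrite perm_catC.
rewrite mulr0 subr0; case: y => [|a u].
  by rewrite /= (lc0 (lc_lact2 _)) eqxx.
rewrite lact_theta_word /reduce; case: q => p q /=; case: (q =P [::]) => [_|_]; first by rewrite eqxx.
rewrite funD funN /tens /Defs.mono /=; case: (p =P x) => [->|_].
  case: (q =P a :: u) => [-> //|_]; rewrite mulr0 sub0r; case: (x =P rcons x a) => [E|_].
    by have := congr1 size E; rewrite size_rcons => /eqP; rewrite eqn_leq ltnn andbF.
  by rewrite mul0r oppr0 eqxx.
rewrite mul0r sub0r; case: (p =P rcons x a) => [->|_]; last by rewrite mul0r oppr0 eqxx.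
case: (q =P u) => [-> _|_]; last by rewrite mulr0 oppr0 eqxx.
by rewrite cat_rcons.
Qed.

Lemma colfin_comm_theta : colfin comm_theta.
Proof.
by move=> p; have [s Hs] := pairs_fin (p.1 ++ p.2); exists s => q /comm_theta_perm /Hs.
Qed.

(** In the expansion of u dv, rotating uv' dt_a . v'' into dt_a . (v''uv') costs one commutator, and
    the rotated terms add up to Theta of the value of [kappa]. *)
Lemma theta_kappa F :
  reduce F - theta (kappa F) = ext comm_theta (shift F).
Proof.
have Lk := lc_kappaE; have Lt := lc_thetaE; have Ls := lc_shiftE; have Lm := lc_reduceE.
have Lc := lc_extM colfin_comm_theta.
move: F; apply: lc_extXX => [||u v]; [by lc|by lc|].
rewrite shift_mono; elim: v u => [|a v IH] u /=.
  rewrite reduce_tens eqxx kappa_mono /= (lc0 Lc) (_ : _ *+: 0 = 0); last by lin.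
  by rewrite (lc0 Lt) subrr.
rewrite (lcD Lc) -IH -delta_tens (ext_delta _ colfin_comm_theta) delta_tens.
rewrite /comm_theta [(_, _).1]/= [(_, _).2]/= lact_theta_word (lcB Lm) !kappa_mono.
rewrite [cder K (a :: v) u]/= !(lcZ Lt) (lcD Lt) (lcZ Lt) theta_mono cat_cons -cat_cons.
lin.
Qed.

End Forms.

(** * The Hochschild differential b *)

Section HochschildDifferential.
Variables (K : comAlgType rat) (V : free_graded_module).

Local Notation word := (word V).
Local Notation X := (word -> K).
Local Notation mono := (mono K (V := V)).
Local Notation ksign := (ksign K).
Local Notation ldeg := (@letter_deg V).

Variables (m : X -> X) (Hm : odd_lie_derivation m).

Let Lm : lincont m := old_lc Hm.
Let Ld : lincont (der2 m) := lc_der2E Hm.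
Let Lk := @lc_kappaE K V.

(** [hoch_b] with [kappa] in place of the choice made by [theta_inv], hence linear and continuous on
    all series. The two are identified on homogeneous series by [hoch_bE]. *)
Definition hoch_lin (f : X) : X := kappa (lie_deriv 1 m (theta f)).

Lemma lie_derivE F : lie_deriv 1 m F = - reduce (der2 m F).
Proof.
apply/funext => -[p q]; rewrite /lie_deriv /reduce funN /=; case: eqP => _; rewrite ?oppr0 //.
by rewrite /der2 funD /act1 /act2 funscal /=; sgn.
Qed.

Lemma hoch_linE f : hoch_lin f = - kappa (der2 m (theta f)).
Proof. by rewrite /hoch_lin lie_derivE (lcN Lk) kappa_reduce. Qed.

Lemma lc_hoch_linE : lincont hoch_lin.
Proof.
have Lt := @lc_thetaE K V; have : lincont (fun f : X => - kappa (der2 m (theta f))) by lc.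
by congr lincont; apply/funext => f; rewrite hoch_linE.
Qed.

Lemma hoch_lin_nil : hoch_lin (mono [::]) = 0.
Proof. by rewrite hoch_linE theta_mono (lc0 Ld) (lc0 Lk) oppr0. Qed.

(** L_m is applied to dt_a . u = d(t_a u) - t_a du, and two Leibniz rules recombine the result into
    dm(t_a) . u and dt_a . m(u). The global sign is that of L_m on exact forms. *)
Lemma hoch_lin_mono a u : hoch_lin (mono (a :: u)) =
  - (dmul (tens (m (mono [:: a])) (mono u)) + ksign 1 (ldeg a) *+: mul (mono [:: a]) (m (mono u))).
Proof.
rewrite hoch_linE theta_mono theta_word_cons (lcB (lc_reduceE _ _)) !reduce_tens /=.
(* For empty [u] the form t_a du is zero, but it can be kept, since [kappa] kills every x d1. *)
have -> : kappa (der2 m (tens (mono [::]) (mono (a :: u)) -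
    (if u == [::] then 0 else tens (mono [:: a]) (mono u)))) =
    kappa (der2 m (tens (mono [::]) (mono (a :: u)) - tens (mono [:: a]) (mono u))).
  case: eqP => [->|//]; rewrite !(lcB Ld) !(lcB Lk) (lc0 Ld) (lc0 Lk); congr (_ - _).
  rewrite (der2_tens Hm) (old_one Hm) tensE (lcD Lk) (lcZ Lk) (lc0 Lk) kappa_tens_nil; lin.
rewrite (lcB Ld) !(der2_tens Hm) (old_one Hm) tensE add0r (lcB Lk) !(lcD Lk) !(lcZ Lk).
rewrite (old_cons Hm) !tensE (lcD Lk) (lcZ Lk).
have E1 := kappa_dmul (m (mono [:: a])) (mono u).
have E2 := kappa_dmul (mono [:: a]) (m (mono u)); rewrite dmul_letter in E2.
by rewrite -E1 -[in RHS]E2; lin.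
Qed.

Lemma hoch_lin_cons a y : hoch_lin (mul (mono [:: a]) y) =
  - (dmul (tens (m (mono [:: a])) y) + ksign 1 (ldeg a) *+: mul (mono [:: a]) (m y)).
Proof.
have Lh := lc_hoch_linE; have Lu := @lc_dmulE K V.
move: y; apply: lc_extX => [||u]; [by lc|by lc|].
by rewrite mul_mono hoch_lin_mono.
Qed.

Lemma s_tail_hoch f : s_tail (hoch_lin f) = hoch_lin (s_tail f).
Proof.
have Lh := lc_hoch_linE; have Lt := @lc_s_tailE K V.
move: f; apply: lc_extX => [||[|a u]]; [by lc|by lc| |].
  by rewrite s_tail_nil hoch_lin_nil (lc0 Lh) (lc0 Lt).
rewrite s_tail_mono hoch_lin_cons hoch_lin_mono (lcN Lt) (lcD Lt) (lcZ Lt).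
by rewrite s_tail_cons (dmul_s _ (old_lie Hm a)) (s_der Hm).
Qed.

Lemma hoch_lin_nil0 f : hoch_lin f [::] = 0.
Proof.
rewrite hoch_linE funN /kappa; apply/eqP; rewrite oppr_eq0; apply/eqP.
by apply: (lc_supp (@lc_dmulE K V)) => -[u v] _; rewrite delta_tens dmul_mono cder_nil.
Qed.

Lemma hoch_lin_low n f w :
  (forall u, (size u <= n)%N -> f u = 0) -> (size w <= n)%N -> hoch_lin f w = 0.
Proof.
move=> Hf le; apply: (lc_supp lc_hoch_linE) => u fu.
have lt : (size w < size u)%N.
  by apply: leq_ltn_trans le _; rewrite ltnNge; apply: contraNN fu => /Hf ->.
case: u lt {fu} => [//|a u] lt; rewrite [hoch_lin _]hoch_lin_mono funN funD funscal.
rewrite (@mul_low _ _ _ _ 1 (size u)) // => [|v|v]; last first.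
- exact: (der_low_mono Hm).
- by rewrite ltnS leqn0 => /nilP ->; rewrite sg_id.
rewrite (lc_supp (lc_dmul1 (mono u))) ?mulr0 ?addr0 ?oppr0 // => v mv.
rewrite [dmul _]dmul_mono; apply/eqP; apply: contraNT mv => /cder_perm/perm_size.
rewrite size_cat => E; case: v E => [|b v] E; first by rewrite (lie_series_nil (old_lie Hm a)).
by move: lt; rewrite -E /= ltnS addSn ltnNge => /negP[]; apply: leq_addl.
Qed.

Lemma et_hoch i f : f [::] = 0 -> hoch_lin (et_op i f) = et_op i (hoch_lin f).
Proof.
move=> f0; rewrite -{1}[i]addn0.
apply: (intertwine _ (spectral_et K V) (spectral_et K V)) => //.
- exact: lc_hoch_linE.
- by move=> h _; exact: hoch_lin_nil0.
by move=> j h; rewrite addn0 s_tail_hoch (sp_eig (spectral_et K V)) (lcQ lc_hoch_linE).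
Qed.

End HochschildDifferential.

(** * Homogeneity over the graded ring K *)

Section Grading.
Variables (K : comAlgType rat) (V : free_graded_module).

Local Notation word := (word V).
Local Notation X := (word -> K).
Local Notation XX := (word * word -> K).
Local Notation mono := (mono K (V := V)).
Local Notation ksign := (ksign K).
Local Notation deg := (@word_deg V).
Local Notation ldeg := (@letter_deg V).

Variable G : even_grading K.

Lemma gr_opp i x : G i x -> G i (- x).
Proof. by move=> H; rewrite -sub0r; apply: grB => //; apply: gr0. Qed.

Lemma gr_add i x y : G i x -> G i y -> G i (x + y).
Proof. by move=> Hx Hy; rewrite -[y]opprK; apply: grB => //; apply: gr_opp. Qed.

Lemma gr_sum i I (r : seq I) (P : pred I) (F : I -> K) :
  (forall j, P j -> G i (F j)) -> G i (\sum_(j <- r | P j) F j).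
Proof.
by move=> H; apply: (big_ind (fun x => G i x)) => //; [exact: gr0|exact: gr_add].
Qed.

Lemma gr_mul0 i c x : G 0 c -> G i x -> G i (c * x).
Proof. by move=> Hc Hx; rewrite -[i]add0r; apply: grM. Qed.

Lemma gr_nat n : G 0 n%:R.
Proof.
elim: n => [|n IH]; first exact: gr0.
by rewrite -addn1 natrD; apply: gr_add => //; apply: gr1.
Qed.

Lemma gr_sign n : G 0 ((-1) ^+ n).
Proof. by rewrite -signr_odd; case: odd; rewrite ?expr0 ?expr1; [apply: gr_opp|]; apply: gr1. Qed.

Lemma gr_ksign i j : G 0 (ksign i j). Proof. exact: gr_sign. Qed.

Lemma gr_span_uniq x : exists (s : seq int) (c : int -> K),
  [/\ uniq s, forall i, G i (c i) & x = \sum_(i <- s) c i].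
Proof.
have [s [c [Hc ->]]] := gr_span G x.
exists (undup s), (fun i => c i *+ count_mem i s); split; first exact: undup_uniq.
  by move=> i; rewrite -mulr_natl; apply: gr_mul0 (Hc i); apply: gr_nat.
rewrite -[LHS](big_undup_iterop_count _ s xpredT c); apply: eq_bigr => i _.
by [].
Qed.

(** Degree 0 is forced into the index set so that this component can be compared with 1. *)
Lemma gr_span_zero x : exists (s : seq int) (c : int -> K),
  [/\ uniq s, 0 \in s, forall i, G i (c i) & x = \sum_(i <- s) c i].
Proof.
have [s [c [us Hc Ex]]] := gr_span_uniq x.
case: (boolP (0 \in s)) => s0; first by exists s, c.
exists (0 :: s), (fun i => if i == 0 then 0 else c i); split=> [||i|].
- by rewrite /= s0.
- by rewrite inE eqxx.
- by case: eqP => [->|_]; [apply: gr0|apply: Hc].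
rewrite big_cons eqxx add0r Ex big_seq [RHS]big_seq; apply: eq_bigr => i si.
by case: eqP => // E; rewrite -E si in s0.
Qed.

(* n (1/n) = 1 forces the components of 1/n outside degree 0 to vanish, as K
   is torsion-free. *)
Lemma gr_natV n : (0 < n)%N -> G 0 ((n%:R^-1 : rat) *: (1 : K)).
Proof.
move=> n0; have nV : (n%:R : rat) != 0 by rewrite Num.Theory.pnatr_eq0 -lt0n.
set x : K := _ *: _; have [s [c [us s0 Hc Ex]]] := gr_span_zero x.
have nx : n%:R * x = 1 by rewrite mulr_natl -scaler_nat scalerA mulfV ?scale1r.
have sum0 : \sum_(i <- s) (n%:R * c i - (i == 0)%:R) = 0.
  rewrite sumrB -mulr_sumr -Ex nx (bigD1_seq 0) //= big1 ?addr0 ?subrr // => i ne.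
  by rewrite (negPf ne).
have Hn i : G i (n%:R * c i - (i == 0)%:R).
  apply: grB; first by apply: gr_mul0 (Hc i); apply: gr_nat.
  by case: eqP => [->|_]; [apply: gr1|apply: gr0].
have H := gr_direct us Hn sum0; rewrite Ex (bigD1_seq 0) //= big_seq_cond big1 ?addr0 //.
move=> i /andP[si ne]; have /eqP := H _ si; rewrite (negPf ne) subr0 => /eqP ci.
by rewrite -[c i]scale1r -(mulVf nV) -scalerA scaler_nat -[c i *+ n]mulr_natl ci scaler0.
Qed.

(** The idempotents and the averages over rotations have rational coefficients; they preserve
    degrees because rational scalars have degree 0. *)
Lemma gr_rat (q : rat) i x : G i x -> G i (q *: x).
Proof.
move=> Hx; rewrite -[q]divq_num_den -mulr_algl.
have -> : (((numq q)%:~R / (denq q)%:~R : rat)%:A : K) =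
    (numq q)%:~R * ((denq q)%:~R^-1 *: 1).
  by rewrite -scalerA scaler_int -mulrzl.
have -> : ((denq q)%:~R : rat) = `|denq q|%N%:R by rewrite -[in LHS]absz_denq.
apply: gr_mul0 => //; apply: gr_mul0.
  case: (numq q) => n; first exact: gr_nat.
  by rewrite NegzE mulrNz; apply: gr_opp; apply: gr_nat.
by apply: gr_natV; rewrite absz_gt0 denq_eq0.
Qed.

Definition homogeneous (A : choiceType) (dA : A -> int) (d : int) (f : A -> K) :=
  forall a, G (d - dA a) (f a).

Lemma hom_lc (A B : choiceType) (dA : A -> int) (dB : B -> int) k
    (T : (A -> K) -> B -> K) d f :
  lincont T -> (forall a, homogeneous dB (dA a + k) (T (delta K a))) ->
  homogeneous dA d f -> homogeneous dB (d + k) (T f).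
Proof.
move=> L HT Hf b; have [s [_ ->]] := lcE L b; apply: gr_sum => a _.
have -> : d + k - dB b = (d - dA a) + (dA a + k - dB b) by ring.
by apply: grM; [exact: Hf|exact: HT].
Qed.

Lemma hom_delta (A : choiceType) (dA : A -> int) a : homogeneous dA (dA a) (delta K a).
Proof.
move=> b; rewrite /delta; case: eqP => [->|_]; last exact: gr0.
by rewrite subrr; apply: gr1.
Qed.

Lemma homD (A : choiceType) (dA : A -> int) d f g :
  homogeneous dA d f -> homogeneous dA d g -> homogeneous dA d (f + g).
Proof. by move=> Hf Hg a; apply: gr_add. Qed.

Lemma homN (A : choiceType) (dA : A -> int) d f : homogeneous dA d f -> homogeneous dA d (- f).
Proof. by move=> Hf a; apply: gr_opp. Qed.

Lemma homB (A : choiceType) (dA : A -> int) d f g :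
  homogeneous dA d f -> homogeneous dA d g -> homogeneous dA d (f - g).
Proof. by move=> Hf Hg a; apply: grB. Qed.

Lemma hom0 (A : choiceType) (dA : A -> int) d : homogeneous dA d 0.
Proof. by move=> a; apply: gr0. Qed.

Lemma homZ (A : choiceType) (dA : A -> int) d i c f :
  G i c -> homogeneous dA d f -> homogeneous dA (i + d) (c *+: f).
Proof. by move=> Hc Hf a; rewrite -addrA; apply: grM. Qed.

Lemma homZ0 (A : choiceType) (dA : A -> int) d c f :
  G 0 c -> homogeneous dA d f -> homogeneous dA d (c *+: f).
Proof. by move=> Hc Hf; rewrite -[d]add0r; apply: homZ. Qed.

Lemma homQ (A : choiceType) (dA : A -> int) d (q : rat) (f : A -> K) :
  homogeneous dA d f -> homogeneous dA d (q *: f).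
Proof. by move=> Hf a; apply: gr_rat. Qed.

(** A coefficient at a word of the wrong parity would have odd degree in [K]. *)
Lemma hom_pdeg (f : X) d : homogeneous deg d f -> pdeg d f.
Proof.
move=> Hf w; apply: contraNeq => ne; apply/eqP.
apply: (gr_odd _ (Hf w)); rewrite -/(par _) parD parN.
by move: ne; case: (par d); case: (par _).
Qed.

Definition deg2 (p : word * word) : int := deg p.1 + deg p.2.

Lemma hom_form_pdeg (F : XX) e p : homogeneous deg2 e F -> F p != 0 ->
  par (deg p.1 + deg p.2) = par e.
Proof.
move=> HF; apply: contraNeq => ne; apply/eqP.
apply: (gr_odd _ (HF p)); rewrite -/(par _) parD parN.
by move: ne; rewrite /deg2; case: (par e); case: (par _).
Qed.

Lemma homog_mono w : homog G (deg w) (mono w).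
Proof. exact: (hom_delta deg w). Qed.

Lemma hom_tens u v : homogeneous deg2 (deg u + deg v) (tens (mono u) (mono v)).
Proof. by rewrite -delta_tens; apply: (hom_delta deg2 (u, v)). Qed.

Lemma hom_dsum (A : choiceType) (dA : A -> int) w phi d :
  (forall x y, deg w = deg x + deg y -> homogeneous dA d (phi x y)) ->
  homogeneous dA d (dsum (B := A) w phi).
Proof.
elim: w phi => [|a w IH] phi H /=; first by apply: H; rewrite deg_nil.
apply: IH => x y E; apply: homD; first by apply: H; rewrite !deg_cons E addrA.
apply: homZ0; first exact: gr_ksign.
by apply: H; rewrite !deg_cons E; ring.
Qed.

Lemma hom_op0 (T : X -> X) d f : lincont T ->
  (forall w, homogeneous deg (deg w) (T (mono w))) -> homog G d f -> homog G d (T f).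
Proof.
move=> L H Hf; rewrite -[d]addr0; apply: (hom_lc L _ Hf) => w; rewrite addr0.
exact: H.
Qed.

Lemma homog_s d (f : X) : homog G d f -> homog G d (s_op f).
Proof.
apply: hom_op0 => [|w]; first exact: lc_sE.
rewrite s_mono; apply: hom_dsum => x y ->; rewrite -deg_cat; exact: homog_mono.
Qed.

Lemma homog_cyc d (f : X) : homog G d f -> homog G d (cyc f).
Proof.
apply: hom_op0 => [|[|a u]]; first exact: lc_cycE.
  by rewrite cyc_nil; exact: homog_mono.
rewrite cyc_mono; apply: homZ0; first exact: gr_ksign.
by rewrite deg_cons addrC -deg_rcons; exact: homog_mono.
Qed.

Lemma homog_cyc_sub d (f : X) : homog G d f -> homog G d (cyc_sub f).
Proof. by move=> Hf; apply: homB => //; apply: homog_cyc. Qed.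

Lemma homog_iter_cyc k d (f : X) : homog G d f -> homog G d (iter k (@cyc K V) f).
Proof. by move=> Hf; elim: k => [//|k IH]; rewrite iterS; apply: homog_cyc. Qed.

Lemma homog_cyc_norm d (f : X) : homog G d f -> homog G d (cyc_norm f).
Proof. by move=> Hf w; apply: gr_sum => k _; apply: homog_iter_cyc. Qed.

Lemma homog_cyc_prim d (f : X) : homog G d f -> homog G d (cyc_prim f).
Proof.
move=> Hf w; apply: gr_rat; apply: gr_sum => k _; apply: gr_sum => j _.
exact: homog_iter_cyc.
Qed.

Lemma homog_tensor_part n d (f : X) : homog G d f -> homog G d (tensor_part n f).
Proof. by move=> Hf w; rewrite /tensor_part; case: eqP => _; [exact: Hf|exact: gr0]. Qed.

Lemma homog_e i d (f : X) : homog G d f -> homog G d (e_op i f).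
Proof.
move=> Hf w; suff H n (g : X) : homog G d g -> homog G d (e_comp n i g).
  exact: (H _ _ (homog_tensor_part (size w) Hf) w).
move: g; rewrite /e_comp; case: leqP => _ g Hg; last exact: hom0.
apply: homQ.
apply: (big_ind (fun T : X -> X => forall f, homog G d f -> homog G d (T f))) Hg => //.
  by move=> T U HT HU h Hh; apply: HT; apply: HU.
by move=> r _ h Hh; apply: homB; [exact: homog_s|exact: homQ].
Qed.

Lemma homog_et i d (f : X) : homog G d f -> homog G d (et_op i f).
Proof.
move=> Hf [|a u]; first exact: gr0.
rewrite -[et_op i f (a :: u)]/(e_op i (fun v => f (a :: v)) u) deg_cons opprD addrA.
apply: (@homog_e i (d - ldeg a) (fun v => f (a :: v))) => v.
by have := Hf (a :: v); rewrite deg_cons opprD addrA.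
Qed.

Lemma hom_cder v u : homogeneous deg (deg v + deg u) (cder K v u).
Proof.
elim: v u => [|a v IH] u; first exact: hom0.
apply: homD; first by rewrite -deg_cat; exact: homog_mono.
apply: homZ0; first exact: gr_ksign.
by have := IH (rcons u a); rewrite deg_rcons deg_cons; congr homogeneous; ring.
Qed.

Lemma hom_kappa e F : homogeneous deg2 e F -> homog G e (kappa F).
Proof.
move=> HF; rewrite -[e]addr0; apply: (hom_lc (@lc_kappaE K V) _ HF) => -[u v].
rewrite delta_tens kappa_mono addr0 /deg2 addrC; apply: homZ0; first exact: gr_ksign.
exact: hom_cder.
Qed.

Lemma hom_theta_word w : homogeneous deg2 (deg w) (theta_word K w).
Proof.
move=> p; case: (eqVneq (theta_word K w p) 0) => [->|ne]; first exact: gr0.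
have -> : deg w - deg2 p = 0 by rewrite (theta_word_cat ne) deg_cat subrr.
case: w ne => [|a u]; first by rewrite eqxx.
rewrite theta_word_cons /reduce; case: ifP => _; first by rewrite eqxx.
by move=> _; rewrite funD funN; apply: grB; rewrite /tens /Defs.mono -natrM; apply: gr_nat.
Qed.

Lemma hom_theta d (f : X) : homog G d f -> homogeneous deg2 d (theta f).
Proof.
move=> Hf; rewrite -[d]addr0; apply: (hom_lc (@lc_thetaE K V) _ Hf) => w.
by rewrite theta_mono addr0; exact: hom_theta_word.
Qed.

Lemma hom_shift e F : homogeneous deg2 e F -> homogeneous deg2 e (shift F).
Proof.
move=> HF; rewrite -[e]addr0; apply: (hom_lc (@lc_shiftE K V) _ HF) => -[u v].
rewrite delta_tens shift_mono addr0 /deg2 /=; elim: v u => [|a v IH] u; first exact: hom0.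
apply: homD; first exact: hom_tens.
by have := IH (rcons u a); rewrite deg_rcons deg_cons; congr homogeneous; ring.
Qed.

Lemma hom_lie_deriv m e F : (forall d (f : X), homog G d f -> homog G (d + 1) (m f)) ->
  homogeneous deg2 e F -> homogeneous deg2 (e + 1) (lie_deriv 1 m F).
Proof.
move=> Hm HF [p q]; rewrite /lie_deriv /=; case: ifP => _; first exact: gr0.
apply: gr_mul0; first exact: gr_ksign.
apply: gr_add.
  have := Hm (e - deg q) (fun u => F (u, q)) _ p; rewrite /deg2 /=.
  rewrite (_ : e - deg q + 1 - deg p = e + 1 - (deg p + deg q)); last by ring.
  by apply=> u; have := HF (u, q); rewrite /deg2 /= (_ : e - deg q - deg u = e - (deg u + deg q)) //; ring.
apply: gr_mul0; first exact: gr_ksign.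
have := Hm (e - deg p) (fun v => F (p, v)) _ q; rewrite /deg2 /=.
rewrite (_ : e - deg p + 1 - deg q = e + 1 - (deg p + deg q)); last by ring.
by apply=> u; have := HF (p, u); rewrite /deg2 /= (_ : e - deg p - deg u = e - (deg p + deg u)) //; ring.
Qed.

Lemma homog_formP d F :
  homog_form G d F <-> (forall u, F (u, [::]) = 0) /\ homogeneous deg2 d F.
Proof.
split=> -[H0 H]; split=> //.
  by case=> u v; have := H u v; rewrite /deg2 /= (_ : d - deg u - deg v = d - (deg u + deg v)) //; ring.
by move=> u v; have := H (u, v); rewrite /deg2 /= (_ : d - deg u - deg v = d - (deg u + deg v)) //; ring.
Qed.

End Grading.

(** * Direct products from orthogonal idempotents *)

Section DirectProducts.
Variables (K : comAlgType rat) (V : free_graded_module).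

Local Notation word := (word V).
Local Notation X := (word -> K).

Variable G : even_grading K.

Lemma big_ord_trunc n j (F : nat -> K) : (n <= j)%N ->
  (forall i, (n <= i)%N -> F i = 0) -> \sum_(i < j) F i = \sum_(i < n) F i.
Proof.
move=> le H; rewrite -(subnKC le) big_split_ord /= [X in _ + X]big1 ?addr0 // => i _.
by rewrite H // leq_addr.
Qed.

Lemma sPiD d (f g : X) : sPi G d f -> sPi G d g -> sPi G d (f + g).
Proof. by move=> [Hf f0] [Hg g0]; split; [exact: homD|rewrite funD f0 g0 addr0]. Qed.

Lemma sPiN d (f : X) : sPi G d f -> sPi G d (- f).
Proof. by move=> [Hf f0]; split; [exact: homN|rewrite funN f0 oppr0]. Qed.

Lemma sPiB d (f g : X) : sPi G d f -> sPi G d g -> sPi G d (f - g).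
Proof. by move=> Hf Hg; apply: sPiD => //; apply: sPiN. Qed.

Lemma sPi0 d : sPi G d (0 : X).
Proof. by split=> //; exact: hom0. Qed.

Lemma sPi_sum d n (F : nat -> X) : (forall i, sPi G d (F i)) ->
  sPi G d (\sum_(i < n) F i).
Proof.
move=> H; elim: n => [|n IH]; first by rewrite big_ord0; exact: sPi0.
by rewrite big_ord_recr /=; apply: sPiD.
Qed.

Lemma sPi_tensor_part n d (f : X) : sPi G d f -> sPi G d (tensor_part n f).
Proof.
move=> [Hf f0]; split; first exact: homog_tensor_part.
by rewrite /tensor_part f0 if_same.
Qed.

(* [N] cuts out the null elements of [C] and the [Q i], which are, up to null
   elements, the images of the orthogonal idempotents [P i]. *)
Lemma direct_product_idempotents (C : dg_module K V) (Q : nat -> dg_module K V)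
    (D N : X -> X) (P : nat -> X -> X) (J : nat -> nat) :
  (forall d f, mem C d f <-> sPi G d f) ->
  (forall d f, sPi G d f -> (null C d f <-> N f = 0)) ->
  (forall d f, sPi G d f -> diff C f = D f) ->
  (forall i d f, mem (Q i) d f <->
     sPi G d f /\ exists2 g, sPi G d g & N (f - P i g) = 0) ->
  (forall i d f, sPi G d f -> (null (Q i) d f <-> N f = 0)) ->
  (forall i d f, sPi G d f -> diff (Q i) f = D f) ->
  lincont D -> lincont N -> (forall i, lincont (P i)) ->
  size_graded N -> (forall i, size_graded (P i)) ->
  (forall d f, sPi G d f -> sPi G (d + 1) (D f)) ->
  (forall i d f, sPi G d f -> sPi G d (P i f)) ->
  (forall i f w, (J (size w) <= i)%N -> P i f w = 0) ->
  (forall f w, f [::] = 0 -> \sum_(i < J (size w)) P i f w = f w) ->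
  (forall i j f, f [::] = 0 -> P i (P j f) = if i == j then P j f else 0) ->
  (forall i f, f [::] = 0 -> N f = 0 -> N (P i f) = 0) ->
  (forall f, f [::] = 0 -> N f = 0 -> N (D f) = 0) ->
  (forall n f w, (forall u, (size u <= n)%N -> f u = 0) -> (size w <= n)%N -> D f w = 0) ->
  (forall i f, f [::] = 0 -> D (P i f) = P i (D f)) ->
  direct_product C Q.
Proof.
move=> Cm Cn Cd Qm Qn Qd LD LN LP sN sP DPi PPi PJ Psum PP PN DN Dlow PD.
have Nt n f : N (tensor_part n f) = tensor_part n (N f) by exact: sg_tensor_part.
have Pt i n f : P i (tensor_part n f) = tensor_part n (P i f) by exact: sg_tensor_part.
have Lt n := @lc_tensor_partE K V n.
have Ntail d x y n j : (forall i, mem (Q i) d (x i)) -> mem C d y ->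
    (null C d (tensor_part n (y - \sum_(i < j) x i)) <->
     N (tensor_part n (y - \sum_(i < j) x i)) = 0).
  move=> Hx Hy; apply: Cn; apply: sPi_tensor_part; apply: sPiB; first exact/Cm.
  by apply: sPi_sum => i; case/Qm: (Hx i).
have Hnull d (y : X) (x : nat -> X) : (forall n, exists M, forall j, (M <= j)%N ->
      N (tensor_part n (y - \sum_(i < j) x i)) = 0) ->
    (forall i, mem (Q i) d (x i)) -> sPi G d y ->
    (null C d y <-> forall i, null (Q i) d (x i)).
  move=> Sx Hx Hy.
  have Hxi i : sPi G d (x i) by case/Qm: (Hx i).
  (* Modulo the kernel of [N], which [P k] preserves, [x i] lies in the image of [P i]; so
     orthogonality holds modulo this kernel. *)
  have Nx k i : N (P k (x i)) = if k == i then N (x i) else 0.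
    have [_ [g Hg E]] := (Qm _ _ _).1 (Hx i).
    have E0 : N (P k (x i - P i g)) = 0.
      by apply: PN => //; rewrite funD funN (Hxi i).2 (PPi _ _ _ Hg).2 subr0.
    move: E E0; rewrite (lcB (LP k)) !(lcB LN) PP; last exact: Hg.2.
    move=> /eqP; rewrite subr_eq0 => /eqP -> /eqP; rewrite subr_eq0 => /eqP ->.
    by case: eqP => // _; exact: lc0.
  split=> [/(Cn _ _ Hy) Ny k|H].
    apply/Qn => //; apply/funext => w; have [M HM] := Sx (size w).
    (* Large enough for the partial sum to be null in this tensor degree and to contain the term
       [k], which [P k] then isolates. *)
    pose j := maxn M k.+1; pose z := tensor_part (size w) (\sum_(i < j) x i).
    have z0 : z [::] = 0 by apply: (sPi_tensor_part _ (sPi_sum _ Hxi)).2.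
    have Nz : N z = 0.
      have /eqP := HM j (leq_maxl _ _); rewrite (lcB (Lt _)) (lcB LN) Nt Ny (lc0 (Lt _)).
      by rewrite sub0r oppr_eq0 => /eqP.
    have := congr1 (fun h => h w) (PN k z z0 Nz).
    rewrite /z Pt Nt (lcS (LP k)) (lcS LN) /tensor_part eqxx funsum.
    have lt : (k < j)%N by rewrite leq_max leqnn orbT.
    rewrite (bigD1 (Ordinal lt)) //= Nx eqxx big1 ?addr0 // => i ne; rewrite Nx.
    by case: eqP => // Ek; case/eqP: ne; apply: val_inj.
  apply/(Cn _ _ Hy); apply/funext => w; have [M HM] := Sx (size w).
  have /(congr1 (fun h => h w)) := HM _ (leqnn M).
  rewrite (lcB (Lt _)) (lcB LN) !Nt (lcS LN) big1 => [|i _].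
    by rewrite (lc0 (Lt _)) subr0 /tensor_part eqxx.
  by apply/(Qn _ _ _ (Hxi i)).
split=> [i d f /Qm[Hf [g Hg Hfg]]|d].
  split; first exact/Cm.
  - by split=> [/(Qn _ _ _ Hf)/(Cn _ _ Hf)|/(Cn _ _ Hf)/(Qn _ _ _ Hf)].
  - rewrite (Qd _ _ _ Hf); apply/Qm; split; first exact: DPi.
    exists (D g); first exact: DPi.
    rewrite -PD; last exact: Hg.2.
    rewrite -(lcB LD); apply: DN => //.
    by rewrite funD funN Hf.2 (PPi i _ _ Hg).2 subr0.
  - rewrite (Qd _ _ _ Hf) (Cd _ _ Hf) subrr; apply/Cn; first exact: sPi0.
    exact: lc0.
split.
- move=> x Hx; have {}Hx i : exists g, sPi G d (x i) /\ sPi G d g /\ N (x i - P i g) = 0.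
    by case/Qm: (Hx i) => H [g Hg E]; exists g.
  (* The [x i] are constrained only modulo the kernel of [N], so their series may diverge. The
     chosen [P i (g i)] vanish in tensor degree n once J n <= i, and can be summed word by word. *)
  have [g Hg] := choice Hx.
  have Hy : sPi G d (fun w => \sum_(i < J (size w)) P i (g i) w).
    split=> [w|]; first by apply: gr_sum => i _; apply: (PPi _ _ _ (Hg i).2.1).1.
    by rewrite big1 // => i _; apply: (PPi _ _ _ (Hg i).2.1).2.
  exists (fun w => \sum_(i < J (size w)) P i (g i) w); first exact/Cm.
  move=> n; exists (J n) => j le; apply/Ntail.
  + move=> i; apply/Qm; split; first exact: (Hg i).1.
    by exists (g i); [exact: (Hg i).2.1|exact: (Hg i).2.2].
  + exact/Cm.
  have -> : tensor_part n ((fun w => \sum_(i < J (size w)) P i (g i) w) - \sum_(i < j) x i) =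
      - tensor_part n (\sum_(i < j) (x i - P i (g i))).
    apply/funext => w; rewrite funN /tensor_part; case: eqP => [E|_]; last by rewrite oppr0.
    have Ej : \sum_(i < J (size w)) P i (g i) w = \sum_(i < j) P i (g i) w.
      by rewrite E (big_ord_trunc le (F := fun i => P i (g i) w)) // -E => i; exact: PJ.
    rewrite !funE Ej -sumrB -sumrN; apply: eq_bigr => i _.
    by rewrite !funE; ring.
  rewrite (lcN LN) Nt (lcS LN) big1 ?(lc0 (Lt n)) ?oppr0 // => i _.
  exact: (Hg i).2.2.
- move=> y /Cm Hy; exists (fun i => P i y) => [i|].
    apply/Qm; split; first exact: PPi.
    by exists y => //; rewrite subrr (lc0 LN).
  move=> n; exists (J n) => j le; apply/(Ntail d (fun i => P i y) y n j); last 1 first.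
  + have -> : tensor_part n (y - \sum_(i < j) P i y) = 0; last exact: lc0.
    apply/funext => w; rewrite /tensor_part; case: eqP => // E.
    rewrite !funE -[y w](Psum _ w Hy.2) E.
    rewrite (big_ord_trunc le (F := fun i => P i y w)) ?subrr // -E => i; exact: PJ.
  + move=> i; apply/Qm; split; first exact: PPi.
    by exists y => //; rewrite subrr (lc0 LN).
  + exact/Cm.
- move=> x x' y y' Hx Hx' Hy Hy' Sx Sx'.
  have Syy n : exists M, forall j, (M <= j)%N ->
      N (tensor_part n ((y - y') - \sum_(i < j) (x i - x' i))) = 0.
    have [M HM] := Sx n; have [M' HM'] := Sx' n; exists (maxn M M') => j.
    rewrite geq_max => /andP[/HM/(Ntail _ _ _ _ _ Hx Hy) H /HM'/(Ntail _ _ _ _ _ Hx' Hy') H'].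
    rewrite sumrB (_ : _ - _ - _ = (y - \sum_(i < j) x i) - (y' - \sum_(i < j) x' i)).
      by rewrite (lcB (Lt n)) (lcB LN) H H' subrr.
    by apply/funext => w; rewrite !funE; ring.
  have Hxx i : mem (Q i) d (x i - x' i).
    case/Qm: (Hx i) => H [g Hg E]; case/Qm: (Hx' i) => H' [g' Hg' E'].
    apply/Qm; split; first exact: sPiB.
    exists (g - g'); first exact: sPiB.
    rewrite (_ : _ - _ = (x i - P i g) - (x' i - P i g')); first by rewrite (lcB LN) E E' subrr.
    by rewrite (lcB (LP i)); apply/funext => w; rewrite !funE; ring.
  have {Hy Hy'} Hyy : sPi G d (y - y') by apply: sPiB; exact/Cm.
  exact: (Hnull _ _ (fun i => x i - x' i) Syy Hxx Hyy).
- move=> x y Hx Hy Sx.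
  (* [D] may raise the tensor degree, so its part of degree n needs one bound valid for all degrees
     up to n. *)
  have {Sx} Sx n : exists M, forall k j, (k <= n)%N -> (M <= j)%N ->
      N (tensor_part k (y - \sum_(i < j) x i)) = 0.
    elim: n => [|n [M HM]].
      have [M HM] := Sx 0%N; exists M => k j; rewrite leqn0 => /eqP -> /HM.
      by move/(Ntail _ _ _ _ _ Hx Hy).
    have [M' HM'] := Sx n.+1; exists (maxn M M') => k j.
    rewrite geq_max leq_eqVlt ltnS => /predU1P[->|le] /andP[/(HM _ _) H /HM' H'].
      by move: H' => /(Ntail _ _ _ _ _ Hx Hy).
    exact: H.
  move=> n; have [M HM] := Sx n; exists M => j le.
  have Hxi i : sPi G d (x i) by case/Qm: (Hx i).
  have {Hy} Hy : sPi G d y by exact/Cm.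
  have Hf : sPi G d (y - \sum_(i < j) x i) by apply: sPiB => //; exact: sPi_sum.
  have E : diff C y - \sum_(i < j) diff (Q i) (x i) = D (y - \sum_(i < j) x i).
    rewrite (lcB LD) (lcS LD) (Cd _ _ Hy); congr (_ - _); apply: eq_bigr => i _.
    exact: Qd (Hxi i).
  rewrite E; apply/Cn; first by apply: sPi_tensor_part; exact: DPi.
  move: (y - \sum_(i < j) x i) (HM ^~ j) Hf => {HM E Sx Hxi Hx Hy} f HM Hf.
  (* As [D] does not lower the tensor degree, truncating above n leaves this part of [D f]
     unchanged. The truncation is killed by [N], whereas [f] itself need not be. *)
  pose h := \sum_(k < n.+1) tensor_part k f.
  have Eh : tensor_part n (D f) = tensor_part n (D h).
    apply/eqP; rewrite -subr_eq0 -(lcB (Lt n)) -(lcB LD); apply/eqP/funext => w.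
    rewrite /tensor_part; case: eqP => // Ew; apply: (@Dlow n); last by rewrite Ew.
    move=> u leu; rewrite /h !funE /tensor_part (bigD1 (Ordinal (n := n.+1) (m := size u) leu)) //=.
    rewrite eqxx big1 ?addr0 ?subrr // => k ne; case: eqP => // Ek; case/eqP: ne.
    exact: val_inj.
  rewrite Eh Nt DN ?(lc0 (Lt n)) //.
    by apply: (sPi_sum _ (fun k => sPi_tensor_part k Hf)).2.
  by rewrite (lcS LN) big1 // => k _; apply: HM => //; rewrite -ltnS.
Qed.

End DirectProducts.

(** * Commutators in form degrees zero and one *)

Section Splitting.
Variables (K : comAlgType rat) (V : free_graded_module).

Local Notation word := (word V).
Local Notation X := (word -> K).
Local Notation XX := (word * word -> K).
Local Notation mono := (mono K (V := V)).
Local Notation ksign := (ksign K).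
Local Notation deg := (@word_deg V).
Local Notation ldeg := (@letter_deg V).

Variable G : even_grading K.

Lemma comm0_cyc_norm (f : X) : comm0 G f -> cyc_norm f = 0.
Proof.
move=> [I [d [e [x [y [Hx Hy Hf]]]]]]; apply: (lc_has_sum (@lc_cyc_normE K V) Hf) => i.
by rewrite (bracketE (hom_pdeg (Hx i)) (hom_pdeg (Hy i))) cyc_norm_brk.
Qed.

(** With w = t_a u, the series (1 - z) h is the sum over w of the commutators of h(w) t_a and u. The
    coefficient stays with the letter to make that factor homogeneous; at a word t only w = t and
    its right rotation contribute. *)
Lemma cyc_sub_comm0 d (h : X) : homog G d h -> comm0 G (cyc_sub h).
Proof.
move=> Hh; pose M w := cyc_sub (mono w).
have cfM : colfin M.
  move=> t; exists [:: t; rotr 1 t] => w; rewrite /M /cyc_sub funD funN cycE /Defs.mono !inE.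
  case: (t =P w) => [->|_]; first by rewrite eqxx.
  case: (rotr 1 t =P w) => [->|_]; first by rewrite eqxx orbT.
  by rewrite mulr0 subr0 eqxx.
have EM : cyc_sub h = ext M h.
  move: {Hh} h; apply: lc_extX; [exact: lc_cyc_subE|exact: (lc_extM cfM)|] => w.
  by rewrite [RHS](ext_delta w cfM).
pose x (w : word) : X := if w is a :: u then h w *+: mono [:: a] else 0.
pose y (w : word) : X := if w is a :: u then mono u else 0.
have Hx w : homog G (d - deg (behead w)) (x w).
  case: w => [|a u] /=; first exact: hom0.
  have := homZ (Hh (a :: u)) (homog_mono G [:: a]).
  by rewrite !deg_cons deg_nil (_ : _ + (_ + _) = d - deg u) //; ring.
have Hy w : homog G (deg (behead w)) (y w).
  by case: w => [|a u] /=; [exact: hom0|exact: homog_mono].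
exists word, (fun w => d - deg (behead w)), (fun w => deg (behead w)), x, y; split=> // t.
have EF w : bracket (d - deg (behead w)) (deg (behead w)) (x w) (y w) t = h w * M w t.
  rewrite (bracketE (hom_pdeg (Hx w)) (hom_pdeg (Hy w))) /M.
  case: w => [|a u] /=; first by rewrite brkE cyc_sub_nil !fun0 mulr0.
  by rewrite brkE cyc_sub_mono.
split.
  have [s Hs] := cfM t; apply: (@sub_finite_set _ _ [set` s]); last exact: finite_seq.
  move=> w /=; rewrite EF => ne; apply: Hs; apply: contraNneq ne => ->.
  by rewrite mulr0.
by rewrite EM /ext; apply: eq_fsbigr => w _; rewrite EF.
Qed.

Lemma sPi_cyc_sub d (f : X) : sPi G d f -> sPi G d (cyc_sub f).
Proof.
move=> [Hf f0]; split; first exact: homog_cyc_sub.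
by apply: sg_nil; [exact: lc_cyc_subE|exact: sg_cyc_sub|].
Qed.

Lemma sPi_cyc_norm d (f : X) : sPi G d f -> sPi G d (cyc_norm f).
Proof.
move=> [Hf f0]; split; first exact: homog_cyc_norm.
by apply: sg_nil; [exact: lc_cyc_normE|exact: sg_cyc_norm|].
Qed.

Lemma sPiZ_nullP d (f : X) : sPi G d f -> (sPiZ_null G d f <-> cyc_norm f = 0).
Proof.
move=> [Hf f0]; split=> [[g _ ->]|Nf]; first exact: cyc_norm_sub.
exists (cyc_prim f); last exact: cyc_sub_prim.
split; first exact: homog_cyc_prim.
by rewrite /cyc_prim big_ord0 scaler0.
Qed.

Lemma comm0P d (f : X) : sPi G d f -> (sPi G d f /\ comm0 G f <-> cyc_norm f = 0).
Proof.
move=> Hf; split=> [[_ /comm0_cyc_norm //]|Nf]; split=> //.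
by have [g [Hg _] ->] := (sPiZ_nullP Hf).2 Nf; apply: cyc_sub_comm0 Hg.
Qed.

Lemma comm1_kappa (H : XX) : comm1 G H -> kappa H = 0.
Proof.
move=> [I [d [e [x [F [Hx HF Hf]]]]]]; apply: (lc_has_sum (@lc_kappaE K V) Hf) => i.
apply: kappa_comm; first exact: hom_pdeg (Hx i).
by move=> p; apply: hom_form_pdeg; exact: ((homog_formP _ _ _).1 (HF i)).2.
Qed.

(** The expansion in [theta_kappa] becomes a convergent sum of homogeneous commutators once its
    coefficients are absorbed into the words on the left. *)
Lemma comm1_theta_kappa e (F : XX) : homog_form G e F ->
  comm1 G (theta (kappa F) - F).
Proof.
move=> /homog_formP[F0 HF].
have EF : theta (kappa F) - F = ext (@comm_theta K V) (- shift F).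
  rewrite (lcN (lc_extM (@colfin_comm_theta K V))) -theta_kappa opprB; congr (_ - _).
  by apply/funext => -[p q]; rewrite /reduce /=; case: eqP => // ->; rewrite F0.
have Hs := hom_shift HF.
pose x (p : word * word) : X := (- shift F p) *+: mono p.1.
have Hx p : homog G (e - deg p.2) (x p).
  have := homZ (gr_opp (Hs p)) (homog_mono G p.1).
  by rewrite /deg2 (_ : _ - _ + _ = e - deg p.2) //; ring.
exists (word * word)%type, (fun p => e - deg p.2), (fun p => deg p.2), x,
  (fun p => theta_word K p.2); split=> // [p|t].
  apply/homog_formP; split=> [u|]; last exact: hom_theta_word.
  case: p.2 => [//|a v]; rewrite theta_word_cons /reduce /=; done.
have EM p : (lact (x p) (theta_word K p.2) -
    ksign (e - deg p.2) (deg p.2) *+: ract (theta_word K p.2) (x p)) t =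
    (- shift F) p * comm_theta K p t.
  rewrite /x; case: p {Hx x} => u v /=.
  rewrite (lcZ (lc_lact1 _)) (lcZ (lc_ract2 _)) /comm_theta !funE /=.
  case: (eqVneq (shift F (u, v)) 0) => [->|ne]; first by rewrite !(oppr0, mul0r, mulr0, subr0).
  have nv : v != [::] by apply: contraNneq ne => ->; rewrite shift_nil.
  have -> : ract (theta_word K v) (mono u) = theta_word K (v ++ u).
    by case: v nv {ne} => [//|a v] _; exact: ract_theta_word.
  (* The commutator uses the degree of [x p], and [comm_theta] that of the word u. As [K] is even,
     their parities agree wherever the coefficient is nonzero. *)
  have p1 : par (e - deg v) = par (deg u).
    by have := hom_form_pdeg Hs ne; rewrite /= !parD parN => <-; case: (par _); case: (par _).
  by rewrite (ksign_par K p1 (erefl (par (deg v)))); ring.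
split.
  have [s Hcf] := @colfin_comm_theta K V t.
  apply: (@sub_finite_set _ _ [set` s]); last exact: finite_seq.
  move=> p /=; rewrite EM => ne; apply: Hcf; apply: contraNneq ne => ->.
  by rewrite mulr0.
by rewrite EF /ext; apply: eq_fsbigr => p _; rewrite EM.
Qed.

(** [comm1_theta_kappa] gives existence. Uniqueness holds because [kappa] kills commutators and is a
    left inverse of Theta on series without constant term. *)
Lemma theta_invE e (F : XX) : homog_form G e F -> theta_inv G F = kappa F.
Proof.
move=> HF; apply: xget_unique => [|f [f0 Hf]].
  split; last exact: comm1_theta_kappa HF.
  rewrite /kappa; apply: (lc_supp (@lc_dmulE K V)) => -[u v] _.
  by rewrite delta_tens dmul_mono cder_nil.
have := comm1_kappa Hf; rewrite (lcB (@lc_kappaE K V)) kappa_theta // => /eqP.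
by rewrite subr_eq0 => /eqP.
Qed.

Lemma lie_series_letter a : lie_series (mono [:: a]).
Proof.
exists unit, (fun=> 1), (fun=> ldeg a), (fun=> mono [:: a]); split; first by move=> _; constructor.
move=> t; split; first exact: finite_finset.
rewrite (fsum_seq (s := [:: tt])) //.
by rewrite big_seq1 scal1.
Qed.

End Splitting.

(** * The two splittings *)

Section Main.
Variables (K : comAlgType rat) (V : free_graded_module).

Local Notation word := (word V).
Local Notation X := (word -> K).

Variable G : even_grading K.
Variables (m mT : X -> X).
Hypotheses (Hm : Cinfty_structure G m) (HmT : vector_field G 1 mT).
Hypothesis HmTm : forall f : X, lie_series f -> mT f = m f.

Lemma lc_vector_field : lincont mT.
Proof.
split=> [c f g|w]; first exact: (vf_linear HmT).
by have [s Hs] := vf_continuous HmT w; exists s => f; exact: Hs.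
Qed.

Lemma homog_vector_field d (f : X) : homog G d f -> homog G (d + 1) (mT f).
Proof. exact: (vf_degree HmT). Qed.

(** The Leibniz rule, given for a homogeneous first factor, holds for words and extends to all
    series by continuity. *)
Lemma vector_field_old : odd_lie_derivation mT.
Proof.
have L := lc_vector_field; split=> // [f g|u|a].
- move: f; apply: lc_extX => [||u]; [by lc| |].
    apply: lc_add; first by lc.
    exact: (lc_comp (lc_mulr _) (@lc_sgnopE K V 1)).
  by rewrite (vf_derivation HmT _ (homog_mono G u)) sgnop_mono mulE.
- exact: hom_pdeg (homog_vector_field (homog_mono G u)).
- rewrite HmTm; last exact: lie_series_letter.
  by apply: (lvf_stable (Cinfty_vf Hm)); exact: lie_series_letter.
Qed.

Lemma hoch_bE d (f : X) : homog G d f -> hoch_b G mT f = hoch_lin mT f.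
Proof.
move=> Hf; apply: (@theta_invE _ _ G (d + 1)); apply/homog_formP; split=> [u|].
  by rewrite /lie_deriv /=.
apply: hom_lie_deriv; first by move=> *; exact: homog_vector_field.
exact: hom_theta.
Qed.

Lemma sPi_vector_field d (f : X) : sPi G d f -> sPi G (d + 1) (mT f).
Proof.
move=> [Hf f0]; split; last exact: (der_nil vector_field_old).
by rewrite addrAC; exact: homog_vector_field.
Qed.

Lemma sPi_hoch d (f : X) : sPi G d f -> sPi G (d + 1) (hoch_lin mT f).
Proof.
move=> [Hf f0]; split; last exact: hoch_lin_nil0.
rewrite addrAC; apply: hom_kappa; apply: hom_lie_deriv.
  by move=> *; exact: homog_vector_field.
exact: hom_theta.
Qed.

Lemma sPi_e i d (f : X) : sPi G d f -> sPi G d (e_op i f).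
Proof.
by move=> [Hf f0]; split; [exact: homog_e|exact: (sp_nil _ (spectral_e K V))].
Qed.

Lemma sPi_et i d (f : X) : sPi G d f -> sPi G d (et_op i f).
Proof.
by move=> [Hf f0]; split; [exact: homog_et|exact: (sp_nil _ (spectral_et K V))].
Qed.

Lemma cyclic_hochschild_split :
  direct_product (CC_Hoch G mT) (fun i => Hoch_factor G mT i.+1).
Proof.
have Hold := vector_field_old; have Sp := spectral_e K V.
(* The bound [J] is the identity because e(i+1) vanishes in tensor degrees at most i. *)
apply: (@direct_product_idempotents _ _ G _ _ mT (@cyc_norm K V)
  (fun i => @e_op K V i.+1) id) => //=.
- by move=> d f Hf; exact: comm0P.
- move=> i d f; split=> [[Hf [g Hg Hfg]]|[Hf [g Hg Hfg]]]; split=> //; exists g => //.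
    by apply/(sPiZ_nullP (sPiB Hf (sPi_e i.+1 Hg))).
  by apply/(sPiZ_nullP (sPiB Hf (sPi_e i.+1 Hg))).
- by move=> i d f; exact: sPiZ_nullP.
- exact: lc_vector_field.
- exact: lc_cyc_normE.
- by move=> i; exact: lc_eE.
- exact: sg_cyc_norm.
- by move=> i; exact: sg_e.
- by move=> d f; exact: sPi_vector_field.
- by move=> i d f; exact: sPi_e.
- by move=> i f w le; apply: e_big; rewrite ltnS.
- move=> f w f0; rewrite -[RHS](sp_sum Sp w f0) big_ord_recl /= e_zero // add0r.
  by apply: eq_bigr => i _.
- by move=> i j f f0; rewrite (sp_proj _ _ Sp f0) eqSS.
(* The idempotents act on coinvariants since N e(i+1) = \tilde e(i) N. *)
- by move=> i f f0 Nf; rewrite cyc_norm_e // Nf (lc0 (sp_lc (spectral_et K V) i)).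
- by move=> f; exact: cyc_norm_der.
- by move=> n f w; exact: der_low.
- by move=> i f f0; exact: e_der.
Qed.

(* For fixed p, the columns p of the Gamma_i are the shifts by k = p./2 of the
   eigenspaces in the column p of the Tsygan bicomplex. *)
Lemma column_split (S : X -> X) (E : nat -> X -> X) k (D b : X -> X)
    (M : nat -> int -> X -> Prop) :
  spectral S E -> lincont D ->
  (forall d f, sPi G d f -> b f = D f) ->
  (forall d f, sPi G d f -> sPi G (d + 1) (D f)) ->
  (forall i d f, sPi G d f -> sPi G d (E i f)) ->
  (forall n f w, (forall u, (size u <= n)%N -> f u = 0) -> (size w <= n)%N -> D f w = 0) ->
  (forall i f, f [::] = 0 -> D (E i f) = E i (D f)) ->
  (forall i d f, M i d f <->
     if (k <= i)%N then exists2 g, sPi G d g & f = E (i - k)%N g else f = 0) ->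
  direct_product (unquotiented (@sPi K G V) b) (fun i => unquotiented (M i) b).
Proof.
move=> Sp LD bD DPi EPi Dlow ED HM.
pose P i := if (k <= i)%N then E (i - k)%N else fun=> 0.
have MP i d f : M i d f <-> sPi G d f /\ exists2 g, sPi G d g & f - P i g = 0.
  rewrite HM /P; case: leqP => _; split.
  - by move=> [g Hg ->]; split; [exact: EPi|exists g; rewrite ?subrr].
  - by move=> [_ [g Hg /eqP]]; rewrite subr_eq0 => /eqP ->; exists g.
  - by move=> ->; split; [exact: sPi0|exists 0; [exact: sPi0|rewrite subrr]].
  - by move=> [_ [g _]]; rewrite subr0.
(* The first k of the [P i] are zero, and in tensor degree n only [E 0], ..., [E n] can follow,
   whence the bound k + n + 1. *)
apply: (@direct_product_idempotents _ _ G _ _ D id P (fun n => k + n.+1)%N) => //=.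
- exact: lc_id.
- by move=> i; rewrite /P; case: leqP => _; [exact: sp_lc Sp _|exact: lc_zero].
- exact: sg_id.
- by move=> i; rewrite /P; case: leqP => _; [exact: sp_sg Sp _|].
- by move=> i d f Hf; rewrite /P; case: leqP => _; [exact: EPi|exact: sPi0].
- move=> i f w le; rewrite /P (leq_trans _ le) ?leq_addr //.
  by apply: (sp_big Sp); rewrite ltn_subRL -addnS.
- move=> f w f0; rewrite big_split_ord /= big1 ?add0r => [|i _]; last first.
    by rewrite /P leqNgt ltn_ord.
  rewrite -[RHS](sp_sum Sp w f0); apply: eq_bigr => i _.
  by rewrite /P leq_addr addKn.
- move=> i j f f0; rewrite /P; case: (leqP k j) => lj; last first.
    by case: leqP => _; rewrite ?(lc0 (sp_lc Sp _)) if_same.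
  case: (leqP k i) => li; last by case: eqP => // Eij; move: li; rewrite Eij ltnNge lj.
  by rewrite (sp_proj _ _ Sp f0) -(eqn_add2r k) !subnK.
- by move=> i f _ ->; rewrite /P; case: leqP => _ //; rewrite (lc0 (sp_lc Sp _)).
- by move=> f _ ->; exact: lc0.
- by move=> i f f0; rewrite /P; case: leqP => _; [exact: ED|exact: lc0].
Qed.

Lemma tsygan_column_split p :
  direct_product (col (CC_Tsygan G mT) p) (fun i => col (Gamma_ G mT i) p).
Proof.
have Hold := vector_field_old; rewrite /= /tsygan_diff; case Ep: (odd p).
  apply: (@column_split _ _ p./2 mT _ _ (spectral_e K V)) => //.
  - exact: lc_vector_field.
  - by move=> d f; exact: sPi_vector_field.
  - by move=> i d f; exact: sPi_e.
  - by move=> n f w; exact: der_low.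
  - by move=> i f f0; exact: e_der.
  (* In odd columns [Gamma_col] is zero for i = p./2, where [column_split] expects the image of
     e(0); that image is zero as well. *)
  move=> i d f; rewrite /Gamma_col Ep [(_ <= i)%N in X in _ <-> X]leq_eqVlt; case: ltngtP => [_|_|Ei] /=; [by []|by []|].
  rewrite Ei subnn; split=> [->|[g Hg ->]]; last by apply: e_zero; exact: Hg.2.
  by exists 0; [exact: sPi0|rewrite (lc0 (@lc_eE K V 0))].
apply: (@column_split _ _ p./2 (hoch_lin mT) _ _ (spectral_et K V)) => //.
- exact: lc_hoch_linE.
- by move=> d f [Hf _]; exact: hoch_bE Hf.
- by move=> d f; exact: sPi_hoch.
- by move=> i d f; exact: sPi_et.
- by move=> n f w; exact: hoch_lin_low.
- by move=> i f f0; exact: et_hoch.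
- by move=> i d f; rewrite /Gamma_col Ep.
Qed.

Lemma tsygan_hor_Gamma i p d (f : X) : Gamma_col G i p d f ->
  Gamma_col G i p.+1 d (tsygan_hor p f).
Proof.
rewrite /Gamma_col /tsygan_hor /= uphalf_half; case Ep: (odd p) => /=.
  rewrite add1n; case: ltnP => [lt [g Hg ->]|_ ->]; last exact: (lc0 (@lc_cyc_normE K V)).
  exists (cyc_norm g); first exact: sPi_cyc_norm.
  by rewrite -(subnSK lt) cyc_norm_e //; exact: Hg.2.
rewrite add0n; case: ltngtP => [lt [g Hg ->]|_ ->|E [g Hg ->]].
- exists (cyc_sub g); first exact: sPi_cyc_sub.
  by rewrite cyc_sub_et //; exact: Hg.2.
- exact: (lc0 (@lc_cyc_subE K V)).
(* At the end of Gamma_i, 1 - z takes \tilde Q_0 into the image of e(0), which is zero; so the row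
   can stop there. *)
- rewrite cyc_sub_et; last exact: Hg.2.
  by rewrite E subnn e_zero //; exact: (sPi_cyc_sub Hg).2.
Qed.

Lemma tsygan_split : bi_direct_product (CC_Tsygan G mT) (fun i => Gamma_ G mT i).
Proof.
split=> [p|i p d f Hf|p d x y _ _ Hxy].
- exact: tsygan_column_split.
- by split; [exact: tsygan_hor_Gamma|rewrite /= subrr].
have [Lh sh] : lincont (@tsygan_hor K V p) /\ size_graded (@tsygan_hor K V p).
  rewrite /tsygan_hor; case: odd; split.
  - exact: lc_cyc_normE.
  - exact: sg_cyc_norm.
  - exact: lc_cyc_subE.
  - exact: sg_cyc_sub.
(* The horizontal maps preserve the tensor degree, so the bound for the source also serves the
   target. *)
move=> n; have [M HM] := Hxy n; exists M => j /HM /= E.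
by rewrite -(lcS Lh) -(lcB Lh) -(sg_tensor_part _ _ Lh sh) E (lc0 Lh).
Qed.

End Main.

Theorem theorem8p3 (K : comAlgType rat) (G : even_grading K)
  (V : free_graded_module)
  (m : (word V -> K) -> (word V -> K))
  (Hm : Cinfty_structure G m)
  (mT : (word V -> K) -> (word V -> K))
  (HmT : vector_field G 1 mT)
  (HmTm : forall f : word V -> K, lie_series f -> mT f = m f) :
  direct_product (CC_Hoch G mT) (fun i => Hoch_factor G mT i.+1) /\
  bi_direct_product (CC_Tsygan G mT) (fun i => Gamma_ G mT i).
Proof.
split; first exact: cyclic_hochschild_split Hm HmT HmTm.
exact: tsygan_split Hm HmT HmTm.
Qed.
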